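(* Let $\bm{\mu}=(\mu_1,\ldots,\mu_r)=\mathcal{N}(\sigma_1,\ldots,\sigma_r)$ be a Nikishin system on the unit circle, with associated arcs $\Gamma_1,\ldots,\Gamma_r$. Then: (i) If $\bm{n}=(n_1,\ldots,n_r)\in\mathbb{N}^r$ with each $n_j$ odd and $n_1\ge n_2\ge\cdots\ge n_r$, then $\bm{\mu}$ is AT on $\Gamma_1$ at $\bm{n}$. (ii) If $\bm{n}=(n_1,\ldots,n_r)\in\mathbb{N}^r$ with each $n_j$ even and $n_1\ge n_2\ge\cdots\ge n_r$, then $\bm{\mu}$ is AT on $\Gamma_1$ at $\bm{n}$. As a result, any index in (i) or (ii) is $\phi$-normal with respect to $\bm{\mu}$.
   Context: $r\ge1$; $\mathbb{N}=\{0,1,2,\ldots\}$; $|\bm{n}|=n_1+\cdots+n_r$; $\partial\mathbb{D}$ is the complex unit circle. An arc is a set $\Gamma=\{e^{i\theta}:\alpha\le\theta\le\beta\}$ with $0<\beta-\alpha\le2\pi$; $\mathring{\Gamma}$ is its interior in $\partial\mathbb{D}$. For $\Gamma\subseteq\partial\mathbb{D}$, $\mathcal{M}(\Gamma)$ is the set of all finite Borel measures of constant sign (either positive or negative), with all moments finite and with infinite support contained in $\Gamma$. Square root. The branch $z^{1/2}=|z|^{1/2}\exp\big(i\arg_{[t_0,t_0+2\pi)}(z)/2\big)$ is used, where $t_0\in\mathbb{R}$ is fixed so that $e^{it_0}\notin\Gamma_j$ for every $j$ (possible by the definition of a Nikishin system below); half-integer powers of $z$ are powers of this $z^{1/2}$.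 Carathéodory function. $F_\mu(z)=\int_{\partial\mathbb{D}}\frac{w+z}{w-z}\,d\mu(w)$. One has $iF_\mu(z)\in\mathbb{R}$ for $z\in\partial\mathbb{D}\setminus\operatorname{supp}\mu$. Brackets. Given two arcs $\Gamma_1,\Gamma_2$ with $\mathring{\Gamma}_1\cap\mathring{\Gamma}_2=\varnothing$ and two measures $\sigma_1\in\mathcal{M}(\Gamma_1)$, $\sigma_2\in\mathcal{M}(\Gamma_2)$, $\langle\sigma_1,\sigma_2\rangle$ denotes the finite measure on $\Gamma_1$ given by $d\langle\sigma_1,\sigma_2\rangle(z)=iF_{\sigma_2}(z)\,d\sigma_1(z)$; writing $\langle\sigma_1,\sigma_2\rangle$ includes the implicit assumption that such a finite measure exists. The same formula is used for iterated brackets, which are nested to the right: $\langle\sigma_j\rangle=\sigma_j$, $\langle\sigma_j,\sigma_{j+1},\ldots,\sigma_d\rangle=\langle\sigma_j,\langle\sigma_{j+1},\ldots,\sigma_d\rangle\rangle$. Nikishin system on the unit circle. $\bm{\mu}=(\mu_1,\ldots,\mu_r)\in\mathcal{M}(\partial\mathbb{D})^r$ forms a Nikishin system on the unit circle generated by $(\sigma_1,\ldots,\sigma_r)$, written $\bm{\mu}=\mathcal{N}(\sigma_1,\ldots,\sigma_r)$, if there is a collection of arcs $\Gamma_1,\ldots,\Gamma_r$ with $\mathring{\Gamma}_j\cap\mathring{\Gamma}_{j+1}=\varnothing$ for $j=1,\ldots,r-1$ and $\partial\mathbb{D}\setminus\bigcup_{j=1}^r\Gamma_j\ne\varnothing$,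 and measures $\sigma_j\in\mathcal{M}(\Gamma_j)$, $j=1,\ldots,r$, so that $\mu_1=\sigma_1$, $\mu_2=\langle\sigma_1,\sigma_2\rangle$, $\mu_3=\langle\sigma_1,\langle\sigma_2,\sigma_3\rangle\rangle$, ..., $\mu_r=\langle\sigma_1,\langle\sigma_2,\ldots,\sigma_r\rangle\rangle$. Each $\mu_j$ is then absolutely continuous with respect to $\sigma_1$, with Radon–Nikodym derivative $1$ for $j=1$ and $iF_{\langle\sigma_2,\ldots,\sigma_j\rangle}$ for $j\ge2$; these are the weights in the AT property below, with $\sigma_1$ as the reference measure. Chebyshev system. A collection of continuous functions $f_1,\ldots,f_n$ on $\Gamma$ is a Chebyshev system on $\Gamma$ if $\det(f_i(z_j))_{i,j=1}^n\ne0$ for every choice of distinct points $z_1,\ldots,z_n\in\Gamma$. AT system on the unit circle. Let $\Gamma$ be an arc and $\mu\in\mathcal{M}(\Gamma)$ of infinite support. For each $j=1,\ldots,r$, let $d\mu_j=w_j\,d\mu$ be a positive measure that is absolutely continuous with respect to $\mu$ (the $w_j$ are real-valued). The system $(\mu_1,\ldots,\mu_r)$ is an AT system on $\Gamma$ at $\bm{n}\in\mathbb{N}^r$ if the $|\bm{n}|$ functions $z^{-(n_j-1)/2}w_j(z),\,z^{-(n_j-3)/2}w_j(z),\ldots,z^{(n_j-1)/2}w_j(z)$, $1\le j\le r$, form a Chebyshev system on $\Gamma$. $\phi$-normality. An index $\bm{n}\in\mathbb{N}^r$ is $\phi$-normal with respect to $\bm{\mu}$ if there exists a unique $\phi_{\bm{n}}$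 of the form $\phi_{\bm{n}}(z)=z^{|\bm{n}|/2}+\kappa_{|\bm{n}|/2-1}z^{|\bm{n}|/2-1}+\cdots+\kappa_{-|\bm{n}|/2}z^{-|\bm{n}|/2}$ (exponents decreasing in steps of $1$) satisfying, for every $j=1,\ldots,r$, $\int\phi_{\bm{n}}(z)z^{-k}\,d\mu_j(z)=0$ for $k=-n_j/2,-n_j/2+1,\ldots,n_j/2-1$.
   Formalization: If Γ₁ and Γ₂ share an endpoint, a weight iF may diverge there, so AT on all of Γ₁ fails; the Chebyshev property is proved at all points of Γ₁ (including its interior) where the weights converge. AT measures may have constant sign instead of being positive. *)

(* Defs.v *)
(* MathComp-Analysis, with the complex numbers R[i] of real-closed. *)
From HB Require Import structures.
From mathcomp Require Import all_boot all_order all_algebra.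
From mathcomp Require Import all_classical all_reals all_analysis.
From mathcomp Require Import complex.

Set Implicit Arguments.
Unset Strict Implicit.
Unset Printing Implicit Defensive.

Import Order.TTheory GRing.Theory Num.Theory numFieldNormedType.Exports.

Local Open Scope classical_set_scope.
Local Open Scope ring_scope.

(* Wrapping R[i] as a numClosedFieldType gives it the norm topology that
   MathComp-Analysis puts on every numFieldType. *)
Definition C (R : realType) : numClosedFieldType := R[i].

(* Finite signed Borel measures are charges on the Borel sigma-algebra of C. *)
Definition borelC (R : realType) : measurableType (@open (C R)).-sigma :=
  g_sigma_algebraType (@open (C R)).
Notation borel_charge R := (charge (borelC R) R).

Section integration.
Variable R : realType.
Implicit Types (nu : borel_charge R) (D : set (C R)) (f : C R -> C R).

Let hahn_pos nu := cid (Hahn_decomposition nu).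
Let hahn_neg nu := cid (svalP (hahn_pos nu)).

(* The measures below do not depend on the Hahn decomposition chosen. *)
Definition pos_part nu : {measure set (borelC R) -> \bar R} :=
  jordan_pos (svalP (hahn_neg nu)).
Definition neg_part nu : {measure set (borelC R) -> \bar R} :=
  jordan_neg (svalP (hahn_neg nu)).
Definition var_measure nu : {measure set (borelC R) -> \bar R} :=
  charge_variation (svalP (hahn_neg nu)).

Definition cintegrable nu D f : Prop :=
  (var_measure nu).-integrable D (fun z => (complex.Re (f z))%:E) /\
  (var_measure nu).-integrable D (fun z => (complex.Im (f z))%:E).

Definition sint nu D (g : C R -> R) : R :=
  Rintegral (pos_part nu) D g - Rintegral (neg_part nu) D g.

Definition cint nu D f : C R :=
  (sint nu D (fun z => complex.Re (f z)) +i*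
   sint nu D (fun z => complex.Im (f z)))%C.

End integration.

Section circle.
Variable R : realType.
Implicit Types (Gamma E : set (C R)).

Definition circle : set (C R) := [set z | `|z| = 1].

Definition expi (theta : R) : C R := (cos theta +i* sin theta)%C.

Definition is_arc Gamma : Prop :=
  exists alpha beta : R, [/\ 0 < beta - alpha, beta - alpha <= 2 * pi
    & Gamma = [set expi theta | theta in `[alpha, beta]]].

Definition circle_interior Gamma : set (C R) :=
  [set z | circle z /\ \forall w \near z, circle w -> Gamma w].

(* arg_{[t0, t0 + 2 pi)}; the value at z = 0 is arbitrary. *)
Definition arg_from (t0 : R) (z : C R) : R :=
  xget t0 [set theta | t0 <= theta < t0 + 2 * pi /\ z = `|z| * expi theta].

Definition sqrt_from (t0 : R) (z : C R) : C R :=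
  sqrtC `|z| * expi (arg_from t0 z / 2).

(* z^{m/2} *)
Definition hpow (t0 : R) (z : C R) (m : int) : C R := sqrt_from t0 z ^ m.

Definition chebyshev_system E (I : finType) (f : I -> C R -> C R) : Prop :=
  (forall i, {within E, continuous (f i)}) /\
  (forall z : 'I_#|I| -> C R, injective z -> (forall k, E (z k)) ->
     \det (\matrix_(i, k) f (enum_val i) (z k)) != 0).

End circle.

Arguments circle {R}.

Section measures_on_arcs.
Variable R : realType.
Implicit Types (nu s t : borel_charge R) (Gamma D A : set (C R)).

Definition supp nu : set (C R) :=
  [set z | forall U : set (C R), open U -> U z -> (0 < var_measure nu U)%E].

Definition constant_sign nu : Prop :=
  (forall A : set (borelC R), measurable A -> (0 <= nu A)%E) \/
  (forall A : set (borelC R), measurable A -> (nu A <= 0)%E).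

(* The class M(Gamma); finiteness of nu is part of being a charge. *)
Definition measures_on Gamma nu : Prop :=
  [/\ constant_sign nu,
      forall k : int, cintegrable nu circle (fun z => z ^ k),
      infinite_set (supp nu)
    & supp nu `<=` Gamma].

(* t is the finite measure dt = w ds on the circle, where the function w is
   meaningful on D only. The values of w are complex numbers; the last clause
   forces the integrals of w to be real. *)
Definition has_density s D (w : C R -> C R) t : Prop :=
  [/\ {ae var_measure s, forall z, circle z -> D z},
      cintegrable s circle w
    & forall A : set (borelC R), measurable A ->
        (fine (t A))%:C%C = cint s (A `&` circle) w].

Definition cara_kernel (z w : C R) : C R := (w + z) / (w - z).

Definition caratheodory nu (z : C R) : C R := cint nu circle (cara_kernel z).

(* The points where the integral defining F_nu converges absolutely. The first
   clause is needed because cara_kernel z z is 0 by the convention x / 0 = 0,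
   so that integrability alone would ignore an atom of nu at z. *)
Definition cara_dom nu : set (C R) :=
  [set z | var_measure nu [set z] = 0%E /\ cintegrable nu circle (cara_kernel z)].

Definition icara nu (z : C R) : C R := 'i * caratheodory nu z.

Definition is_bracket s nu t : Prop := has_density s (cara_dom nu) (icara nu) t.

(* <s, nu>, to be used when [exists t, is_bracket s nu t]; t is then unique
   on Borel sets. *)
Definition bracket s nu : borel_charge R :=
  if pselect (exists t, is_bracket s nu t) is left h then sval (cid h)
  else czero.

End measures_on_arcs.

(* Systems of r.+1 >= 1 measures, indexed from 0. *)
Section systems.
Variables (R : realType) (r : nat).
Implicit Types (Gamma : 'I_r.+1 -> set (C R)).
Implicit Types (sigma mu : 'I_r.+1 -> borel_charge R) (n : 'I_r.+1 -> nat).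

(* <sigma_i, sigma_{i+1}, ..., sigma_{i+k}>, for i + k <= r *)
Fixpoint iter_bracket sigma (i k : nat) : borel_charge R :=
  if k is k'.+1 then bracket (sigma (inord i)) (iter_bracket sigma i.+1 k')
  else sigma (inord i).

Record nikishin Gamma sigma mu : Prop := Nikishin {
  nikishin_arc : forall j, is_arc (Gamma j);
  nikishin_disjoint : forall j k : 'I_r.+1, k = j.+1 :> nat ->
    circle_interior (Gamma j) `&` circle_interior (Gamma k) = set0;
  nikishin_proper : circle `\` \bigcup_j Gamma j !=set0;
  nikishin_generator : forall j, measures_on (Gamma j) (sigma j);
  nikishin_bracket : forall i k : nat, (i + k.+1 <= r)%N ->
    exists t, is_bracket (sigma (inord i)) (iter_bracket sigma i.+1 k) t;
  nikishin_measure : forall j, measures_on circle (mu j);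
  nikishinE : forall (j : 'I_r.+1) (A : set (borelC R)), measurable A ->
    mu j A = iter_bracket sigma 0 j A
}.

(* The density of mu_j with respect to sigma_0, and where it is defined. *)
Definition weight sigma (j : 'I_r.+1) : C R -> C R :=
  if (j : nat) is k.+1 then icara (iter_bracket sigma 1 k) else fun=> 1.

Definition weight_dom sigma (j : 'I_r.+1) : set (C R) :=
  if (j : nat) is k.+1 then cara_dom (iter_bracket sigma 1 k) else setT.

Definition AT_fun (t0 : R) (w : 'I_r.+1 -> C R -> C R) n
    (p : {j : 'I_r.+1 & 'I_(n j)}) (z : C R) : C R :=
  hpow t0 z ((2 * tagged p)%N%:Z - (n (tag p))%:Z + 1) * w (tag p) z.

(* (mu_j) is AT on G at n, with reference measure nu and densities w_j. The
   density w_j is a function on D_j, which contains G except possibly for end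
   points of G. The Chebyshev property is asserted at all points of G where the
   functions of the system are defined, that is, on all of G if G is contained
   in each D_j. The mu_j are of constant sign, not necessarily positive. *)
Definition AT_system (t0 : R) (G : set (C R)) (nu : borel_charge R)
    (D : 'I_r.+1 -> set (C R)) (w : 'I_r.+1 -> C R -> C R) mu n : Prop :=
  [/\ measures_on G nu,
      forall j, constant_sign (mu j) /\ has_density nu (D j) (w j) (mu j),
      forall j, circle_interior G `<=` D j,
      forall j z, G z -> D j z -> w j z \is Num.real
    & chebyshev_system [set z | G z /\ forall j, (0 < n j)%N -> D j z]
        (AT_fun t0 w (n := n))].

Definition index_length n : nat := (\sum_j n j)%N.

(* phi(z) = z^{N/2} + kappa_0 z^{N/2-1} + ... + kappa_{N-1} z^{-N/2} *)
Definition phi_form (t0 : R) (N : nat) (phi : C R -> C R) : Prop :=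
  exists kappa : 'I_N -> C R, forall z, phi z =
    hpow t0 z N%:Z + \sum_(l < N) kappa l * hpow t0 z (N%:Z - (2 * l.+1)%N%:Z).

(* l indexes k = - n_j / 2 + l, so that z^{-k} = z^{(n_j - 2 l) / 2} *)
Definition phi_orthogonal (t0 : R) mu n (phi : C R -> C R) : Prop :=
  forall (j : 'I_r.+1) (l : 'I_(n j)),
    cint (mu j) circle
      (fun z => phi z * hpow t0 z ((n j)%:Z - (2 * l)%N%:Z)) = 0.

Definition phi_normal (t0 : R) mu n : Prop :=
  exists! phi : C R -> C R,
    phi_form t0 (index_length n) phi /\ phi_orthogonal t0 mu n phi.

Definition nonincreasing_index n : Prop :=
  forall j k : 'I_r.+1, (j <= k)%N -> (n k <= n j)%N.

End systems.

(* Main.v *)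
(* The Cayley transform with pole e^{i t0} carries the circle to the real line,
   the functions of an AT system to real polynomials times weights, and the
   Caratheodory kernel, up to the factor -i, to (1 + x y) / (y - x).
   One argues by downward induction on the level i, for the forms
   sum_{j >= i} P_j w_{i,j} with size P_j <= n_j, where w_{i,j} is the density of
   <sigma_i, ..., sigma_j> with respect to sigma_i. If such a form had as many
   zeros as there are coefficients, a divided difference at these zeros would
   eliminate P_i (n_i is the largest index) and turn the form into a form of level
   i + 1 that is orthogonal, for a measure of constant sign, to all polynomials of
   degree less than n_{i+1} + ... + n_r. A form orthogonal to so many polynomials
   changes sign, hence vanishes, as often as it has coefficients, which the
   zero bound of its own level forbids. At level 0 the zero bound is the
   Chebyshev property, and non-orthogonality is the regularity of the linear
   system that determines phi_n. *)
From HB Require Import structures.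
Require Import Defs.
From mathcomp Require Import all_boot all_order all_algebra.
From mathcomp Require Import all_classical all_reals all_analysis.
From mathcomp Require Import measurable_realfun complex ring lra zify.

Set Implicit Arguments.
Unset Strict Implicit.
Unset Printing Implicit Defensive.

Import Order.TTheory GRing.Theory Num.Theory numFieldNormedType.Exports.

Local Open Scope classical_set_scope.
Local Open Scope ring_scope.

(** * Divided differences and sign changes of polynomials *)

(** Common parity makes every n_i - n_j even, so the powers of the square root of 1 + x^2 that come
    with half-integer powers of z differ by polynomial factors (1 + x^2)^((n_i - n_j)/2);
    monotonicity keeps the exponents nonnegative. Such a factor brings the size of P_j up to n_i at
    most, so that after multiplication by a test polynomial every term still has fewer coefficients
    than there are nodes. The obstacle lies at the end points: consecutive arcs may touch, and a
    weight need not converge at a common end point. The remedy is that on an interval missing y the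
    kernel (1 + x y) / (y - x) increases with x, so its values at two points dominate those in
    between. Hence the part of an arc where a weight converges is convex in the Cayley coordinate,
    and the weight is continuous on all of it, which is what counting sign changes requires.
    Disjointness of interiors also fixes the sign of prod_k (y - x_k) on the next arc when the nodes
    x_k lie on the previous one; this is why the new measure has constant sign. *)

Section lagrange.
Variables (F : fieldType) (N : nat) (x : 'I_N -> F).
Hypothesis x_inj : injective x.

(** The derivative at [x k] of the nodal polynomial, that is, the denominator in the Lagrange
    formula and in divided differences. *)
Definition node_diff (k : 'I_N) : F := \prod_(l | l != k) (x k - x l).

Lemma node_diff_neq0 k : node_diff k != 0.
Proof.
apply/prodf_neq0 => l lk; rewrite subr_eq0.
by apply: contra lk => /eqP/x_inj ->.
Qed.

Lemma horner_prod_others (k m : 'I_N) :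
  (\prod_(l | l != k) ('X - (x l)%:P)).[x m] =
  if m == k then node_diff k else 0.
Proof.
rewrite horner_prod; case: eqP => [->|/eqP mk].
  by apply: eq_bigr => l _; rewrite hornerXsubC.
by rewrite (bigD1 m) //= hornerXsubC subrr mul0r.
Qed.

Lemma size_prod_others (k : 'I_N) :
  size (\prod_(l | l != k) ('X - (x l)%:P)) = N.
Proof.
rewrite size_prod; last by move=> l _; rewrite polyXsubC_eq0.
under eq_bigr => l _ do rewrite size_XsubC.
rewrite sum_nat_const.
have -> : #|[pred l | l != k]| = N.-1.
  by have := cardC1 k; rewrite card_ord.
by case: N k => [[]//|n k] /=; lia.
Qed.

Lemma lagrange_interpolation (f : {poly F}) : (size f <= N)%N ->
  f = \sum_k (f.[x k] / node_diff k) *: \prod_(l | l != k) ('X - (x l)%:P).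
Proof.
move=> sf; apply/eqP; rewrite -subr_eq0; set g := (X in f - X).
apply: contraT => fg0.
pose rs := [seq x i | i <- enum 'I_N].
have := @max_poly_roots F (f - g) rs fg0.
rewrite size_map size_enum_ord => /(_ _ _)/wrap[].
- apply/allP => _ /mapP[k _ ->]; rewrite /root hornerD hornerN horner_sum.
  rewrite (bigD1 k) //= hornerZ horner_prod_others eqxx.
  rewrite divfK ?node_diff_neq0 // big1 ?addr0 ?subrr // => m mk.
  by rewrite hornerZ horner_prod_others eq_sym (negPf mk) mulr0.
- by rewrite map_inj_uniq ?enum_uniq.
rewrite ltnNge (leq_trans (size_polyD _ _)) // geq_max sf size_polyN.
apply: (leq_trans (size_sum _ _ _)); apply/bigmax_leqP => k _.
by rewrite (leq_trans (size_scale_leq _ _)) // size_prod_others.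
Qed.

(** The sum is the coefficient of degree N - 1 in the interpolation formula, since the polynomials
    in that formula are monic of size N. *)
Lemma divided_difference_low (f : {poly F}) : (size f < N)%N ->
  \sum_k f.[x k] / node_diff k = 0.
Proof.
move=> sf; have := lagrange_interpolation (ltnW sf).
move/(congr1 (fun p : {poly F} => p`_N.-1)).
rewrite coef_sum [X in X = _]nth_default; last by rewrite -ltnS (ltn_predK sf).
move=> f0; rewrite [RHS]f0; apply: eq_bigr => k _; rewrite coefZ.
suff -> : (\prod_(l | l != k) ('X - (x l)%:P))`_N.-1 = 1 by rewrite mulr1.
rewrite -[in N.-1](size_prod_others k).
by apply/eqP; rewrite -[_ == 1]/(_ \is monic); apply: monic_prod => l _; apply: monicXsubC.
Qed.

(** Interpolation of f * (1 + y X), evaluated at y and divided by the nodal product at y. The strict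
    bound on the size of f leaves room for the linear factor, and the value of that factor at y is
    the origin of 1 + y^2. *)
Lemma divided_difference_kernel (f : {poly F}) (y : F) :
  (size f < N)%N -> (forall k, y != x k) ->
  \sum_k f.[x k] / node_diff k * ((1 + x k * y) / (y - x k)) =
  f.[y] * (1 + y ^+ 2) / \prod_k (y - x k).
Proof.
move=> sf yx; pose g := f * (1 + y *: 'X).
have sg : (size g <= N)%N.
  rewrite (leq_trans (size_polyMleq _ _)) //.
  have : (size (1 + y *: 'X)%R <= 2)%N.
    rewrite (leq_trans (size_polyD _ _)) // size_poly1 geq_max /=.
    by rewrite (leq_trans (size_scale_leq _ _)) // size_polyX.
  by lia.
have yx0 k : y - x k != 0 by rewrite subr_eq0.
have P0 : \prod_k (y - x k) != 0 by apply/prodf_neq0 => k _.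
have := congr1 (fun p => p.[y]) (lagrange_interpolation sg).
have gE z : g.[z] = f.[z] * (1 + z * y).
  by rewrite hornerM hornerD hornerZ hornerX hornerC (mulrC y).
rewrite gE horner_sum expr2 => ->; rewrite mulr_suml; apply: eq_bigr => k _.
rewrite hornerZ gE horner_prod.
under [X in _ = _ * X / _]eq_bigr => l _ do rewrite hornerXsubC.
rewrite [X in _ = _ / X](bigD1 k) //=.
set B := \prod_(_ | _) _.
have B0 : B != 0 by apply/prodf_neq0 => l _.
by field; rewrite B0 yx0 node_diff_neq0.
Qed.

End lagrange.

(** * Sign changes under an intermediate value property *)

Section sign_changes.
Variable R : realFieldType.
Implicit Types (E : set R) (L : R -> R).

(** The zero is required to lie in [E], so the property survives when [E] is cut at a zero of
    [L]. *)
Definition ivp E L := forall u v, E u -> E v -> u < v -> L u * L v < 0 ->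
  exists w, [/\ E w, u < w < v & L w = 0].

Lemma ivp_no_zero E L : ivp E L -> (forall x, E x -> L x != 0) ->
  exists b : bool, forall x, E x -> 0 <= (-1) ^+ b * L x.
Proof.
move=> ivpL L0.
have [[u [Eu Lu]]|nu] := pselect (exists u, E u /\ 0 < L u).
  exists false => v Ev; rewrite expr0 mul1r leNgt; apply/negP => Lv.
  have [uv|vu|uv] := ltgtP u v; last by move: Lu; rewrite uv ltNge ltW.
    have [|w [Ew _ /eqP]] := ivpL u v Eu Ev uv; first by rewrite pmulr_rlt0.
    by rewrite (negPf (L0 _ Ew)).
  have [|w [Ew _ /eqP]] := ivpL v u Ev Eu vu; first by rewrite pmulr_llt0.
  by rewrite (negPf (L0 _ Ew)).
exists true => v Ev; rewrite expr1 mulN1r oppr_ge0 leNgt; apply/negP => Lv.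
by apply: nu; exists v.
Qed.

(** The list is decreasing and its head y is the largest zero. Below y the induction applies; above
    y there is no zero, so [L] has a constant sign there. If the two signs agree, q is kept;
    otherwise the factor X - y is added. Positivity of q to the right of the list is carried along
    so that above y the sign of q * L is that of [L]. *)
Lemma sign_change_poly E L (s : seq R) : ivp E L -> sorted >%R s ->
  (forall x, E x -> L x = 0 -> x \in s) -> (forall x, x \in s -> L x = 0) ->
  exists (q : {poly R}) (b : bool),
    [/\ (size q <= (size s).+1)%N, forall x, root q x -> x \in s,
       forall x, all (< x) s -> 0 < q.[x]
     & forall x, E x -> 0 <= (-1) ^+ b * (q.[x] * L x)].
Proof.
elim: s E => [|y s IH] E ivpL /= ss zs sz.
  have [|b bP] := @ivp_no_zero E L ivpL.
    by move=> x Ex; apply/negP => /eqP /(zs x Ex).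
  exists 1, b; split=> [|x|x|x Ex]; rewrite ?size_poly1 ?hornerC ?ltr01 //.
    by rewrite /root hornerC oner_eq0.
  by rewrite mul1r bP.
have ys x : x \in s -> x < y.
  by move=> xs; have /allP/(_ _ xs) := order_path_min (rev_trans lt_trans) ss.
have [||x [Ex xy] Lx|x xs|q [b [sq qs qpos qb]]] := IH (E `&` [set x | x < y]).
- move=> u v [Eu uy] [Ev vy] uv /(ivpL _ _ Eu Ev uv)[w [Ew /andP[uw wv] Lw]].
  by exists w; split; rewrite ?uw //; split => //; apply: lt_trans vy.
- exact: path_sorted ss.
- have := zs x Ex Lx; rewrite inE => /orP[/eqP xy'|//].
  by move: xy; rewrite /= xy' ltxx.
- by apply: sz; rewrite inE xs orbT.
have [||c cP] := @ivp_no_zero (E `&` [set x | y < x]) L.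
- move=> u v [Eu uy] [Ev vy] uv /(ivpL _ _ Eu Ev uv)[w [Ew /andP[uw wv] Lw]].
  by exists w; split; rewrite ?uw //; split => //; apply: lt_trans uw.
- move=> x [Ex /= yx]; apply/negP => /eqP /(zs x Ex); rewrite inE.
  move=> /orP[/eqP xy|/ys xy]; first by move: yx; rewrite xy ltxx.
  by move: (lt_trans xy yx); rewrite ltxx.
have qy x : y < x -> 0 < q.[x].
  by move=> yx; apply: qpos; apply/allP => z /ys zy; apply: lt_trans yx.
have Ly : L y = 0 by apply: sz; rewrite inE eqxx.
have [bc|bc] := eqVneq b c.
  exists q, b; split=> [|x /qs xs|x /andP[_ /qpos]|x Ex] //.
  - exact: leq_trans sq _.
  - by rewrite inE xs orbT.
  have [xy|yx|->] := ltgtP x y; last by rewrite Ly !mulr0.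
    exact: qb.
  by rewrite mulrCA mulr_ge0 ?(ltW (qy _ yx)) // bc cP.
exists (q * ('X - y%:P)), c; split=> [|x|x /andP[yx /qpos qx]|x Ex].
- by rewrite (leq_trans (size_polyMleq _ _)) // size_XsubC; lia.
- by rewrite rootM root_XsubC inE => /orP[/qs ->|->]; rewrite ?orbT.
- by rewrite hornerM hornerXsubC mulr_gt0 // subr_gt0.
rewrite hornerM hornerXsubC.
have [xy|yx|->] := ltgtP x y; last by rewrite Ly !mulr0.
  have -> : (-1) ^+ c = - (-1) ^+ b :> R by move: b c bc {qb cP} =>
      [] [] //= _; rewrite !expr1 ?expr0 ?opprK.
  rewrite mulNr -mulrN mulrAC -mulrN opprB mulrA mulr_ge0 ?subr_ge0 ?(ltW xy) //.
  exact: qb.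
rewrite mulrCA mulr_ge0 ?cP // mulr_ge0 ?(ltW (qy _ yx)) //.
by rewrite subr_ge0 ltW.
Qed.

(** A list of distinct zeros of maximal length has fewer than N elements and contains all zeros,
    since any other could be appended. The list [s] is returned to record that q * L has only
    finitely many zeros in [E]. *)
Lemma sign_poly E L N : ivp E L ->
  ~ (exists s : seq R, [/\ uniq s, size s = N & forall x, x \in s -> E x /\ L x = 0]) ->
  exists (q : {poly R}) (b : bool) (s : seq R),
    [/\ (size q <= N)%N, forall x, E x -> 0 <= (-1) ^+ b * (q.[x] * L x)
      & forall x, E x -> q.[x] * L x = 0 -> x \in s].
Proof.
move=> ivpL Nz.
pose P m := `[< exists s : seq R, [/\ uniq s, size s = m & forall x, x \in s -> E x /\ L x = 0] >].
have P0 : exists m, P m by exists 0%N; apply/asboolP; exists [::].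
have PN m : P m -> (m <= N)%N.
  move=> /asboolP[s [us ss sP]]; rewrite leqNgt; apply/negP => Nm; apply: Nz.
  exists (take N s); split; first exact: take_uniq.
    by rewrite size_takel // ss ltnW.
  by move=> x /mem_take /sP.
case: (ex_maxnP P0 PN) => m Pm mmax.
have mN : (m < N)%N.
  rewrite ltn_neqAle PN // andbT; apply/eqP => mN; apply: Nz.
  by rewrite -mN; apply/asboolP.
move/asboolP: Pm => [s [us ss sP]].
have sall x : E x -> L x = 0 -> x \in s.
  move=> Ex Lx; apply: contraT => xs.
  suff /mmax : P m.+1 by rewrite ltnn.
  apply/asboolP; exists (x :: s); split; rewrite /= ?xs ?ss // => y.
  by rewrite inE => /orP[/eqP ->|/sP].
pose t := rev (sort <=%R s).
have tE : t =i s by move=> x; rewrite mem_rev mem_sort.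
have [||x|q [b [sq qs _ qb]]] := @sign_change_poly E L t ivpL.
- have := sort_lt_sorted s; rewrite us => st.
  by rewrite rev_sorted.
- by move=> x Ex Lx; rewrite tE sall.
- by rewrite tE => /sP[].
exists q, b, s; split=> [|//|x Ex /eqP].
  by rewrite (leq_trans sq) // size_rev size_sort ss.
by rewrite mulf_eq0 => /orP[/qs|/eqP]; [rewrite tE|apply: sall].
Qed.

Lemma prod_constant_sign N (x : 'I_N -> R) (D : set R) :
  (forall k, (forall y, D y -> y <= x k) \/ (forall y, D y -> x k <= y)) ->
  exists b : bool, forall y, D y -> 0 <= (-1) ^+ b * \prod_k (y - x k).
Proof.
elim: N x => [x _|N IH x xP].
  by exists false => y _; rewrite big_ord0 mulr1 expr0.
have [b bP] := IH (fun k => x (lift ord0 k)) (fun k => xP _).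
have [yx|xy] := xP ord0.
  exists (~~ b) => y Dy; rewrite big_ord_recl mulrCA -mulrNN -opprB opprK.
  by rewrite mulr_ge0 ?subr_ge0 ?yx // -mulNr -signrN negbK bP.
exists b => y Dy; rewrite big_ord_recl mulrCA mulr_ge0 ?subr_ge0 ?xy //.
exact: bP.
Qed.

End sign_changes.

(** * Integration against charges of constant sign *)

Lemma measurable_invr (R : realType) : measurable_fun [set: R] (@GRing.inv R).
Proof.
have -> : [set: R] = [set 0] `|` [set x | x != 0].
  by apply/seteqP; split => x //= _; have [->|] := eqVneq x 0; [left|right].
have o : open [set x : R | x != 0] by apply: open_neq.
rewrite measurable_funU //; last exact: open_measurable.
split; first exact: measurable_fun_set1.
apply: open_continuous_measurable_fun => // x; rewrite inE /= => x0.
exact: inv_continuous.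
Qed.

Section almost_everywhere.
Context d (T : measurableType d) (R : realType).
Variables (m : {measure set T -> \bar R}) (D : set T).
Hypothesis mD : measurable D.
Implicit Types f g : T -> R.

Lemma ae_le_integrable f g : measurable_fun D g ->
  {ae m, forall x, D x -> `|g x| <= `|f x|} ->
  m.-integrable D (EFin \o f) -> m.-integrable D (EFin \o g).
Proof.
move=> mg [A [mA A0 subA]] fi; have mg' := (measurable_EFinP _ _).2 mg.
apply/(negligible_integrable mA mD mg' A0).
have fi' : m.-integrable (D `\` A) (EFin \o f).
  by apply: integrableS fi => //; exact: measurableD.
apply: le_integrable fi' => //; first exact: measurableD.
  by apply: measurable_funS mg' => //; apply: subDsetl.
move=> x [Dx Ax]; rewrite lee_fin; apply: contrapT => H; apply: Ax; apply: subA.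
by move/(_ Dx).
Qed.

Lemma ae_eq_integrable f g : measurable_fun D g ->
  {ae m, forall x, D x -> f x = g x} ->
  m.-integrable D (EFin \o f) -> m.-integrable D (EFin \o g).
Proof.
move=> mg fg; apply: ae_le_integrable => //.
by apply: filterS fg => x H Dx; rewrite H.
Qed.

Lemma ae_eq_Rintegral f g : measurable_fun D f -> measurable_fun D g ->
  {ae m, forall x, D x -> f x = g x} -> Rintegral m D f = Rintegral m D g.
Proof.
move=> mf mg fg; congr fine; apply: ae_eq_integral => //.
- exact/measurable_EFinP.
- exact/measurable_EFinP.
- by apply: filterS fg => x H Dx; rewrite H.
Qed.

Lemma Rintegral_ge0_eq0 f : m.-integrable D (EFin \o f) ->
  {ae m, forall x, D x -> 0 <= f x} -> Rintegral m D f = 0 ->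
  {ae m, forall x, D x -> f x = 0}.
Proof.
move=> fi f0 i0; have mf := measurable_int _ fi.
have : (\int[m]_(x in D) `|(f x)%:E| = 0)%E.
  have <- : (\int[m]_(x in D) (f x)%:E = \int[m]_(x in D) `|(f x)%:E|)%E.
    apply: ae_eq_integral => //; first exact: measurableT_comp mf.
    by apply: filterS f0 => x H Dx /=; rewrite ger0_norm ?H.
  rewrite -[LHS]fineK; last exact: integrable_fin_num.
  by rewrite -[fine _]/(Rintegral m D f) i0.
move/(ae_eq_integral_abs m mD mf); apply: filterS => x /[swap] Dx /(_ Dx).
by case.
Qed.

End almost_everywhere.

(** * Measures with an integrable density *)

Section density.
Context d (T : measurableType d) (R : realType).
Variables (m : {sigma_finite_measure set T -> \bar R}).
Variables (m' : {finite_measure set T -> \bar R}) (phi : T -> R).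
Hypothesis phii : m.-integrable setT (EFin \o phi).
Hypothesis mE : forall A, measurable A -> m' A = (\int[m]_(x in A) (phi x)%:E)%E.

Lemma density_dominated : m' `<< m.
Proof.
apply/null_content_dominatesP => A mA A0; rewrite mE //.
apply: null_set_integral => //; exact: measurable_funTS (measurable_int _ phii).
Qed.

(** [phi] has the same integrals over measurable sets as the Radon-Nikodym derivative of [m'], hence
    equals it almost everywhere, and the change of variables for that derivative applies.
    Integrability is derived from the nonnegative function |f|. *)
Lemma density_change D (f : T -> R) : measurable D ->
  m'.-integrable D (EFin \o f) ->
  m.-integrable D (fun x => (f x * phi x)%:E) /\
  (\int[m]_(x in D) (f x * phi x)%:E = \int[m']_(x in D) (f x)%:E)%E.
Proof.
move=> mD fi; have dom := density_dominated.
have mphi : measurable_fun setT phi.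
  by apply/measurable_EFinP; exact: measurable_int phii.
have mf : measurable_fun D f by apply/measurable_EFinP; exact: measurable_int fi.
have mg : measurable_fun setT (Radon_Nikodym (charge_of_finite_measure m') m).
  by apply: measurable_int; exact: Radon_Nikodym_integrable.
have phig : ae_eq m setT (EFin \o phi)
    (Radon_Nikodym (charge_of_finite_measure m') m).
  apply: integral_ae_eq => // A _ mA.
  by rewrite -Radon_Nikodym_integral // -mE.
split; last first.
  rewrite -(Radon_Nikodym_change_of_variables dom mD fi).
  apply: ae_eq_integral => //.
  - apply/measurable_EFinP; apply: measurable_funM => //.
    exact: measurable_funTS.
  - apply: emeasurable_funM; last exact: measurable_funTS.
    exact/measurable_EFinP.
  - by apply: filterS phig => x /(_ I) /= H Dx; rewrite EFinM -H.
have phig' : ae_eq m setT (EFin \o phi) (Radon_Nikodym_SigmaFinite.f m' m).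
  apply: ae_eq_trans phig _.
  by apply: ae_eq_sym; apply: ae_eq_Radon_Nikodym_SigmaFinite.
have fi' : m'.-integrable D (fun x => `|(f x)%:E|%E).
  exact: (integrable_abse fi).
have := Radon_Nikodym_SigmaFinite.integrableM dom _ mD fi'.
move=> /(_ _)/wrap[]; first by move=> x; exact: abse_ge0.
move=> gi; apply: (@ae_eq_integrable _ _ _ m D mD
   (fun x => f x * fine (Radon_Nikodym_SigmaFinite.f m' m x))).
- by apply: measurable_funM => //; exact: measurable_funTS.
- by apply: filterS phig' => x /(_ I) /= <-.
have mSF : measurable_fun setT (Radon_Nikodym_SigmaFinite.f m' m).
  by apply: measurable_int; exact: Radon_Nikodym_SigmaFinite.f_integrable.
apply: le_integrable gi => //.
  apply/measurable_EFinP; apply: measurable_funM => //.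
  by apply: measurable_funTS; apply: measurableT_comp.
move=> x Dx /=.
rewrite -[leLHS]/(`|(f x * _)%:E|%E) EFinM fineK;
    last exact: Radon_Nikodym_SigmaFinite.f_fin_num.
by rewrite !abseM /= normr_id.
Qed.

End density.

Section charges.
Variable R : realType.
Implicit Types (nu s t : borel_charge R) (D A : set (borelC R)) (f g : C R -> R).

(** The three measures come from one chosen Hahn decomposition; giving it a name makes the formulas
    for the Jordan parts available. *)
Lemma hahn_exists nu : exists P N (h : hahn_decomposition nu P N),
  [/\ pos_part nu = jordan_pos h, neg_part nu = jordan_neg h
    & var_measure nu = charge_variation h].
Proof. by rewrite /pos_part /neg_part /var_measure; do 3 eexists; split. Qed.

Lemma var_measureE nu A :
  (var_measure nu A = pos_part nu A + neg_part nu A)%E.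
Proof. by []. Qed.

Lemma chargeE nu A : measurable A -> (nu A = pos_part nu A - neg_part nu A)%E.
Proof.
have [P [N [h [-> -> _]]]] := hahn_exists nu => mA.
by rewrite (jordan_decomp h mA) /cadd /= cscaleN1.
Qed.

Lemma var_fin nu A : measurable A -> var_measure nu A \is a fin_num.
Proof.
have [P [N [h [_ _ ->]]]] := hahn_exists nu => mA.
by apply: fin_num_measure.
Qed.

(** The boolean follows the convention of [(-1) ^+ b]: [true] stands for the negative part. *)
Definition sgnm nu (b : bool) : {measure set (borelC R) -> \bar R} :=
  if b then neg_part nu else pos_part nu.

Lemma sgnm_fin nu b A : measurable A -> sgnm nu b A \is a fin_num.
Proof.
have [P [N [h [E1 E2 _]]]] := hahn_exists nu => mA.
by case: b; rewrite /sgnm ?E1 ?E2; apply: fin_num_measure.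
Qed.

Lemma integral_var_ge0 nu D (f : C R -> \bar R) : measurable D ->
  measurable_fun D f -> (forall x, D x -> 0 <= f x)%E ->
  (\int[var_measure nu]_(x in D) f x = \int[pos_part nu]_(x in D) f x +
     \int[neg_part nu]_(x in D) f x)%E.
Proof.
move=> mD mf f0; rewrite -ge0_integral_measure_add //.
apply: eq_measure_integral => A mA _ /=.
by rewrite /msum !big_ord_recl big_ord0 adde0.
Qed.

Lemma integrable_varP nu D f : measurable D ->
  (var_measure nu).-integrable D (EFin \o f) <->
  forall b, (sgnm nu b).-integrable D (EFin \o f).
Proof.
move=> mD; split=> [/integrableP[mf]|fi].
  rewrite integral_var_ge0 //; last exact: measurableT_comp.
  move=> lty b; apply/integrableP; split => //; apply: le_lt_trans lty.
  case: b; rewrite /sgnm; first by rewrite leeDr // integral_ge0.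
  by rewrite leeDl // integral_ge0.
have /integrableP[mf f1] := fi true; have /integrableP[_ f2] := fi false.
apply/integrableP; split => //.
rewrite integral_var_ge0 //; last exact: measurableT_comp.
exact: lte_add_pinfty.
Qed.

Lemma sintE nu D f : sint nu D f =
  Rintegral (sgnm nu false) D f - Rintegral (sgnm nu true) D f.
Proof. by []. Qed.

Lemma sgnm_dominated nu b : sgnm nu b `<< var_measure nu.
Proof.
apply/null_content_dominatesP => A mA A0.
have /eqP : (pos_part nu A + neg_part nu A = 0)%E by [].
rewrite padde_eq0 ?measure_ge0 // => /andP[/eqP p0 /eqP n0].
by case: b.
Qed.

Lemma ae_sgnm nu b (P : C R -> Prop) :
  {ae var_measure nu, forall x, P x} -> {ae sgnm nu b, forall x, P x}.
Proof.
move=> [A [mA A0 sA]]; exists A; split => //.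
by have /null_content_dominatesP := @sgnm_dominated nu b; exact.
Qed.

Lemma sintD nu D f g : measurable D ->
  (var_measure nu).-integrable D (EFin \o f) ->
  (var_measure nu).-integrable D (EFin \o g) ->
  sint nu D (fun x => f x + g x) = sint nu D f + sint nu D g.
Proof.
move=> mD /(integrable_varP _ _ mD) fi /(integrable_varP _ _ mD) gi.
by rewrite !sintE !RintegralD //; ring.
Qed.

Lemma sintZ nu D f c : measurable D ->
  (var_measure nu).-integrable D (EFin \o f) ->
  sint nu D (fun x => c * f x) = c * sint nu D f.
Proof.
move=> mD /(integrable_varP _ _ mD) fi.
by rewrite !sintE !RintegralZl //; ring.
Qed.

Lemma sint0 nu D : sint nu D (fun=> 0) = 0.
Proof. by rewrite sintE /Rintegral !integral0 /= subr0. Qed.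

Lemma integrable_sumr (m : {measure set (borelC R) -> \bar R}) D
    (I : Type) (r : seq I) (P : pred I) (F : I -> C R -> R) :
  measurable D -> (forall i, P i -> m.-integrable D (EFin \o F i)) ->
  m.-integrable D (EFin \o (fun x => \sum_(i <- r | P i) F i x)).
Proof.
move=> mD Fi.
have -> : EFin \o (fun x => \sum_(i <- r | P i) F i x) =
    (fun x => \sum_(i <- r | P i) (EFin \o F i) x)%E.
  by apply/funext => x /=; rewrite sumEFin.
exact: integrable_sum.
Qed.

Lemma integrableZr' (m : {measure set (borelC R) -> \bar R}) D f c :
  measurable D -> m.-integrable D (EFin \o f) ->
  m.-integrable D (EFin \o (fun x => c * f x)).
Proof. by move=> mD fi; exact: (integrableZl mD c fi). Qed.

Lemma sint_sum nu D (I : Type) (r : seq I) (P : pred I) (F : I -> C R -> R) :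
  measurable D ->
  (forall i, P i -> (var_measure nu).-integrable D (EFin \o F i)) ->
  sint nu D (fun x => \sum_(i <- r | P i) F i x) =
  \sum_(i <- r | P i) sint nu D (F i).
Proof.
move=> mD Fi; elim: r => [|i r IH].
  rewrite big_nil -[RHS](sint0 nu D); congr (sint nu D).
  by apply/funext => x; rewrite big_nil.
rewrite big_cons; case: ifPn => Pi.
  rewrite -IH -sintD //; [|exact: Fi|exact: integrable_sumr].
  by congr (sint nu D); apply/funext => x; rewrite big_cons Pi.
by rewrite -IH; congr (sint nu D); apply/funext => x; rewrite big_cons (negPf Pi).
Qed.

Lemma ae_eq_sint nu D f g : measurable D -> measurable_fun D f ->
  measurable_fun D g -> {ae var_measure nu, forall x, D x -> f x = g x} ->
  sint nu D f = sint nu D g.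
Proof.
move=> mD mf mg fg.
by rewrite !sintE !(ae_eq_Rintegral mD mf mg (ae_sgnm _ fg)).
Qed.

(** The Jordan part of the wrong sign is, up to sign, the restriction of [nu] to a Hahn set on which
    [nu] is both nonnegative and nonpositive. *)
Lemma constant_sign_sgnm nu : constant_sign nu -> exists b, forall A,
  measurable A -> var_measure nu A = sgnm nu b A /\ sgnm nu (~~ b) A = 0%E.
Proof.
have [P [N [h [E1 E2 _]]]] := hahn_exists nu.
have [[mP posP] [mN negN] PN PN0] := h.
case=> [nu0|nu0].
  exists false => A mA; rewrite var_measureE /sgnm /negb E1 E2.
  suff N0 : jordan_neg h A = 0%E by split=> //; rewrite -[RHS]adde0; congr (_ + _)%E.
  rewrite jordan_negE cjordan_negE /crestr0 mem_set //= /crestr.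
  have mAN : measurable (A `&` N) by exact: measurableI.
  apply/eqP; rewrite oppe_eq0 eq_le nu0 // negN //; exact: subIsetr.
exists true => A mA; rewrite var_measureE /sgnm /negb E1 E2.
suff P0 : jordan_pos h A = 0%E by split=> //; rewrite -[RHS]add0e; congr (_ + _)%E.
rewrite jordan_posE cjordan_posE /crestr0 mem_set //= /crestr.
have mAP : measurable (A `&` P) by exact: measurableI.
apply/eqP; rewrite eq_le nu0 // posP //; exact: subIsetr.
Qed.

(** With one Jordan part zero, a signed integral becomes an integral against a positive measure, to
    which positivity arguments apply; the sign [b] is the same for all sets and integrands. *)
Lemma constant_sign_sint nu : constant_sign nu -> exists b : bool,
  (forall D f, measurable D ->
     sint nu D f = (-1) ^+ b * Rintegral (var_measure nu) D f) /\
  (forall A, measurable A -> nu A = ((-1) ^+ b * fine (var_measure nu A))%:E).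
Proof.
move=> /constant_sign_sgnm[b bP]; exists b; split=> [D f mD|A mA].
  have E1 : Rintegral (var_measure nu) D f = Rintegral (sgnm nu b) D f.
    by congr fine; apply: eq_measure_integral => A mA _; rewrite (bP A mA).1.
  have E2 : Rintegral (sgnm nu (~~ b)) D f = 0.
    rewrite /Rintegral (@eq_measure_integral _ _ _ D mzero) ?integral_measure_zero //.
    by move=> A mA _; rewrite (bP A mA).2.
  rewrite sintE E1; case: (b) E2 => /= ->; rewrite ?expr0 ?expr1; ring.
rewrite chargeE // (bP A mA).1.
have := (bP A mA).2; have := @fineK _ (sgnm nu b A) (sgnm_fin _ _ mA).
by case: (b) => /= <- ->; rewrite ?sube0 ?add0e ?sub0e ?mulN1r ?mul1r.
Qed.

End charges.

(** * Topology and Borel sets of [C R] *)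

Section topology_of_C.
Variable R : realType.
Implicit Types (nu s t : borel_charge R).

(** The radius of a ball in [C R] is itself an element of [C R]; being positive it is real, so radii
    in [R] suffice. *)
Lemma nbhs_CP (z : C R) (P : set (C R)) : nbhs z P <->
  exists2 e : R, 0 < e & forall w : C R, `|z - w| < e%:C%C -> P w.
Proof.
split=> [/nbhs_normP[e /= e0 eP]|[e e0 eP]].
  have eE : e = (complex.Re e)%:C%C.
    by rewrite RRe_real // ger0_real // ltW.
  exists (complex.Re e); first by move: e0; rewrite {1}eE ltcR.
  by move=> w zw; apply: eP; rewrite /ball_ /= eE.
apply/nbhs_normP; exists e%:C%C => /=; first by rewrite ltcR.
by move=> w; apply: eP.
Qed.

Lemma Re_le_norm (z : C R) : (`|complex.Re z|)%:C%C <= `|z| :> C R.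
Proof. exact: normc_ge_Re. Qed.

Lemma Im_le_norm (z : C R) : (`|complex.Im z|)%:C%C <= `|z| :> C R.
Proof.
have := Re_le_norm (z * 'i%C); rewrite ReiNIm normrN => /le_trans; apply.
by rewrite normrM complexiE normCi mulr1.
Qed.

Lemma Re_continuous : continuous (@complex.Re R : C R -> R).
Proof.
move=> z; apply/(@cvgrPdist_lt _ _ _ (nbhs z)) => e e0; apply/nbhs_CP; exists e => // w zw.
rewrite -ltcR; apply: le_lt_trans zw; apply: le_trans (Re_le_norm _).
by case: z w => [a b] [c d] /=.
Qed.

Lemma Im_continuous : continuous (@complex.Im R : C R -> R).
Proof.
move=> z; apply/(@cvgrPdist_lt _ _ _ (nbhs z)) => e e0; apply/nbhs_CP; exists e => // w zw.
rewrite -ltcR; apply: le_lt_trans zw; apply: le_trans (Im_le_norm _).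
by case: z w => [a b] [c d] /=.
Qed.

Lemma real_complex_continuous : continuous (fun x : R => x%:C%C : C R).
Proof.
move=> x; apply/cvgrPdist_lt => e e0.
have eE : e = (complex.Re e)%:C%C by rewrite RRe_real // ger0_real // ltW.
rewrite eE ltcR in e0.
near=> y.
have -> : x%:C%C - y%:C%C = (x - y)%:C%C :> C R by rewrite rmorphB.
rewrite normc_def /= expr0n addr0 sqrtr_sqr eE ltcR.
by near: y; apply: cvgr_dist_lt.
Unshelve. all: by end_near. Qed.

Lemma borel_open (U : set (C R)) : open U -> measurable (U : set (borelC R)).
Proof. by move=> oU; apply: sub_sigma_algebra. Qed.

Lemma continuous_borel (f : C R -> R) : continuous f ->
  measurable_fun setT (f : borelC R -> R).
Proof.
move=> /continuousP cf; apply: (measurability _ (RGenOpens.measurableE R)).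
move=> _ [_ [a [b ->] <-]]; rewrite setTI; apply: borel_open.
exact/cf/interval_open.
Qed.

Lemma measurable_Re : measurable_fun setT (@complex.Re R : borelC R -> R).
Proof. exact: continuous_borel Re_continuous. Qed.

Lemma measurable_Im : measurable_fun setT (@complex.Im R : borelC R -> R).
Proof. exact: continuous_borel Im_continuous. Qed.

Lemma closed_set1C (z : C R) : closed [set z].
Proof.
exact: (accessible_closed_set1 (hausdorff_accessible (@norm_hausdorff _ _))).
Qed.

Lemma measurable_set1C (z : C R) : measurable ([set z] : set (borelC R)).
Proof.
rewrite -[[set z]]setCK; apply: measurableC; apply: borel_open.
by rewrite openC; apply: closed_set1C.
Qed.

Lemma measurable_circle : measurable (circle : set (borelC R)).
Proof.
rewrite -[circle]setCK; apply: measurableC; apply: borel_open.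
rewrite openC.
have -> : circle = Num.norm @^-1` [set 1 : C R] by [].
apply: preimage_closed; last exact: closed_set1C.
by move=> z _; exact: norm_continuous.
Qed.

(** Each point outside the support lies in a null ball with rational centre and radius 1/(k+1).
    There are countably many such balls, so together they form a null set. *)
Lemma ae_supp nu : {ae var_measure nu, forall z, supp nu z}.
Proof.
pose U a b k : set (C R) :=
  [set w : C R | `|(ratr a +i* ratr b)%C - w| < (k.+1%:R^-1)%:C%C].
have oU a b k : open (U a b k).
  rewrite openE /= => w cw; set c := (ratr a +i* ratr b)%C : C R.
  have e0 : 0 < (k.+1%:R^-1)%:C%C - `|c - w| by rewrite subr_gt0.
  apply/nbhs_normP; exists ((k.+1%:R^-1)%:C%C - `|c - w|) => // v /=.
  rewrite /ball_ /= ltrBrDl; apply: le_lt_trans.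
  by rewrite (le_trans _ (ler_normD _ _)) // addrA subrK.
pose P (n : nat) z : Prop :=
  if (unpickle n : option (rat * rat * nat)) is Some (a, b, k) then
    var_measure nu (U a b k) = 0%E -> ~ U a b k z else True.
have aeP n : {ae var_measure nu, forall z, P n z}.
  rewrite /P; case: unpickle => [[[a b] k]|]; last exact: aeW.
  have [U0|U0] := pselect (var_measure nu (U a b k) = 0%E); last exact: aeW.
  exists (U a b k); split => //; first exact: borel_open (oU a b k).
  by move=> z /not_implyP[_]; apply: contrapT.
apply: filterS (ae_foralln aeP) => z zP V oV Vz.
rewrite lt_neqAle measure_ge0 andbT eq_sym; apply/negP => /eqP V0.
have /nbhs_CP[e e0 eV] : nbhs z V by apply: open_nbhs_nbhs.
(* A ball of radius h whose centre is within h of z stays within 2h of z, hence inside V. *)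
have [k [h [hE h0 he]]] : exists k h, [/\ h = k.+1%:R^-1 :> R, 0 < h & h < e / 4].
  have /ltr_add_invr[k] : 0 < e / 4 by rewrite divr_gt0.
  by rewrite add0r; exists k, k.+1%:R^-1; split; rewrite ?invr_gt0.
have rat_near (x : R) : exists a : rat, `|ratr a - x| < h / 2.
  have /rat_in_itvoo[a] : x - h / 2 < x + h / 2 by lra.
  by rewrite in_itv /= => /andP[xa ax]; exists a; rewrite ltr_norml; lra.
have [a az] := rat_near (complex.Re z); have [b bz] := rat_near (complex.Im z).
have norm_lt (w : C R) (x y : R) : `|complex.Re w| < x -> `|complex.Im w| < y ->
    `|w| < (x + y)%:C%C.
  move=> wx wy; rewrite [w in `|w|]complexE.
  rewrite (le_lt_trans (ler_normD _ _)) // normrM complexiE normCi mul1r.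
  by rewrite !normc_def /= !expr0n !addr0 !sqrtr_sqr -rmorphD ltcR ltrD.
have := zP (pickle (a, b, k)); rewrite /P pickleK => /(_ _)/wrap[]; last first.
  apply; rewrite /U /= -hE.
  have -> : h = h / 2 + h / 2 by lra.
  by apply: norm_lt; move: az bz; case: (z).
apply: (subset_measure0 _ _ _ V0); [exact: borel_open (oU a b k)|exact: borel_open|].
move=> w; rewrite /U /= -hE => Uw; apply: eV.
have zc : `|z - (ratr a +i* ratr b)%C| < h%:C%C.
  rewrite distrC; have -> : h = h / 2 + h / 2 by lra.
  by apply: norm_lt; move: az bz; case: (z).
rewrite -(subrK ((ratr a +i* ratr b)%C : C R) z) -addrA.
rewrite (le_lt_trans (ler_normD _ _)) // (lt_trans (ltrD zc Uw)) //.
by rewrite -rmorphD ltcR; lra.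
Qed.

End topology_of_C.

(** * Charges with a density *)

Section change_of_density.
Variable R : realType.
Implicit Types (nu s t : borel_charge R) (f : C R -> R).

(** The type of [var_measure] records only a measure; the finite structure, required for densities
    and for bounded integrands, is recovered from [var_fin]. *)
Lemma fin_measure_exists nu : exists m : {finite_measure set (borelC R) -> \bar R},
  forall A, measurable A -> m A = var_measure nu A.
Proof.
have fin : fin_num_fun (var_measure nu) by move=> A mA; exact: var_fin.
pose F := Measure_isFinite.Build _ _ _ (var_measure nu) fin.
pose m : {finite_measure set (borelC R) -> \bar R} :=
    HB.pack (Measure.sort (var_measure nu)) F.
by exists m.
Qed.

Lemma eq_measure_integrable (m m' : {measure set (borelC R) -> \bar R})
    (D : set (borelC R)) f :
  (forall A, measurable A -> m A = m' A) ->
  m.-integrable D (EFin \o f) -> m'.-integrable D (EFin \o f).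
Proof.
move=> mm' /integrableP[mf fi]; apply/integrableP; split => //.
rewrite (_ : (\int[m']_(x in D) _ = \int[m]_(x in D) `|(EFin \o f) x|)%E) //.
by apply: eq_measure_integral => A mA _; rewrite mm'.
Qed.

(** Real parts of the identity that defines [has_density], together with the constant sign of [s],
    give [t] an ordinary real density against the positive measure [var_measure s]; as that identity
    sees only A intersected with the circle, [t] is carried by the circle. *)
Lemma has_density_charge s D w t : constant_sign s -> has_density s D w t ->
  exists b : bool,
  [/\ forall f (A : set (borelC R)), measurable A ->
        sint s A f = (-1) ^+ b * Rintegral (var_measure s) A f,
      (forall A : set (borelC R), measurable A -> A `<=` (circle : set (C R)) ->
        t A = (\int[var_measure s]_(z in A) ((-1) ^+ b * complex.Re (w z))%:E)%E)
    & forall A : set (borelC R), measurable A -> t A = t (A `&` (circle : set (C R)))].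
Proof.
move=> /constant_sign_sint[b [sE _]] [_ [wr wi] tE]; exists b.
have tA (A : set (borelC R)) : measurable A ->
   fine (t A) = sint s (A `&` (circle : set (C R))) (fun z => complex.Re (w z)).
  by move=> mA; have /(congr1 (@complex.Re R)) := tE A mA.
split=> [f A|A mA Ac|A mA]; first exact: sE.
  rewrite -[LHS]fineK ?fin_num_measure // tA // (setIidl Ac) sE //.
  have wA : (var_measure s).-integrable A (EFin \o (fun z => complex.Re (w z))).
    by apply: integrableS wr => //; exact: measurable_circle.
  rewrite -RintegralZl // /Rintegral fineK //.
  apply: integrable_fin_num => //.
  exact: (integrableZl mA ((-1) ^+ b) wA).
have mAc : measurable (A `&` (circle : set (C R)) : set (borelC R)).
  by apply: measurableI => //; exact: measurable_circle.
rewrite -[LHS]fineK ?fin_num_measure // -[RHS]fineK ?fin_num_measure //.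
by rewrite !tA // -setIA setIid.
Qed.

(** With P and N Hahn sets of [t] and phi the signed real density, the Jordan parts of [t] have
    densities phi on P and - phi on N. Each is treated by [density_change]; since P and N partition
    the space, the difference of the two densities is phi. *)
Lemma has_density_change s D w t f : constant_sign s -> has_density s D w t ->
  (var_measure t).-integrable circle (EFin \o f) ->
  (var_measure s).-integrable circle (EFin \o (fun z => f z * complex.Re (w z))) /\
  sint t circle f = sint s circle (fun z => f z * complex.Re (w z)).
Proof.
move=> cs st fi; have [b [sE tE tC]] := has_density_charge cs st.
have [_ [wr _] _] := st.
have mc := @measurable_circle R.
have [m mE] := fin_measure_exists s.
pose phi z := (-1) ^+ b * complex.Re (w z).
pose psi (Q : set (borelC R)) := phi \_ (Q `&` (circle : set (C R))).
have phii : m.-integrable circle (EFin \o phi).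
  apply: eq_measure_integrable (integrableZr' ((-1) ^+ b) mc wr).
  by move=> A mA; exact/esym/mE.
have psii Q : measurable Q -> m.-integrable setT (EFin \o psi Q).
  move=> mQ; have mQc : measurable (Q `&` (circle : set (C R)) : set (borelC R)).
    exact: measurableI.
  have -> : EFin \o psi Q = (EFin \o phi) \_ (Q `&` (circle : set (C R))).
    by rewrite /psi restrict_EFin.
  apply: (integrable_mkcond _ mQc).1.
  by apply: integrableS phii => //; exact: subIsetr.
have psiE Q A : measurable Q -> measurable A ->
    (\int[m]_(z in A) (psi Q z)%:E)%E = t (A `&` Q).
  move=> mQ mA; rewrite (_ : (fun z => (psi Q z)%:E) =
      (EFin \o phi) \_ (Q `&` (circle : set (C R)))); last first.
    by rewrite -[LHS]/(EFin \o psi Q) /psi restrict_EFin.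
  have mAQ : measurable (A `&` Q) by exact: measurableI.
  rewrite -integral_mkcondr setIA [RHS]tC // [RHS]tE //; last exact: measurableI.
  by apply: eq_measure_integral => B mB _; exact: mE.
have [P [N [h [E1 E2 _]]]] := hahn_exists t.
have [[mP posP] [mN negN] PN PN0] := h.
have jp A : measurable A -> jordan_pos h A = (\int[m]_(z in A) (psi P z)%:E)%E.
  by move=> mA; rewrite psiE // jordan_posE cjordan_posE /crestr0 mem_set.
have jn A : measurable A ->
    jordan_neg h A = (\int[m]_(z in A) (- psi N z)%:E)%E.
  move=> mA; have pA := integrableS measurableT mA (@subsetT _ _) (psii N mN).
  have := integralZl mA pA (-1); under eq_integral do rewrite -EFinM mulN1r.
  move=> ->; rewrite psiE // mulN1e.
  by rewrite jordan_negE cjordan_negE /crestr0 mem_set.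
have /(integrable_varP _ _ mc) fb := fi.
have fp : (jordan_pos h).-integrable circle (EFin \o f) by have := fb false; rewrite /sgnm E1.
have fn : (jordan_neg h).-integrable circle (EFin \o f) by have := fb true; rewrite /sgnm E2.
have [ip Ip] := density_change (psii P mP) jp mc fp.
have nN : m.-integrable setT (EFin \o (fun z => - psi N z)).
  exact: integrableN (psii N mN).
have [in' In] := density_change nN jn mc fn.
have fphi z : z \in (circle : set (borelC R)) ->
    f z * psi P z - f z * - psi N z = f z * phi z.
  rewrite inE => zc; rewrite mulrN opprK -mulrDr; congr (_ * _).
  have [Pz|Pz] := pselect (P z).
    have Nz : ~ N z by move=> Nz; have : (P `&` N) z by []; rewrite PN0.
    rewrite /psi !patchE mem_set // memNset ?addr0 //.
    by case.
  have Nz : N z by have : (P `|` N) z by [rewrite PN]; case.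
  rewrite /psi !patchE memNset; last by case.
  by rewrite mem_set // add0r.
have iphi : m.-integrable circle (EFin \o (fun z => f z * phi z)).
  apply: eq_integrable (integrableB mc ip in') => // z zc /=.
  by rewrite -EFinB fphi.
have iw : m.-integrable circle (EFin \o (fun z => f z * complex.Re (w z))).
  apply: eq_integrable (integrableZl mc ((-1) ^+ b) iphi) => // z zc /=.
  by rewrite -EFinM /phi (mulrCA (f z)) signrMK.
split; first by apply: eq_measure_integrable iw => A mA; exact: mE.
rewrite sE // sintE /sgnm E1 E2 /Rintegral -Ip -In -[LHS]/(Rintegral m circle _ - Rintegral m circle _).
rewrite -RintegralB // (eq_Rintegral _ fphi) -RintegralZl //; last first.
  by apply: eq_measure_integrable iw => A mA; exact: mE.
rewrite /Rintegral (@eq_measure_integral _ _ _ _ (var_measure s)) => [|A mA _]; last exact: mE.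
by congr fine; apply: eq_integral => z _; rewrite /phi mulrCA.
Qed.

(** On a set that is null for [s], the charge [t] vanishes together with all measurable subsets, so
    both Jordan parts vanish there; t(A) = 0 alone would allow cancellation. *)
Lemma has_density_dominated s D w t : constant_sign s -> has_density s D w t ->
  forall P : C R -> Prop, {ae var_measure s, forall z, P z} ->
    {ae var_measure t, forall z, P z}.
Proof.
move=> cs st P [A [mA A0 AP]]; exists A; split => //.
have [b [_ tE tC]] := has_density_charge cs st.
have [_ [wr _] _] := st.
have mc := @measurable_circle R.
have t0 B : measurable B -> B `<=` A -> t B = 0%E.
  move=> mB BA; rewrite tC // tE //; last exact: measurableI.
  have mBc : measurable (B `&` (circle : set (C R)) : set (borelC R)).
    exact: measurableI.
  apply: null_set_integral => //.
    apply: measurable_funS (measurable_int _ (integrableZr' ((-1) ^+ b) mc wr)) => //.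
  by apply: (subset_measure0 _ _ _ A0) => // z [/BA].
have [P' [N [h [E1 E2 _]]]] := hahn_exists t.
have [[mP posP] [mN negN] PN PN0] := h.
have p0 : pos_part t A = 0%E.
  rewrite E1 -[LHS]/(jordan_pos h A) jordan_posE cjordan_posE /crestr0 mem_set //= /crestr.
  by apply: t0; [exact: measurableI|exact: subIsetl].
have n0 : neg_part t A = 0%E.
  rewrite E2 -[LHS]/(jordan_neg h A) jordan_negE cjordan_negE /crestr0 mem_set //= /crestr.
  by rewrite t0 ?oppe0 //; exact: measurableI.
suff : (pos_part t A + neg_part t A = 0)%E by [].
by rewrite p0 n0 adde0.
Qed.

End change_of_density.

(** * The Cayley transform of the circle onto the line *)

Section for_continuous.
Variables (T : topologicalType) (K : numFieldType).
Implicit Types (f g : T -> K) (x : T).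

Lemma for_continuousD f g x : {for x, continuous f} -> {for x, continuous g} ->
  {for x, continuous (fun y => f y + g y)}.
Proof. exact: cvgD. Qed.

Lemma for_continuousM f g x : {for x, continuous f} -> {for x, continuous g} ->
  {for x, continuous (fun y => f y * g y)}.
Proof. exact: cvgM. Qed.

Lemma for_continuousV f x : f x != 0 -> {for x, continuous f} ->
  {for x, continuous (fun y => (f y)^-1)}.
Proof. by move=> f0; apply: cvgV. Qed.

Lemma for_continuous_cst (c : K) x : {for x, continuous (fun=> c)}.
Proof. exact: cvg_cst. Qed.

End for_continuous.

Section cayley.
Variable R : realType.
Implicit Types (x y t : R) (z w : C R).

Lemma expiD t t' : expi (t + t') = expi t * expi t' :> C R.
Proof. by rewrite /expi cosD sinD; congr Complex; rewrite addrC // [RHS]addrC. Qed.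

Lemma norm_expi t : `|expi t| = 1 :> C R.
Proof. by rewrite normc_def /= cos2Dsin2 sqrtr1. Qed.

Lemma expi_neq0 t : expi t != 0 :> C R.
Proof. by rewrite -normr_eq0 norm_expi oner_eq0. Qed.

Lemma expi0 : expi 0 = 1 :> C R.
Proof. by rewrite /expi cos0 sin0. Qed.

Lemma expiN t : expi (- t) = (expi t)^-1 :> C R.
Proof.
by apply: (mulIf (expi_neq0 t)); rewrite -expiD addNr expi0 mulVf ?expi_neq0.
Qed.

(** At z = e^{i (t0 + theta)} this is -cot(theta/2), increasing from -oo to +oo for theta in (0, 2
    pi). At the pole the value is 0, by the convention for division by 0. *)
Definition cayX t0 z : R :=
  let u := z / expi t0 in complex.Im u / (complex.Re u - 1).

Definition cayZ t0 x : C R := expi t0 * ((x%:C%C - 'i) / (x%:C%C + 'i)).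

Definition kerK x y : R := (1 + x * y) / (y - x).

Lemma xDi_neq0 x : x%:C%C + 'i != 0 :> C R.
Proof. by rewrite -complexiE eq_complex /= addr0 add0r oner_eq0 andbF. Qed.

Lemma xBi_neq0 x : x%:C%C - 'i != 0 :> C R.
Proof.
by rewrite -complexiE eq_complex /= oppr0 addr0 add0r oppr_eq0 oner_eq0 andbF.
Qed.

Lemma xDixBi x : (x%:C%C + 'i) * (x%:C%C - 'i) = (1 + x ^+ 2)%:C%C :> C R.
Proof. by rewrite mulrC -subr_sqr sqrCi opprK -rmorphXn addrC -[1]/(1%:C%C) -rmorphD. Qed.

Lemma cayE x : (x%:C%C - 'i) / (x%:C%C + 'i) =
  ((x ^+ 2 - 1) / (1 + x ^+ 2) +i* (- (2 * x) / (1 + x ^+ 2)))%C :> C R.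
Proof.
apply: (mulIf (xDi_neq0 x)); rewrite divfK ?xDi_neq0 //.
rewrite -complexiE; apply/eqP; rewrite eq_complex /=.
have x0 : 1 + x ^+ 2 != 0 by rewrite lt0r_neq0 // ltr_pwDl // sqr_ge0.
by apply/andP; split; apply/eqP; field.
Qed.

Lemma norm_cayZ t0 x : `|cayZ t0 x| = 1.
Proof.
rewrite /cayZ normrM norm_expi mul1r normf_div.
have -> : `|x%:C%C - 'i| = `|x%:C%C + 'i : C R|.
  by rewrite -complexiE !normc_def /= !addr0 !add0r oppr0 addr0 sqrrN.
by rewrite divff // normr_eq0 xDi_neq0.
Qed.

Lemma cayZ_neq t0 x : cayZ t0 x != expi t0.
Proof.
rewrite /cayZ -subr_eq0 -[X in _ - X]mulr1 -mulrBr mulf_neq0 ?expi_neq0 //.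
rewrite -[X in _ - X](divff (xDi_neq0 x)) -mulrBl mulf_neq0 ?invr_eq0 ?xDi_neq0 //.
by rewrite opprD addrACA subrr add0r -opprD oppr_eq0 -mulr2n mulrn_eq0 neq0Ci.
Qed.

Lemma cayZK t0 x : cayX t0 (cayZ t0 x) = x.
Proof.
rewrite /cayX /cayZ (mulrC (expi _)) mulfK ?expi_neq0 // cayE /=.
have x0 : 1 + x ^+ 2 != 0 by rewrite lt0r_neq0 // ltr_pwDl // sqr_ge0.
have -> : (x ^+ 2 - 1) / (1 + x ^+ 2) - 1 = - 2 / (1 + x ^+ 2) by field.
by field; rewrite x0 /= ?oppr_eq0 ?pnatr_eq0.
Qed.

Lemma cayXK t0 z : circle z -> z != expi t0 -> cayZ t0 (cayX t0 z) = z.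
Proof.
move=> zc zt; rewrite /cayZ /cayX cayE.
have uE : z = expi t0 * (z / expi t0) by rewrite mulrC divfK // expi_neq0.
rewrite [RHS]uE; congr (_ * _).
have : `|z / expi t0| = 1 by rewrite normf_div norm_expi zc divr1.
have : z / expi t0 != 1.
  by apply: contra zt => /eqP u1; rewrite uE u1 mulr1.
case: (z / expi t0) => a b; rewrite eq_complex /= => ab1 nab.
have ab : a ^+ 2 + b ^+ 2 = 1.
  have /(congr1 (fun v => v ^+ 2)) := nab.
  by rewrite -add_Re2_Im2 expr1n => /(congr1 (@complex.Re R)).
have a1 : a - 1 != 0.
  rewrite subr_eq0; apply: contra ab1 => /eqP a1; rewrite a1 eqxx /=.
  by move/eqP: ab; rewrite a1 expr1n -subr_eq0 addrAC subrr add0r sqrf_eq0.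
have d0 : (a - 1) ^+ 2 + b ^+ 2 != 0.
  rewrite lt0r_neq0 // ltr_pwDl ?sqr_ge0 // exprn_even_gt0 //.
have bE : b ^+ 2 = 1 - a ^+ 2 by rewrite -ab; ring.
have d1 : 1 + (b / (a - 1)) ^+ 2 != 0 by rewrite lt0r_neq0 // ltr_pwDl // sqr_ge0.
congr Complex.
  apply: (mulIf d1); rewrite divfK // expr_div_n bE.
  by field.
apply: (mulIf d1); rewrite divfK // expr_div_n bE.
by field.
Qed.

Lemma cayZ_inj t0 : injective (cayZ t0).
Proof. exact: can_inj (cayZK t0). Qed.

Lemma cara_kernel_cay t0 x y :
  cara_kernel (cayZ t0 x) (cayZ t0 y) = - 'i * (kerK x y)%:C%C.
Proof.
rewrite /cara_kernel /cayZ -mulrDr -mulrBr -mulf_div divff ?expi_neq0 // mul1r.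
(* On the diagonal both kernels are 0, by the convention for division by 0. *)
have [->|xy] := eqVneq x y.
  have -> : kerK y y = 0 by rewrite /kerK subrr invr0 mulr0.
  by rewrite subrr invr0 !mulr0.
rewrite /kerK rmorphM fmorphV rmorphD rmorph1 rmorphM rmorphB /=.
have yx : y%:C%C - x%:C%C != 0 :> C R.
  by rewrite -rmorphB /= eq_complex /= eqxx andbT subr_eq0 eq_sym.
have := xDi_neq0 x; have := xDi_neq0 y.
have i2 : 'i * 'i = -1 :> C R by rewrite -expr2 sqrCi.
have i0 : 'i != 0 :> C R by exact: neq0Ci.
set X := x%:C%C in yx *; set Y := y%:C%C in yx *; set i := 'i in i2 i0 * => y0 x0.
have D0 : (Y - i) / (Y + i) - (X - i) / (X + i) != 0.
  have -> : (Y - i) / (Y + i) - (X - i) / (X + i) = 2 * i * (Y - X) / ((Y + i) * (X + i)).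
    by field; rewrite x0.
  by rewrite !mulf_neq0 ?invr_eq0 ?mulf_neq0 ?pnatr_eq0.
apply: (mulIf D0); rewrite divfK //.
have -> : (Y - i) / (Y + i) + (X - i) / (X + i) =
  2 * (X * Y - i * i) / ((Y + i) * (X + i)) by field; rewrite x0.
have -> : (Y - i) / (Y + i) - (X - i) / (X + i) = 2 * i * (Y - X) / ((Y + i) * (X + i)).
  by field; rewrite x0.
rewrite i2 opprK.
transitivity (2 * (1 + X * Y) * (- (i * i)) / ((Y + i) * (X + i))).
  by rewrite i2 opprK mulr1 [1 + _]addrC.
by field; rewrite x0 y0.
Qed.

(** With h = acos(-x / rho) in (0, pi), the vector v = (i - x) / rho is e^{ih}, and t0 + 2h is an
    argument of [cayZ t0 x] in the prescribed range. This shows that the choice made by [arg_from]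
    is not vacuous and that its result squares correctly; only a sign is left to decide. *)
Lemma sqrt_from_cayZ t0 x : sqrt_from t0 (cayZ t0 x) =
  expi (t0 / 2) * (('i - x%:C%C) / (Num.sqrt (1 + x ^+ 2))%:C%C).
Proof.
have x1 : 0 < 1 + x ^+ 2 by rewrite ltr_pwDl // sqr_ge0.
set rho := Num.sqrt _.
have rho0 : 0 < rho by rewrite sqrtr_gt0.
have rho2 : rho ^+ 2 = 1 + x ^+ 2 by rewrite sqr_sqrtr // ltW.
have rhoC : rho%:C%C != 0 :> C R by rewrite eq_complex /= eqxx andbT gt_eqF.
pose v := ('i - x%:C%C) / rho%:C%C : C R.
have vE : v = (- x / rho +i* rho^-1)%C.
  apply: (mulIf rhoC); rewrite divfK // -complexiE.
  apply/eqP; rewrite eq_complex /=.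
  by apply/andP; split; apply/eqP; field; rewrite gt_eqF.
have v2 : v ^+ 2 = (x%:C%C - 'i) / (x%:C%C + 'i).
  rewrite /v expr_div_n -rmorphXn /= rho2 -xDixBi -sqrrN opprB expr2.
  by rewrite -mulf_div divff ?xBi_neq0 // mulr1.
have hx : -1 < - x / rho < 1.
  have xr : `|x| < rho.
    rewrite -(ltr_pXn2r (_ : 0 < 2)%N) ?nnegrE ?normr_ge0 ?(ltW rho0) //.
    by rewrite real_normK ?num_real // rho2 ltrDr.
  by rewrite -ltr_norml normf_div normrN (gtr0_norm rho0) ltr_pdivrMr // mul1r.
have hx' : -1 <= - x / rho <= 1 by case/andP: hx => /ltW -> /ltW ->.
pose h := acos (- x / rho).
have ch : cos h = - x / rho by apply: acosK; rewrite in_itv.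
have sh : sin h = rho^-1.
  rewrite /h sin_acos // expr_div_n sqrrN.
  have -> : 1 - x ^+ 2 / rho ^+ 2 = (rho^-1) ^+ 2.
    rewrite exprVn -[X in X - _](divff (_ : rho ^+ 2 != 0)) ?expf_neq0 ?gt_eqF //.
    by rewrite -mulrBl {1}rho2 addrK mul1r.
  by rewrite sqrtr_sqr ger0_norm // invr_ge0 ltW.
have hE : expi h = v by rewrite /expi ch sh vE.
have ex : t0 <= t0 + (h + h) < t0 + 2 * pi /\
    cayZ t0 x = `|cayZ t0 x| * expi (t0 + (h + h)).
  split.
    have h0 : 0 <= h by apply: acos_ge0.
    have hpi : h < pi by apply: acos_ltpi; case/andP: hx => -> /ltW ->.
    by rewrite lerDl addr_ge0 //= ltrD2l mulr2n mulrDl mul1r ltrD.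
  by rewrite norm_cayZ mul1r expiD expiD /cayZ -v2 hE expr2.
rewrite /sqrt_from norm_cayZ sqrtC1 mul1r /arg_from.
case: xgetP => [th _ [/andP[t1 t2]]|/(_ _ ex)//].
rewrite norm_cayZ mul1r => zE; pose k := (th - t0) / 2.
have -> : th / 2 = t0 / 2 + k by rewrite /k; field.
rewrite expiD; congr (_ * _).
have : (expi k) ^+ 2 == v ^+ 2.
  rewrite v2; apply/eqP/(mulfI (expi_neq0 t0)); rewrite -[RHS]/(cayZ t0 x) zE.
  by rewrite expr2 -!expiD; congr expi; rewrite /k; field.
(* Half the chosen argument minus t0/2 lies in [0, pi), where the sine is nonnegative, whereas -v
   has negative imaginary part. *)
rewrite eqf_sqr => /orP[/eqP //|/eqP kE].
have : sin k = - rho^-1 by move/(congr1 (@complex.Im R)): kE; rewrite vE.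
have : 0 <= sin k.
  by apply: sin_ge0_pi; rewrite /k divr_ge0 ?subr_ge0 //= ler_pdivrMr // lerBlDl mulrC ltW.
by move=> /[swap] ->; rewrite oppr_ge0 invr_le0 leNgt rho0.
Qed.

Lemma measurable_cayX t0 : measurable_fun setT (cayX t0 : borelC R -> R).
Proof.
have -> : cayX t0 = fun z => (complex.Im z * cos t0 - complex.Re z * sin t0) /
    (complex.Re z * cos t0 + complex.Im z * sin t0 - 1).
  apply/funext => z; rewrite /cayX -expiN /expi cosN sinN; case: z => a b /=.
  by congr (_ / _); ring.
have mR := @measurable_Re R; have mI := @measurable_Im R.
apply: measurable_funM.
  by apply: measurable_funB; apply: measurable_funM.
apply: (measurableT_comp (@measurable_invr R)).
by apply: measurable_funB => //; apply: measurable_funD; apply: measurable_funM.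
Qed.

Lemma cayX_den t0 z : circle z -> z != expi t0 -> complex.Re (z / expi t0) - 1 != 0.
Proof.
move=> zc zt; apply/negP => /eqP H.
have := cayXK zc zt; rewrite /cayX H invr0 mulr0 => zE.
move/eqP: H; rewrite -zE /cayZ (mulrC (expi _)) mulfK ?expi_neq0 // cayE /=.
by rewrite expr0n /= addr0 divr1 sub0r -opprD oppr_eq0 -mulr2n pnatr_eq0.
Qed.

Lemma cayX_continuous t0 z : circle z -> z != expi t0 ->
  {for z, continuous (cayX t0)}.
Proof.
move=> zc zt; have d0 := cayX_den zc zt.
have cu : {for z, continuous (fun w : C R => w / expi t0)}.
  exact: mulrr_continuous.
apply: for_continuousM; first exact: (continuous_comp cu (@Im_continuous R _)).
apply: for_continuousV => //.
apply: (@for_continuousD _ _ _ (fun=> - 1)); last exact: for_continuous_cst.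
exact: (continuous_comp cu (@Re_continuous R _)).
Qed.

Lemma cayZ_continuous t0 : continuous (cayZ t0).
Proof.
move=> x; have cx : {for x, continuous (fun v : R => v%:C%C : C R)}.
  exact: real_complex_continuous.
apply: (@for_continuousM _ _ (fun=> expi t0)); first exact: for_continuous_cst.
apply: (@for_continuousM _ _ (fun v : R => v%:C%C - 'i) (fun v : R => (v%:C%C + 'i)^-1)).
  by apply: (@for_continuousD _ _ _ (fun=> - 'i)); [exact: cx|exact: for_continuous_cst].
apply: for_continuousV; first exact: xDi_neq0.
by apply: (@for_continuousD _ _ _ (fun=> 'i)); [exact: cx|exact: for_continuous_cst].
Qed.

Lemma expi_eq1 t : 0 < t <= pi -> expi t != 1 :> C R.
Proof.
move=> /andP[t0 tpi]; apply/negP => /eqP/(congr1 (@complex.Re R)) /= ct.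
suff : t = 0 by move=> tE; rewrite tE ltxx in t0.
by apply: cos_inj; rewrite ?in_itv /= ?lexx ?pi_ge0 ?(ltW t0) ?cos0.
Qed.

Lemma arc_circle (G : set (C R)) : is_arc G -> G `<=` circle.
Proof. by move=> [a [b [_ _ ->]]] _ [t _ <-]; exact: norm_expi. Qed.

Lemma arc_two_points (G : set (C R)) : is_arc G ->
  exists z w, [/\ G z, G w & z != w].
Proof.
move=> [a [b [ab b2 ->]]]; exists (expi ((a + b) / 2)), (expi a); split.
- by exists ((a + b) / 2) => //=; rewrite in_itv /=; lra.
- by exists a => //=; rewrite in_itv /=; lra.
have -> : (a + b) / 2 = a + (b - a) / 2 by field.
rewrite expiD -subr_eq0 -[X in _ - X]mulr1 -mulrBr mulf_neq0 ?expi_neq0 //.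
by rewrite subr_eq0 expi_eq1 //; lra.
Qed.

(** Since the arc misses the pole, [cayX t0] composed with [expi] is continuous on the parameter
    interval, and the intermediate value theorem applies between parameters of z and w. These may
    come in either order. *)
Lemma arc_convex t0 (G : set (C R)) z w x : is_arc G -> ~ G (expi t0) ->
  G z -> G w -> cayX t0 z < x < cayX t0 w -> G (cayZ t0 x).
Proof.
move=> [a [b [ab b2 ->]]] nG [s sab <-] [u uab <-] {z w} sxu.
pose f th : R := cayX t0 (expi th).
have fc th : th \in `[a, b] -> {for th, continuous f}.
  move=> thab.
  have tht : expi th != expi t0 :> C R.
    by apply/eqP => E; apply: nG; exists th.
  have d0 := cayX_den (norm_expi th) tht.
  rewrite /f /cayX; have expE v : expi v / expi t0 = expi (v - t0) :> C R.
    by rewrite expiD expiN.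
  rewrite expE in d0.
  have -> : (fun th => let u := expi th / expi t0 in complex.Im u / (complex.Re u - 1)) =
    (fun v => sin (v - t0) / (cos (v - t0) - 1)).
    by apply/funext => v; rewrite expE.
  have cB : {for th, continuous (fun v : R => v - t0)}.
    by apply: (@for_continuousD _ _ id (fun=> - t0)); [exact: cvg_id|exact: for_continuous_cst].
  apply: for_continuousM; first exact: (continuous_comp cB (@continuous_sin R _)).
  apply: for_continuousV => //.
  apply: (@for_continuousD _ _ _ (fun=> - 1)); last exact: for_continuous_cst.
  exact: (continuous_comp cB (@continuous_cos R _)).
have [v vab fv] : exists2 v, v \in `[a, b] & f v = x.
  have [su|/ltW us] := leP s u.
    have sub v : v \in `[s, u] -> v \in `[a, b].
      by move: sab uab; rewrite /= !in_itv /=; lra.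
    have [||v vsu fv] := @IVT R f s u x su.
    - by apply: continuous_in_subspaceT => v; rewrite inE => /sub; exact: fc.
    - by rewrite ge_min le_max /f; case/andP: sxu => /ltW -> /ltW ->; rewrite orbT.
    - by exists v => //; exact: sub.
  have sub v : v \in `[u, s] -> v \in `[a, b].
    by move: sab uab; rewrite /= !in_itv /=; lra.
  have [||v vsu fv] := @IVT R f u s x us.
  - by apply: continuous_in_subspaceT => v; rewrite inE => /sub; exact: fc.
  - by rewrite ge_min le_max /f; case/andP: sxu => /ltW -> /ltW ->; rewrite orbT.
  - by exists v => //; exact: sub.
exists v => //; rewrite -fv /f cayXK //; first exact: norm_expi.
by apply/eqP => E; apply: nG; exists v.
Qed.

(* By convexity [(x1, x2)] lies in the interior of [G], so if it met [H], then
   an interval between [y] and a second point of [H] would lie in both interiors. *)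
Lemma arc_separation t0 (G H : set (C R)) x1 x2 y : is_arc G -> is_arc H ->
  ~ G (expi t0) -> ~ H (expi t0) ->
  circle_interior G `&` circle_interior H = set0 ->
  G (cayZ t0 x1) -> G (cayZ t0 x2) -> H (cayZ t0 y) -> ~ (x1 < y < x2).
Proof.
move=> aG aH nG nH GH0 G1 G2 Hy /andP[x1y yx2].
have inter K a b x : is_arc K -> ~ K (expi t0) -> K (cayZ t0 a) -> K (cayZ t0 b) ->
    a < x < b -> circle_interior K (cayZ t0 x).
  move=> aK nK Ka Kb /andP[ax xb]; split; first exact: norm_cayZ.
  have cX : {for cayZ t0 x, continuous (cayX t0)}.
    by apply: cayX_continuous; [exact: norm_cayZ|exact: cayZ_neq].
  have zt := cayZ_neq t0 x.
  near=> w => wc.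
  have wt : w != expi t0.
    near: w.
    have : open (~` [set expi t0] : set (C R)) by rewrite openC; exact: closed_set1C.
    move=> o; have := open_nbhs_nbhs (conj o (_ : (~` [set expi t0]) (cayZ t0 x))).
    move=> /(_ _)/wrap[]; first by move=> /= E; move: zt; rewrite E eqxx.
    by apply: filterS => v /= /eqP.
  rewrite -(cayXK wc wt); apply: (arc_convex aK nK Ka Kb).
  rewrite !cayZK; near: w.
  have : nbhs (cayX t0 (cayZ t0 x)) `]a, b[%classic.
    by rewrite cayZK; apply: near_in_itvoo; rewrite in_itv /= ax xb.
  move=> /cX; apply: (@filterS _ _ (nbhs_filter _)) => v.
    by rewrite /= in_itv.
have [z [w [Hz Hw zw]]] := arc_two_points aH.
have HX v : H v -> v = cayZ t0 (cayX t0 v).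
  move=> Hv; rewrite cayXK //; first exact: arc_circle Hv.
  by apply/eqP => E; apply: nH; rewrite -E.
have [y' Hy' yy'] : exists2 y', H (cayZ t0 y') & y' != y.
  have [zy|zy] := eqVneq (cayX t0 z) y.
    exists (cayX t0 w); rewrite -?HX //; apply: contra zw => /eqP wy.
    by rewrite (HX _ Hz) (HX _ Hw) zy wy.
  by exists (cayX t0 z); rewrite -?HX.
have [m [m1 m2]] : exists m, x1 < m < x2 /\ (y' < m < y \/ y < m < y').
  have [yy|yy|E] := ltgtP y' y; last by rewrite E eqxx in yy'.
    have [h|h] := leP y' x1.
      by exists ((x1 + y) / 2); split; [lra|left; lra].
    by exists ((y' + y) / 2); split; [lra|left; lra].
  have [h|h] := leP y' x2.
    by exists ((y' + y) / 2); split; [lra|right; lra].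
  by exists ((x2 + y) / 2); split; [lra|right; lra].
have : (circle_interior G `&` circle_interior H) (cayZ t0 m).
  split; first exact: (inter G x1 x2).
  by case: m2 => m2; [exact: (inter H y' y)|exact: (inter H y y')].
by rewrite GH0.
Unshelve. all: by end_near. Qed.

End cayley.

(** * Carathéodory functions on the real line *)

Section ae_imply.
Context d (T : measurableType d) (R : realType) (m : {measure set T -> \bar R}).
Implicit Types P Q S U : T -> Prop.

Lemma aeS P Q : (forall x, P x -> Q x) ->
  {ae m, forall x, P x} -> {ae m, forall x, Q x}.
Proof. by move=> PQ; apply: filterS. Qed.

Lemma aeS2 P Q S : (forall x, P x -> Q x -> S x) ->
  {ae m, forall x, P x} -> {ae m, forall x, Q x} -> {ae m, forall x, S x}.
Proof. by move=> PQ; apply: filterS2. Qed.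

Lemma aeS3 P Q S U : (forall x, P x -> Q x -> S x -> U x) ->
  {ae m, forall x, P x} -> {ae m, forall x, Q x} -> {ae m, forall x, S x} ->
  {ae m, forall x, U x}.
Proof. by move=> PQ; apply: filterS3. Qed.

End ae_imply.

(** * Measurability by real and imaginary parts *)

Section complex_measurable.
Variable R : realType.
Implicit Types (f g : C R -> C R) (D : set (C R)).

Definition cmeasurable D f :=
  measurable_fun (D : set (borelC R)) (fun z => complex.Re (f z)) /\
  measurable_fun (D : set (borelC R)) (fun z => complex.Im (f z)).

Lemma cmeasurable_id D : cmeasurable D id.
Proof.
by split; apply: measurable_funTS; [exact: measurable_Re|exact: measurable_Im].
Qed.

Lemma cmeasurable_cst D (c : C R) : cmeasurable D (fun=> c).
Proof. by split; exact: measurable_cst. Qed.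

Lemma cmeasurableD D f g : cmeasurable D f -> cmeasurable D g ->
  cmeasurable D (fun z => f z + g z).
Proof.
move=> [f1 f2] [g1 g2]; split.
  have -> : (fun z => complex.Re (f z + g z)) = (fun z => complex.Re (f z) + complex.Re (g z)).
    by apply/funext => z; case: (f z) (g z) => ? ? [].
  exact: measurable_funD.
have -> : (fun z => complex.Im (f z + g z)) = (fun z => complex.Im (f z) + complex.Im (g z)).
  by apply/funext => z; case: (f z) (g z) => ? ? [].
exact: measurable_funD.
Qed.

Lemma cmeasurableM D f g : cmeasurable D f -> cmeasurable D g ->
  cmeasurable D (fun z => f z * g z).
Proof.
move=> [f1 f2] [g1 g2]; split.
  have -> : (fun z => complex.Re (f z * g z)) =
      (fun z => complex.Re (f z) * complex.Re (g z) - complex.Im (f z) * complex.Im (g z)).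
    by apply/funext => z; case: (f z) (g z) => ? ? [].
  by apply: measurable_funB; exact: measurable_funM.
have -> : (fun z => complex.Im (f z * g z)) =
    (fun z => complex.Re (f z) * complex.Im (g z) + complex.Im (f z) * complex.Re (g z)).
  by apply/funext => z; case: (f z) (g z) => ? ? [].
by apply: measurable_funD; exact: measurable_funM.
Qed.

Lemma cmeasurableV D f : cmeasurable D f -> cmeasurable D (fun z => (f z)^-1).
Proof.
move=> [f1 f2].
have mN : measurable_fun (D : set (borelC R))
    (fun z => (complex.Re (f z) ^+ 2 + complex.Im (f z) ^+ 2)^-1).
  apply: (measurableT_comp (@measurable_invr R)).
  by apply: measurable_funD; exact: measurable_funX.
split.
  have -> : (fun z => complex.Re ((f z)^-1)) =
      (fun z => complex.Re (f z) * (complex.Re (f z) ^+ 2 + complex.Im (f z) ^+ 2)^-1).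
    by apply/funext => z; case: (f z).
  exact: measurable_funM.
have -> : (fun z => complex.Im ((f z)^-1)) =
    (fun z => - (complex.Im (f z) * (complex.Re (f z) ^+ 2 + complex.Im (f z) ^+ 2)^-1)).
  by apply/funext => z; case: (f z) => a b /=; ring.
by apply: measurableT_comp => //; exact: measurable_funM.
Qed.

Lemma cmeasurable_cara_kernel D z : cmeasurable D (cara_kernel z).
Proof.
apply: cmeasurableM.
  by apply: cmeasurableD; [exact: cmeasurable_id|exact: cmeasurable_cst].
apply: cmeasurableV.
by apply: cmeasurableD; [exact: cmeasurable_id|exact: cmeasurable_cst].
Qed.

End complex_measurable.

(** * Monotonicity of the kernel, convergence and continuity of its integrals *)

Section kernel.
Variables (R : realType) (t0 : R).
Implicit Types (nu : borel_charge R) (x y : R) (E : set R).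

Lemma kerKE x y : y != x -> kerK x y = x + (1 + x ^+ 2) / (y - x).
Proof. by rewrite /kerK => yx; field; rewrite subr_eq0. Qed.

(** The difference of the two values is (1 + y^2) (x2 - x1) / ((y - x1) (y - x2)), and the
    denominator is positive when y is outside the interval. *)
Lemma kerK_le x1 x2 y : x1 <= x2 -> y != x1 -> y != x2 -> ~ x1 < y < x2 ->
  kerK x1 y <= kerK x2 y.
Proof.
move=> x12 y1 y2 ny.
have -> : kerK x2 y = kerK x1 y + (1 + y ^+ 2) * (x2 - x1) / ((y - x1) * (y - x2)).
  by rewrite /kerK; field; rewrite !subr_eq0 y1 y2.
have p : 0 < (y - x1) * (y - x2).
  have [yx1|yx1|E] := ltgtP y x1; last by rewrite E eqxx in y1.
    by rewrite nmulr_rgt0 ?subr_lt0 // (lt_le_trans yx1).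
  rewrite pmulr_rgt0 subr_gt0 // lt_neqAle eq_sym y2 leNgt.
  by apply/negP => yx2; apply: ny; rewrite yx1.
rewrite lerDl mulr_ge0 ?invr_ge0 ?(ltW p) // mulr_ge0 ?subr_ge0 //.
by rewrite addr_ge0 // sqr_ge0.
Qed.

(** By monotonicity the value at x lies between those at x1 and x2. The bound does not depend on x,
    which makes it a majorant for dominated convergence even when x1 or x2 is an end point of an
    arc. *)
Lemma kerK_dominated x1 x x2 y : x1 <= x <= x2 -> y != x1 -> y != x2 ->
  ~ x1 < y < x2 -> `|kerK x y| <= `|kerK x1 y| + `|kerK x2 y|.
Proof.
move=> /andP[x1x xx2] y1 y2 ny.
have [yx|yx] := eqVneq y x.
  by rewrite /kerK yx subrr invr0 mulr0 normr0 addr_ge0.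
have h1 : kerK x1 y <= kerK x y.
  apply: kerK_le => // /andP[a b]; apply: ny.
  by rewrite a (lt_le_trans b).
have h2 : kerK x y <= kerK x2 y.
  apply: kerK_le => // /andP[a b]; apply: ny.
  by rewrite b (le_lt_trans x1x).
have := ler_norm (kerK x2 y); have := ler_norm (- kerK x1 y); rewrite normrN.
by have := normr_ge0 (kerK x1 y); have := normr_ge0 (kerK x2 y); rewrite ler_norml; lra.
Qed.

Lemma measurable_kerK x D :
  measurable_fun (D : set (borelC R)) (fun w : C R => kerK x (cayX t0 w)).
Proof.
apply: measurable_funTS; have mX := measurable_cayX t0.
apply: measurable_funM.
  by apply: measurable_funD => //; exact: measurable_funM.
apply: (measurableT_comp (@measurable_invr R)).
exact: measurable_funB.
Qed.

Definition offpole nu := {ae var_measure nu, forall w, circle w /\ w != expi t0}.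

(** The function i F_nu in the Cayley coordinate: the factor i cancels the -i in front of the
    kernel, which leaves a real integral. *)
Definition wint nu x : R := sint nu circle (fun w => kerK x (cayX t0 w)).

Lemma cara_kernel_ae nu x : offpole nu ->
  {ae var_measure nu, forall w, cara_kernel (cayZ t0 x) w =
     - 'i * (kerK x (cayX t0 w))%:C%C}.
Proof.
by apply: aeS => w [wc wt]; rewrite -{1}(cayXK wc wt) cara_kernel_cay.
Qed.

Lemma Re_mNi (x : R) : complex.Re (- 'i * x%:C%C : C R) = 0.
Proof. by rewrite -complexiE /=; ring. Qed.

Lemma Im_mNi (x : R) : complex.Im (- 'i * x%:C%C : C R) = - x.
Proof. by rewrite -complexiE /=; ring. Qed.

Lemma cara_domP nu x : offpole nu ->
  cara_dom nu (cayZ t0 x) <-> var_measure nu [set cayZ t0 x] = 0%E /\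
  (var_measure nu).-integrable circle (EFin \o (fun w => kerK x (cayX t0 w))).
Proof.
move=> off; have mc := @measurable_circle R.
have kae := cara_kernel_ae x off.
have [m1 m2] := cmeasurable_cara_kernel circle (cayZ t0 x).
have mK := @measurable_kerK x circle.
split=> -[z0 int]; split => //.
  apply: (@ae_le_integrable _ _ _ _ _ mc (fun w =>
      complex.Im (cara_kernel (cayZ t0 x) w))) int.2 => //.
  by apply: aeS kae => w -> _; rewrite Im_mNi normrN.
split.
  have i0 : (var_measure nu).-integrable circle (EFin \o (fun=> 0 : R)).
    exact: integrable0.
  apply: (@ae_le_integrable _ _ _ _ _ mc (fun=> 0)) i0 => //.
  by apply: aeS kae => w -> _; rewrite Re_mNi.
apply: (@ae_le_integrable _ _ _ _ _ mc (fun w => kerK x (cayX t0 w))) int => //.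
by apply: aeS kae => w -> _; rewrite Im_mNi normrN.
Qed.

Lemma icara_cayZ nu x : offpole nu -> cara_dom nu (cayZ t0 x) ->
  icara nu (cayZ t0 x) = (wint nu x)%:C%C.
Proof.
move=> off /(cara_domP _ off)[_ int]; have mc := @measurable_circle R.
have kae := cara_kernel_ae x off.
have [m1 m2] := cmeasurable_cara_kernel circle (cayZ t0 x).
have mK := @measurable_kerK x circle.
rewrite /icara /caratheodory /cint.
have -> : sint nu circle (fun z => complex.Re (cara_kernel (cayZ t0 x) z)) = 0.
  rewrite -[RHS](sint0 nu circle); apply: ae_eq_sint => //.
  by apply: aeS kae => w -> _; rewrite Re_mNi.
have -> : sint nu circle (fun z => complex.Im (cara_kernel (cayZ t0 x) z)) = - wint nu x.
  rewrite -mulN1r -sintZ //; apply: ae_eq_sint => //.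
    exact: measurable_funM.
  by apply: aeS kae => w -> _; rewrite Im_mNi mulN1r.
by rewrite -complexiE; apply/eqP; rewrite eq_complex /=; apply/andP; split; apply/eqP; ring.
Qed.

Lemma ae_cayX_neq nu x : offpole nu -> var_measure nu [set cayZ t0 x] = 0%E ->
  {ae var_measure nu, forall w, cayX t0 w != x}.
Proof.
move=> off x0; have nz : {ae var_measure nu, forall w, w <> cayZ t0 x}.
  exists [set cayZ t0 x]; split=> //; first exact: measurable_set1C.
  by move=> w /= /contrapT.
apply: aeS2 nz off => w wx [wc wt]; apply/eqP => E; apply: wx.
by rewrite -E cayXK.
Qed.

Lemma null_set1 nu (P : C R -> Prop) (z : C R) :
  {ae var_measure nu, forall w, P w} -> ~ P z -> var_measure nu [set z] = 0%E.
Proof.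
move=> [A [mA A0 AP]] nP; apply: (subset_measure0 _ _ _ A0) => //.
  exact: measurable_set1C.
by move=> _ ->; apply: AP.
Qed.

Lemma cara_dom_convex nu x1 x x2 : offpole nu ->
  {ae var_measure nu, forall w, ~ x1 < cayX t0 w < x2} -> x1 <= x <= x2 ->
  cara_dom nu (cayZ t0 x1) -> cara_dom nu (cayZ t0 x2) ->
  cara_dom nu (cayZ t0 x).
Proof.
move=> off sep /andP[x1x xx2] d1 d2.
have [/andP[l1 l2]|nx] := boolP (x1 < x < x2); last first.
  have [->//|x1x'] := eqVneq x x1; have [->//|xx2'] := eqVneq x x2.
  by move: nx; rewrite !lt_neqAle x1x xx2 eq_sym x1x' xx2'.
have [n1 i1] := (cara_domP _ off).1 d1; have [n2 i2] := (cara_domP _ off).1 d2.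
have mc := @measurable_circle R.
apply/(cara_domP _ off); split.
  by apply: (null_set1 sep); rewrite cayZK l1.
have i12 := integrableD mc (integrable_norm i1) (integrable_norm i2).
apply: (@ae_le_integrable _ _ _ _ _ mc (fun w =>
    `|kerK x1 (cayX t0 w)| + `|kerK x2 (cayX t0 w)|)) i12.
  exact: measurable_kerK.
apply: aeS3 (ae_cayX_neq off n1) (ae_cayX_neq off n2) sep => w w1 w2 sw _.
rewrite [leRHS]ger0_norm ?addr_ge0 //.
by apply: kerK_dominated; rewrite // x1x xx2.
Qed.

(** Here nothing is assumed about convergence at x1 or x2: the measure stays at a positive distance
    from x, so the kernel is bounded and the measure is finite. *)
Lemma cara_dom_interior nu x1 x x2 : offpole nu ->
  {ae var_measure nu, forall w, ~ x1 < cayX t0 w < x2} -> x1 < x < x2 ->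
  cara_dom nu (cayZ t0 x).
Proof.
move=> off sep /andP[x1x xx2]; have mc := @measurable_circle R.
apply/(cara_domP _ off); split.
  by apply: (null_set1 sep); rewrite cayZK x1x.
have [m mE] := fin_measure_exists nu.
(* From K(x, y) = x + (1 + x^2) / (y - x), where |y - x| is at least x - x1 or at least x2 - x; the
   sum of inverses covers both sides. *)
pose M := `|x| + (1 + x ^+ 2) * ((x - x1)^-1 + (x2 - x)^-1).
have iM : (var_measure nu).-integrable circle (EFin \o (fun=> M)).
  by apply: eq_measure_integrable (finite_measure_integrable_cst m M mc) => A mA; exact: mE.
apply: (@ae_le_integrable _ _ _ _ _ mc (fun=> M)) iM; first exact: measurable_kerK.
apply: aeS sep => w sw _; set y := cayX t0 w in sw *.
have d1 : 0 < (x - x1)^-1 by rewrite invr_gt0 subr_gt0.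
have d2 : 0 < (x2 - x)^-1 by rewrite invr_gt0 subr_gt0.
have X0 : 0 < 1 + x ^+ 2 by rewrite ltr_pwDl // sqr_ge0.
have M0 : 0 <= M by rewrite addr_ge0 // mulr_ge0 ?ltW // addr_gt0.
have yx : y != x by apply/eqP => E; apply: sw; rewrite E x1x.
rewrite [leRHS]ger0_norm // kerKE // (le_trans (ler_normD _ _)) // lerD2l.
rewrite normrM normfV (gtr0_norm X0) ler_pM2l //.
have [yx1|yx1] := leP y x1.
  rewrite distrC gtr0_norm ?subr_gt0 ?(le_lt_trans yx1) //.
  apply: le_trans (_ : (x - x1)^-1 <= _); last by rewrite lerDl ltW.
  by rewrite lef_pV2 ?posrE ?subr_gt0 ?(le_lt_trans yx1) // lerB.
have yx2 : x2 <= y by rewrite leNgt; apply/negP => yx2; apply: sw; rewrite yx1.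
rewrite gtr0_norm ?subr_gt0 ?(lt_le_trans xx2) //.
apply: le_trans (_ : (x2 - x)^-1 <= _); last by rewrite lerDr ltW.
by rewrite lef_pV2 ?posrE ?subr_gt0 ?(lt_le_trans xx2) // lerB.
Qed.

Lemma dominated_sint_cvg nu (F : nat -> C R -> R) (f g : C R -> R) :
  (forall n, measurable_fun (circle : set (borelC R)) (F n)) ->
  measurable_fun (circle : set (borelC R)) f ->
  {ae var_measure nu, forall w, F ^~ w @ \oo --> f w} ->
  (var_measure nu).-integrable circle (EFin \o g) ->
  {ae var_measure nu, forall w n, `|F n w| <= g w} ->
  sint nu circle (F n) @[n --> \oo] --> sint nu circle f.
Proof.
move=> mF mf Ff gi Fg; have mc := @measurable_circle R.
have H b : Rintegral (sgnm nu b) circle (F n) @[n --> \oo] -->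
    Rintegral (sgnm nu b) circle f.
  have gib := (integrable_varP _ _ mc).1 gi b.
  have [|||||fi _ cv] := @dominated_convergence _ _ _ (sgnm nu b) _ mc
    (fun n => EFin \o F n) (EFin \o f) (EFin \o g).
  - by move=> n; apply/measurable_EFinP.
  - exact/measurable_EFinP.
  - apply: aeS (ae_sgnm b Ff) => w H _.
    by apply: cvg_EFin => //; exact: nearW.
  - exact: gib.
  - by apply: aeS (ae_sgnm b Fg) => w H n _; rewrite lee_fin.
  apply: fine_cvg; rewrite /Rintegral fineK; first exact: cv.
  exact: integrable_fin_num.
by rewrite sintE; under eq_fun do rewrite sintE; exact: cvgB.
Qed.

(** Near x all points of [E] lie between two points x1 and x2 of [E], and at these the kernel is
    integrable. [kerK_dominated] then gives a majorant, and dominated convergence along a sequence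
    contradicts a failure of continuity. *)
Lemma wint_continuous nu E : offpole nu ->
  (forall x, E x -> cara_dom nu (cayZ t0 x)) ->
  {ae var_measure nu, forall w, forall x1 x2, E x1 -> E x2 -> ~ x1 < cayX t0 w < x2} ->
  {within E, continuous (wint nu)}.
Proof.
move=> off dom sep; apply/subspace_continuousP => x Ex.
have mc := @measurable_circle R.
(* If [E] has no point to the left of x, then x itself serves as x1; this covers an end point at
   which the integral converges. The choice of x2 is symmetric. *)
have [x1 [d1 [d10 E1 x1x H1]]] : exists x1 d1, [/\ 0 < d1, E x1, x1 <= x &
    forall u, E u -> `|u - x| < d1 -> x1 <= u].
  have [[e [Ee ex]]|ne] := pselect (exists e, E e /\ e < x).
    exists e, (x - e); split; rewrite ?subr_gt0 ?(ltW ex) // => u _.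
    by rewrite ltr_norml => /andP[h _]; lra.
  exists x, 1; split => // u Eu _; rewrite leNgt; apply/negP => ux.
  by apply: ne; exists u.
have [x2 [d2 [d20 E2 xx2 H2]]] : exists x2 d2, [/\ 0 < d2, E x2, x <= x2 &
    forall u, E u -> `|u - x| < d2 -> u <= x2].
  have [[e [Ee ex]]|ne] := pselect (exists e, E e /\ x < e).
    exists e, (e - x); split; rewrite ?subr_gt0 ?(ltW ex) // => u _.
    by rewrite ltr_norml => /andP[_ h]; lra.
  exists x, 1; split => // u Eu _; rewrite leNgt; apply/negP => ux.
  by apply: ne; exists u.
apply/cvgrPdist_lt => e e0; apply: contrapT => H.
have {}H d : 0 < d -> exists u, [/\ E u, `|u - x| < d & e <= `|wint nu x - wint nu u|].
  move=> d0; apply: contrapT => nu'; apply: H; rewrite near_withinE.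
  apply/nbhs_ballP; exists d => // u; rewrite /ball /= => xu Eu.
  rewrite ltNge; apply/negP => h; apply: nu'; exists u; split => //.
  by rewrite distrC.
(* The first two radii keep the sequence between x1 and x2, the third forces it to converge to x. *)
pose d n := Num.min (Num.min d1 d2) n.+1%:R^-1.
have d0 n : 0 < d n by rewrite !lt_min d10 d20 invr_gt0 ltr0n.
have [u uP] := choice (fun n => H (d n) (d0 n)).
have [n1 i1] := (cara_domP _ off).1 (dom _ E1).
have [n2 i2] := (cara_domP _ off).1 (dom _ E2).
have [nx _] := (cara_domP _ off).1 (dom _ Ex).
have ux : u n @[n --> \oo] --> x.
  apply/cvgrPdist_lt => eps eps0; near=> n.
  have [_ + _] := uP n; rewrite distrC !lt_min => /andP[_ /lt_trans]; apply.
  by near: n; exact: (near_infty_natSinv_lt (PosNum eps0)).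
have : wint nu (u n) @[n --> \oo] --> wint nu x.
  apply: (@dominated_sint_cvg _ _ _ (fun w =>
      `|kerK x1 (cayX t0 w)| + `|kerK x2 (cayX t0 w)|)).
  - by move=> n; exact: measurable_kerK.
  - exact: measurable_kerK.
  - apply: aeS (ae_cayX_neq off nx) => w wx.
    have yx : cayX t0 w - x != 0 by rewrite subr_eq0.
    apply: cvgM.
      by apply: cvgD; [exact: cvg_cst|apply: cvgM => //; exact: cvg_cst].
    by apply: cvgV => //; apply: cvgB => //; exact: cvg_cst.
  - exact: (integrableD mc (integrable_norm i1) (integrable_norm i2)).
  - apply: aeS3 (ae_cayX_neq off n1) (ae_cayX_neq off n2) sep => w w1 w2 sw n.
    have [Eu + _] := uP n; rewrite !lt_min => /andP[/andP[l1 l2] _].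
    by apply: kerK_dominated => //; [rewrite H1 ?H2|exact: sw].
move/cvgrPdist_lt => /(_ e e0) [N _ /(_ N (leqnn N)) /=].
by have [_ _ /le_lt_trans/[apply]] := uP N; rewrite ltxx.
Unshelve. all: by end_near. Qed.

End kernel.

(** * The Nikishin induction on the line *)

Lemma for_continuous_sum (T : topologicalType) (K : numFieldType) (I : Type)
    (s : seq I) (P : pred I) (F : I -> T -> K) (x : T) :
  (forall i, P i -> {for x, continuous (F i)}) ->
  {for x, continuous (fun y => \sum_(i <- s | P i) F i y)}.
Proof.
move=> cF; elim: s => [|i s IH].
  have -> : (fun y => \sum_(i <- [::] | P i) F i y) = (fun=> 0).
    by apply/funext => y; rewrite big_nil.
  exact: for_continuous_cst.
have [Pi|nPi] := boolP (P i).
  have -> : (fun y => \sum_(i <- i :: s | P i) F i y) =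
      (fun y => F i y + \sum_(i <- s | P i) F i y).
    by apply/funext => y; rewrite big_cons Pi.
  exact: for_continuousD (cF i Pi) IH.
have -> // : (fun y => \sum_(i <- i :: s | P i) F i y) =
    (fun y => \sum_(i <- s | P i) F i y).
by apply/funext => y; rewrite big_cons (negPf nPi).
Qed.

Lemma poly_continuous (K : numFieldType) (p : {poly K}) : continuous (horner p).
Proof.
move=> x; elim/poly_ind: p => [|p c IH].
  have -> : horner (0 : {poly K}) = (fun=> 0) by apply/funext => y; rewrite horner0.
  exact: for_continuous_cst.
have -> : horner (p * 'X + c%:P) = (fun y => p.[y] * y + c).
  by apply/funext => y; rewrite hornerMXaddC.
apply: (@for_continuousD _ _ (fun y => p.[y] * y)); last exact: for_continuous_cst.
by apply: (@for_continuousM _ _ (horner p) id) => //; exact: cvg_id.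
Qed.

Lemma measurable_horner (R : realType) (p : {poly R}) :
  measurable_fun setT (fun x : R => p.[x]).
Proof. by apply: continuous_measurable_fun; exact: poly_continuous. Qed.

Section nikishin_theory.
Variables (R : realType) (r : nat) (Gamma : 'I_r.+1 -> set (C R)).
Variables (sigma mu : 'I_r.+1 -> borel_charge R) (t0 : R).
Hypothesis nik : nikishin Gamma sigma mu.
Hypothesis nG : forall j, ~ Gamma j (expi t0).

Local Notation X := (cayX t0).
Local Notation Z := (cayZ t0).

(* <sigma_i, ..., sigma_j> *)
Definition ibracket (i j : nat) : borel_charge R := iter_bracket sigma i (j - i).

Lemma ibii i : ibracket i i = sigma (inord i).
Proof. by rewrite /ibracket subnn. Qed.

Lemma ib_bracket i j : (i < j <= r)%N ->
  is_bracket (sigma (inord i)) (ibracket i.+1 j) (ibracket i j).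
Proof.
move=> /andP[ij jr]; rewrite /ibracket -(subnSK ij) /= /bracket.
have ex := nikishin_bracket nik (_ : (i + (j - i.+1).+1 <= r)%N).
case: pselect => [h|]; first by case: cid.
by case; apply: ex; lia.
Qed.

Lemma sigma_sign i : constant_sign (sigma i).
Proof. by have [] := nikishin_generator nik i. Qed.

Lemma ae_sigma_Gamma i : {ae var_measure (sigma i), forall w, Gamma i w}.
Proof.
have [_ _ _ sG] := nikishin_generator nik i.
by apply: aeS (ae_supp (sigma i)) => w /sG.
Qed.

Lemma ae_ib_Gamma i j : (i <= j <= r)%N ->
  {ae var_measure (ibracket i j), forall w, Gamma (inord i) w}.
Proof.
move=> /andP[ij jr]; move: ij; rewrite leq_eqVlt => /orP[/eqP <-|ij].
  by rewrite ibii; exact: ae_sigma_Gamma.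
apply: (has_density_dominated (sigma_sign _) (ib_bracket _)).
  by rewrite ij.
exact: ae_sigma_Gamma.
Qed.

Lemma Gamma_offpole i w : Gamma i w -> circle w /\ w != expi t0.
Proof.
move=> Gw; split; first exact: arc_circle (nikishin_arc nik i) _ Gw.
by apply/eqP => E; apply: (nG (j := i)); rewrite -E.
Qed.

Lemma Gamma_cayX i w : Gamma i w -> Gamma i (Z (X w)).
Proof. by move=> Gw; have [wc woff] := Gamma_offpole Gw; rewrite cayXK. Qed.

Lemma ib_offpole i j : (i <= j <= r)%N -> offpole t0 (ibracket i j).
Proof. by move=> /ae_ib_Gamma; apply: aeS => w /Gamma_offpole. Qed.

Lemma Gamma_separation i x1 x2 y : (i < r)%N ->
  Gamma (inord i) (Z x1) -> Gamma (inord i) (Z x2) -> Gamma (inord i.+1) (Z y) ->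
  ~ x1 < y < x2.
Proof.
move=> ir G1 G2 Gy; apply: (arc_separation _ _ _ _ _ G1 G2 Gy) => //.
- exact: nikishin_arc nik _.
- exact: nikishin_arc nik _.
- by apply: (nikishin_disjoint nik); rewrite !inordK //; lia.
Qed.

Lemma Gamma_separation' i x1 x2 y : (i < r)%N ->
  Gamma (inord i.+1) (Z x1) -> Gamma (inord i.+1) (Z x2) -> Gamma (inord i) (Z y) ->
  ~ x1 < y < x2.
Proof.
move=> ir G1 G2 Gy; apply: (arc_separation _ _ _ _ _ G1 G2 Gy) => //.
- exact: nikishin_arc nik _.
- exact: nikishin_arc nik _.
- by rewrite setIC; apply: (nikishin_disjoint nik); rewrite !inordK //; lia.
Qed.

Variable n : 'I_r.+1 -> nat.

(** The part of the arc, in the Cayley coordinate, where the weights of level [i] are convergent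
    integrals; an end point of the arc may drop out. An index with [n j = 0] brings no coefficients
    and imposes no condition. *)
Definition lvl (i : nat) : set R := [set x | Gamma (inord i) (Z x) /\
  forall j : 'I_r.+1, (i < j)%N -> (0 < n j)%N -> cara_dom (ibracket i.+1 j) (Z x)].

Definition line_weight (i j : nat) (x : R) : R :=
  if i == j then 1 else wint t0 (ibracket i.+1 j) x.

(* Agrees with [line_weight] at the points of [lvl], but is measurable on the
   whole circle. *)
Definition circle_weight (i j : nat) (z : C R) : R :=
  if i == j then 1 else complex.Re (icara (ibracket i.+1 j) z).

Lemma ae_sep i j : (i < j <= r)%N -> {ae var_measure (ibracket i.+1 j),
  forall w, forall x1 x2, Gamma (inord i) (Z x1) -> Gamma (inord i) (Z x2) ->
    ~ x1 < X w < x2}.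
Proof.
move=> /andP[ij jr]; have h : (i.+1 <= j <= r)%N by rewrite ij.
apply: aeS (ae_ib_Gamma h) => w /Gamma_cayX Gw x1 x2 G1 G2.
by apply: (Gamma_separation _ G1 G2 Gw); apply: leq_trans jr.
Qed.

Lemma ltn_jr (i : nat) (j : 'I_r.+1) : (i < j)%N -> (i < j <= r)%N.
Proof. by move=> ->; rewrite -ltnS ltn_ord. Qed.

Lemma lvl_convex i x1 x2 x : lvl i x1 -> lvl i x2 -> x1 <= x <= x2 -> lvl i x.
Proof.
move=> [G1 d1] [G2 d2] x12; split.
  have [->//|nx1] := eqVneq x x1; have [->//|nx2] := eqVneq x x2.
  apply: (arc_convex (nikishin_arc nik _) (nG (j := _)) G1 G2).
  by rewrite !cayZK !lt_neqAle eq_sym nx1 nx2.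
move=> j ij nj; have ijr := ltn_jr ij.
apply: (cara_dom_convex (ib_offpole _) _ x12 (d1 j ij nj) (d2 j ij nj)).
  by case/andP: ijr => -> ->.
by apply: aeS (ae_sep ijr) => w; apply.
Qed.

Lemma wt_continuous i (j : 'I_r.+1) : (i <= j)%N -> (0 < n j)%N ->
  {within lvl i, continuous (line_weight i j)}.
Proof.
rewrite leq_eqVlt => /orP[/eqP ->|ij] nj.
  rewrite /line_weight eqxx; exact: cst_continuous.
rewrite /line_weight ltn_eqF //; have ijr := ltn_jr ij.
apply: wint_continuous.
- by apply: ib_offpole; case/andP: ijr => -> ->.
- by move=> x [_]; exact.
- by apply: aeS (ae_sep ijr) => w H x1 x2 [G1 _] [G2 _]; exact: H.
Qed.

Lemma ae_sigma_lvl i : (i <= r)%N -> {ae var_measure (sigma (inord i)),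
  forall w, [/\ circle w, w != expi t0, lvl i (X w) & w = Z (X w)]}.
Proof.
move=> ir.
(* The ordinals are reached through [k : nat], so that a countable intersection of sets of full
   measure can be taken. For each k, convergence almost everywhere is part of the existence of the
   bracket. *)
have H : {ae var_measure (sigma (inord i)), forall w, forall k : nat,
    forall j : 'I_r.+1, j = k :> nat -> (i < j)%N -> circle w ->
    cara_dom (ibracket i.+1 j) w}.
  apply: ae_foralln => k.
  have [/andP[kr ik]|nk] := boolP ((k <= r) && (i < k))%N; last first.
    apply: aeW => w j jk ij; case/negP: nk.
    by rewrite -jk ij andbT -ltnS ltn_ord.
  have ikr : (i < k <= r)%N by rewrite ik.
  have [dom _ _] := ib_bracket ikr.
  by apply: aeS dom => w H j -> _; exact: H.
apply: aeS2 (ae_sigma_Gamma (inord i)) H => w Gw H.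
have [wc woff] := Gamma_offpole Gw; have wE := cayXK wc woff.
by split=> //; split; rewrite wE // => j ij nj; exact: (H j j).
Qed.

Lemma cwtE i (j : 'I_r.+1) x : (i <= j)%N -> (0 < n j)%N -> lvl i x ->
  circle_weight i j (Z x) = line_weight i j x.
Proof.
rewrite leq_eqVlt /circle_weight /line_weight => /orP[->//|ij] nj [_ d].
rewrite ltn_eqF // icara_cayZ //; last exact: d.
by apply: ib_offpole; case/andP: (ltn_jr ij) => -> ->.
Qed.

Lemma measurable_cwt i (j : 'I_r.+1) : (i <= j)%N ->
  measurable_fun (circle : set (borelC R)) (circle_weight i j).
Proof.
rewrite leq_eqVlt /circle_weight => /orP[->|ij]; first exact: measurable_cst.
rewrite ltn_eqF //; have [_ [ri _] _] := ib_bracket (ltn_jr ij).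
by apply/measurable_EFinP; exact: measurable_int ri.
Qed.


(** * Zero bounds and non-orthogonality of the forms of a level *)

Hypothesis npar : forall j k, odd (n j) = odd (n k).
Hypothesis nmon : nonincreasing_index n.

Definition halfdiff (i : nat) (j : 'I_r.+1) : nat := ((n (inord i) - n j)./2)%N.

Definition deg (i : nat) : nat := (\sum_(j : 'I_r.+1 | (i <= j)%N) n j)%N.

(* Since [1 + x ^+ 2 = |x + 'i| ^+ 2], these powers bring the half-integer forms
   of different lengths [n j] to a common denominator. *)
Definition wform (i : nat) (P : 'I_r.+1 -> {poly R}) (w : 'I_r.+1 -> R) (x : R) : R :=
  \sum_(j : 'I_r.+1 | (i <= j)%N) (P j).[x] * (1 + x ^+ 2) ^+ halfdiff i j * w j.

Definition admissible (i : nat) (P : 'I_r.+1 -> {poly R}) : Prop :=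
  (forall j : 'I_r.+1, (i <= j)%N -> (size (P j) <= n j)%N) /\
  exists2 j : 'I_r.+1, (i <= j)%N & P j != 0.

Definition zero_bound (i : nat) : Prop := forall P, admissible i P ->
  ~ exists s : seq R, [/\ uniq s, size s = deg i &
      forall x, x \in s -> lvl i x /\ wform i P ((line_weight i)^~ x) x = 0].

(** The factor [rho] of constant sign leaves room for what elimination produces: a nodal product and
    powers of 1 + x^2, or at level 0 a negative power of the square root of 1 + x^2. Integrability
    is part of orthogonality, so that the value 0 is that of a convergent integral. *)
Definition nonorthogonal (i : nat) : Prop :=
  forall (P : 'I_r.+1 -> {poly R}) (rho : R -> R) (b : bool), admissible i P ->
  {ae var_measure (sigma (inord i)), forall w, 0 < (-1) ^+ b * rho (X w)} ->
  ~ forall q : {poly R}, (size q <= deg i)%N ->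
    let f w := q.[X w] * wform i P ((circle_weight i)^~ w) (X w) * rho (X w) in
    (var_measure (sigma (inord i))).-integrable circle (EFin \o f) /\
    sint (sigma (inord i)) circle f = 0.

(** Parity makes the halving in [halfdiff] exact, and monotonicity keeps the subtraction from being
    truncated. *)
Lemma n_halfdiff i (j : 'I_r.+1) : (i <= j)%N ->
  n (inord i) = (n j + (halfdiff i j).*2)%N.
Proof.
move=> ij; have ir : (i < r.+1)%N := leq_ltn_trans ij (ltn_ord j).
have nij : (n j <= n (inord i))%N by apply: nmon; rewrite inordK.
rewrite /halfdiff halfK oddB // (npar j (inord i)) addbb subn0.
by rewrite subnKC.
Qed.

Lemma form_ivp i P : (i <= r)%N -> admissible i P ->
  ivp (lvl i) (fun x => wform i P ((line_weight i)^~ x) x).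
Proof.
move=> ir [sP _]; pose L x := wform i P ((line_weight i)^~ x) x.
rewrite -[X in ivp _ X]/L => u v lu lv uv.
have cL : {within lvl i, continuous L}.
  move=> x; apply: for_continuous_sum => j ij.
  (* A zero polynomial is set apart because its weight may have [n j = 0], and [lvl] does not
     control such a weight. *)
  have [->|Pj0] := eqVneq (P j) 0.
    have -> : (fun y => (0 : {poly R}).[y] * (1 + y ^+ 2) ^+ halfdiff i j * line_weight i j y) =
        (fun=> 0).
      by apply/funext => y; rewrite horner0 !mul0r.
    exact: for_continuous_cst.
  have nj : (0 < n j)%N by apply: leq_trans (sP j ij); rewrite lt0n size_poly_eq0.
  apply: for_continuousM; last exact: wt_continuous.
  have -> : (fun y => (P j).[y] * (1 + y ^+ 2) ^+ halfdiff i j) =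
      horner (P j * (1 + 'X^2) ^+ halfdiff i j).
    by apply/funext => y; rewrite hornerM horner_exp !hornerE.
  by apply: continuous_subspaceT; exact: poly_continuous.
move=> Luv.
have sub : `[u, v]%classic `<=` lvl i.
  by move=> y; rewrite /= in_itv; exact: lvl_convex.
have [|c cuv Lc] := @IVT R L u v 0 (ltW uv) (continuous_subspaceW sub cL).
  rewrite ge_min le_max; have [Lu|Lu|Lu] := ltgtP (L u) 0.
  - by rewrite /= ltW // -(nmulr_rlt0 _ Lu).
  - by rewrite /= andbT -(pmulr_rle0 _ Lu) ltW.
  - by move: Luv; rewrite Lu mul0r ltxx.
exists c; split=> //; first exact: sub.
move: cuv; rewrite in_itv /= => /andP[uc cv].
rewrite !lt_neqAle uc cv !andbT; apply/andP; split.
  by apply/eqP => E; move: Luv; rewrite E Lc mul0r ltxx.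
by apply/eqP => E; move: Luv; rewrite -E Lc mulr0 ltxx.
Qed.

(** The zero bound provides a q, within the allowed size, for which q times the form has constant
    sign and finitely many zeros on [lvl i]. Orthogonality to this q makes the integrand vanish
    almost everywhere, so [sigma_i] would be concentrated on finitely many points, against its
    infinite support. *)
Lemma nonorthogonalW i : (i <= r)%N -> zero_bound i -> nonorthogonal i.
Proof.
move=> ir zb P rho b adm rho0 orth; have [sP _] := adm.
have mc := @measurable_circle R.
have [q [c [s [sq qL qLs]]]] := sign_poly (form_ivp ir adm) (zb P adm).
have [fi f0] := orth q sq; set f := fun w => _ in fi f0.
have [e [sE _]] := constant_sign_sint (sigma_sign (inord i)).
have wE w : lvl i (X w) -> w = Z (X w) ->
    wform i P ((circle_weight i)^~ w) (X w) = wform i P ((line_weight i)^~ (X w)) (X w).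
  move=> lw wE; apply: eq_bigr => j ij.
  have [->|Pj0] := eqVneq (P j) 0; first by rewrite horner0 !mul0r.
  have nj : (0 < n j)%N by apply: leq_trans (sP j ij); rewrite lt0n size_poly_eq0.
  by congr (_ * _); rewrite {1}wE cwtE.
have gi := integrableZr' ((-1) ^+ c * (-1) ^+ b) mc fi.
have : Rintegral (var_measure (sigma (inord i))) circle
    (fun w => (-1) ^+ c * (-1) ^+ b * f w) = 0.
  rewrite RintegralZl //; move: f0; rewrite sE // => /eqP.
  by rewrite mulf_eq0 signr_eq0 /= => /eqP ->; rewrite mulr0.
move/(Rintegral_ge0_eq0 mc gi) => /(_ _)/wrap[].
  apply: aeS2 (ae_sigma_lvl ir) rho0 => w [wc woff lw Zw] rw _.
  rewrite /f wE // mulrACA; apply: mulr_ge0; [exact: qL|exact: ltW].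
move=> f0'.
have aes : {ae var_measure (sigma (inord i)), forall w, w \in [seq Z x | x <- s]}.
  apply: aeS3 f0' (ae_sigma_lvl ir) rho0 => w fw [wc woff lw Zw] rw.
  rewrite Zw; apply: map_f; apply: qLs => //.
  move: (fw wc); rewrite /f wE // mulrACA => /eqP.
  rewrite mulf_eq0 [X in _ || X]gt_eqF // orbF mulf_eq0 signr_eq0 /=.
  by move/eqP.
have [_ _ inf _] := nikishin_generator nik (inord i).
apply: inf; apply: (@sub_finite_set _ _ [set` [seq Z x | x <- s]]); last first.
  exact: finite_seq.
move=> z zsupp /=; apply: contrapT => zs.
(* The complement of the finite set is open and null, hence contains no point of the support. *)
have oU : open (~` [set` [seq Z x | x <- s]] : set (C R)).
  rewrite openC; apply: accessible_finite_set_closed.1; last exact: finite_seq.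
  by apply: hausdorff_accessible; exact: norm_hausdorff.
have := zsupp _ oU zs; rewrite lt0e => /andP[/eqP + _]; apply.
have [A [mA A0 sA]] := aes.
by apply: (subset_measure0 _ _ _ A0) => //; exact: borel_open.
Qed.


Lemma wform_wt_form i P x : wform i P ((line_weight i)^~ x) x =
  \sum_(j : 'I_r.+1 | (i <= j)%N)
     (P j * (1 + 'X^2) ^+ halfdiff i j).[x] * line_weight i j x.
Proof. by apply: eq_bigr => j _; rewrite hornerM horner_exp !hornerE. Qed.

Lemma wform_first i P x : (i <= r)%N -> wform i P ((line_weight i)^~ x) x =
  (P (inord i)).[x] + \sum_(j : 'I_r.+1 | (i < j)%N)
     (P j * (1 + 'X^2) ^+ halfdiff i j).[x] * line_weight i j x.
Proof.
move=> ir; rewrite wform_wt_form (bigD1 (inord i)) /= ?inordK //.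
congr (_ + _); last first.
  apply: eq_bigl => j; rewrite ltn_neqAle andbC eq_sym; congr (~~ _ && _).
  by rewrite -val_eqE /= inordK.
by rewrite /halfdiff subnn expr0 mulr1 /line_weight eqxx mulr1.
Qed.

Lemma deg_first i : (i <= r)%N -> deg i = (n (inord i) + deg i.+1)%N.
Proof.
move=> ir; rewrite /deg (bigD1 (inord i)) /= ?inordK //; congr (_ + _)%N.
apply: eq_bigl => j; rewrite ltn_neqAle andbC eq_sym; congr (~~ _ && _).
by rewrite -val_eqE /= inordK.
Qed.

(** The form is the single polynomial P_i, of size at most n_i, and n_i is at most [deg i]. *)
Lemma zero_bound_poly i P : (i <= r)%N -> admissible i P ->
  (forall j : 'I_r.+1, (i < j)%N -> P j = 0) ->
  ~ exists s : seq R, [/\ uniq s, size s = deg i &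
      forall x, x \in s -> lvl i x /\ wform i P ((line_weight i)^~ x) x = 0].
Proof.
move=> ir [sP [j ij Pj]] P0 [s [us ss sz]].
have Pi : P (inord i) != 0.
  move: ij Pj; rewrite leq_eqVlt => /orP[/eqP ->|/P0 ->]; last by rewrite eqxx.
  by rewrite inord_val.
have := @max_poly_roots _ _ s Pi _ us.
rewrite ss deg_first // => /(_ _)/wrap[].
  apply/allP => x /sz[_]; rewrite wform_first // big1 ?addr0 => [/rootP //|k ik].
  by rewrite P0 // mul0r horner0 mul0r.
by rewrite ltnNge (leq_trans (sP _ _)) ?leq_addr // inordK.
Qed.

(** The half differences telescope through n_{i+1}. The first summand does not depend on j, so the
    corresponding power of 1 + x^2 can be moved into the measure when the level rises. *)
Lemma halfdiffD i (j : 'I_r.+1) : (i < j)%N ->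
  halfdiff i j = (halfdiff i (inord i.+1) + halfdiff i.+1 j)%N.
Proof.
move=> ij; have jr := ltn_ord j.
have h1 := n_halfdiff (ltnW ij); have h2 := n_halfdiff ij.
have h3 : n (inord i) = (n (inord i.+1) + (halfdiff i (inord i.+1)).*2)%N.
  by apply: n_halfdiff; rewrite inordK; lia.
lia.
Qed.

Lemma sub_pole_ae i (j : 'I_r.+1) x : (i < j)%N -> (0 < n j)%N -> lvl i x ->
  {ae var_measure (ibracket i.+1 j), forall w, X w != x}.
Proof.
move=> ij nj [_ d]; have ijr := ltn_jr ij.
have off : offpole t0 (ibracket i.+1 j) by apply: ib_offpole; case/andP: ijr => -> ->.
by apply: ae_cayX_neq => //; have [] := d j ij nj.
Qed.

(* Lagrange interpolation at the nodes [x] turns the values of the weights of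
   level [i] into integrals against those of level [i.+1]. *)
Lemma transfer i (j : 'I_r.+1) N (x : 'I_N -> R) (f : {poly R}) :
  (i < j)%N -> injective x -> (forall k, lvl i (x k)) -> (size f < N)%N ->
  (0 < n j)%N ->
  let g w := f.[X w] * (1 + X w ^+ 2) / \prod_k (X w - x k) * circle_weight i.+1 j w in
  (var_measure (sigma (inord i.+1))).-integrable circle (EFin \o g) /\
  sint (sigma (inord i.+1)) circle g =
    \sum_k f.[x k] / node_diff x k * line_weight i j (x k).
Proof.
move=> ij xi xl sf nj g; have ijr := ltn_jr ij.
have mc := @measurable_circle R.
have off : offpole t0 (ibracket i.+1 j) by apply: ib_offpole; case/andP: ijr => -> ->.
have Ki k : (var_measure (ibracket i.+1 j)).-integrable circle
    (EFin \o (fun w => kerK (x k) (X w))).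
  by have [_ d] := xl k; have [] := (cara_domP _ off).1 (d j ij nj).
pose G w := \sum_k f.[x k] / node_diff x k * kerK (x k) (X w).
pose h w := f.[X w] * (1 + X w ^+ 2) / \prod_k (X w - x k).
have Gi : (var_measure (ibracket i.+1 j)).-integrable circle (EFin \o G).
  by apply: integrable_sumr => // k _; exact: integrableZr'.
have mX D : measurable_fun (D : set (borelC R)) X.
  by apply: measurable_funTS; exact: measurable_cayX.
have mh : measurable_fun (circle : set (borelC R)) h.
  apply: measurable_funM.
    apply: measurable_funM; first exact: (measurableT_comp (measurable_horner f)).
    by apply: measurable_funD => //; exact: measurable_funX.
  apply: (measurableT_comp (@measurable_invr R)).
  have -> : (fun w => \prod_k (X w - x k)) = (fun w => (\prod_k ('X - (x k)%:P)).[X w]).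
    apply/funext => w; rewrite horner_prod.
    by apply: eq_bigr => k _; rewrite hornerXsubC.
  exact: (measurableT_comp (measurable_horner _)).
have Gh : {ae var_measure (ibracket i.+1 j), forall w, circle w -> G w = h w}.
  have H : {ae var_measure (ibracket i.+1 j), forall w, forall m : nat,
      forall k : 'I_N, k = m :> nat -> X w != x k}.
    apply: ae_foralln => m; have [mN|Nm] := ltnP m N.
      apply: aeS (sub_pole_ae ij nj (xl (Ordinal mN))) => w wx k km.
      by rewrite (_ : k = Ordinal mN) //; apply: val_inj.
    by apply: aeW => w k km; have := ltn_ord k; rewrite km ltnNge Nm.
  apply: aeS H => w wx _; rewrite /G /h /kerK.
  by apply: divided_difference_kernel => // k; exact: (wx k k).
have mG := (measurable_EFinP _ _).1 (measurable_int _ Gi).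
have hi := ae_eq_integrable mc mh Gh Gi.
have hE : sint (ibracket i.+1 j) circle h = \sum_k f.[x k] / node_diff x k
    * line_weight i j (x k).
  rewrite -(ae_eq_sint mc mG mh Gh) sint_sum // => [|k _]; last exact: integrableZr'.
  by apply: eq_bigr => k _; rewrite sintZ // /line_weight ltn_eqF.
(* For j = i + 1 the bracket is [sigma_{i+1}] itself, with weight 1; otherwise the integral is
   carried over to [sigma_{i+1}] through the density of the bracket. *)
have [E|ne] := eqVneq i.+1 j.
  have gE : g = h by apply/funext => w; rewrite /g /circle_weight E eqxx mulr1.
  by move: hi hE; rewrite gE -E ibii.
have ij' : (i.+1 < j <= r)%N by rewrite ltn_neqAle ne; case/andP: ijr => -> ->.
have [] := has_density_change (sigma_sign _) (ib_bracket ij') hi.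
by rewrite hE /g /circle_weight (negPf ne).
Qed.

(** The count behind the elimination: with q of size at most [deg i.+1], the product q P_j (1 +
    x^2)^(halfdiff i j) has size at most deg(i+1) + n_j + 2 halfdiff - 1 = N - 1, where N = [deg i]
    is the number of nodes. So [transfer] applies to each j > i, and the divided difference of q P_i
    vanishes by the same bound. *)
Lemma zero_boundS i : (i < r)%N -> nonorthogonal i.+1 -> zero_bound i.
Proof.
move=> ir no P adm; have [sP [j0 ij0 Pj0]] := adm; have mc := @measurable_circle R.
have [[j ij Pj]|nP] := pselect (exists2 j : 'I_r.+1, (i < j)%N & P j != 0); last first.
  apply: zero_bound_poly => //; first exact: ltnW.
  by move=> j ij; apply/eqP; apply: contrapT => /negP Pj; apply: nP; exists j.
move=> [s [us ss sz]]; set N := deg i in ss.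
have NE := deg_first (ltnW ir).
have njP (k : 'I_r.+1) : (i <= k)%N -> P k != 0 -> (0 < n k)%N.
  by move=> ik Pk; apply: leq_trans (sP k ik); rewrite lt0n size_poly_eq0.
have nj := njP j (ltnW ij) Pj.
have ni1 : (0 < n (inord i.+1))%N.
  by apply: leq_trans nj _; apply: nmon; rewrite inordK.
have ni0 : (0 < n (inord i))%N.
  by apply: leq_trans nj _; apply: nmon; rewrite inordK; lia.
pose x (k : 'I_N) := s`_k.
have xs k : x k \in s by rewrite mem_nth // ss.
have xi : injective x.
  move=> k l /eqP; rewrite nth_uniq ?ss // => /eqP; exact: val_inj.
have xl k : lvl i (x k) by have [] := sz _ (xs k).
have adm' : admissible i.+1 P.
  by split; [move=> k /ltnW; exact: sP|exists j].
(* A node lies on the previous arc and cannot separate two points of the next one, so each factor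
   keeps its sign there. *)
have [b bP] : exists b : bool, forall y, Gamma (inord i.+1) (Z y) ->
    0 <= (-1) ^+ b * \prod_k (y - x k).
  apply: (@prod_constant_sign R N x [set y | Gamma (inord i.+1) (Z y)]) => k.
  have [[y [Gy xy]]|ny] := pselect (exists y, Gamma (inord i.+1) (Z y) /\ x k < y).
    right=> y' Gy'; rewrite leNgt; apply/negP => yx.
    by apply: (Gamma_separation' ir Gy' Gy (xl k).1); rewrite yx.
  by left=> y Gy; rewrite leNgt; apply/negP => xy; apply: ny; exists y.
pose e := halfdiff i (inord i.+1).
(* The factors common to all terms: the power split off by [halfdiffD], the 1 + y^2 produced by the
   kernel, and the nodal product. *)
pose rho y := (1 + y ^+ 2) ^+ e * (1 + y ^+ 2) / \prod_k (y - x k).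
apply: (no P rho b adm').
  have i1 : (i < @inord r i.+1)%N by rewrite inordK.
  (* No node carries mass of [sigma_{i+1}]: [cara_dom] excludes atoms, and it applies to the index i
     + 1 because n_{i+1} > 0 by monotonicity. *)
  have H : {ae var_measure (sigma (inord i.+1)), forall w, forall m : nat,
      forall k : 'I_N, k = m :> nat -> X w != x k}.
    apply: ae_foralln => m; have [mN|Nm] := ltnP m N.
      have := sub_pole_ae i1 ni1 (xl (Ordinal mN)).
      rewrite inordK // ibii; apply: aeS => w wx k km.
      by rewrite (_ : k = Ordinal mN) //; apply: val_inj.
    by apply: aeW => w k km; have := ltn_ord k; rewrite km ltnNge Nm.
  apply: aeS2 H (ae_sigma_Gamma (inord i.+1)) => w wx /Gamma_cayX Gw.
  have y0 : 0 < 1 + X w ^+ 2 by rewrite ltr_pwDl // sqr_ge0.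
  rewrite /rho mulrCA mulr_gt0 //; first by rewrite mulr_gt0 // exprn_gt0.
  have p0 : \prod_k (X w - x k) != 0.
    by apply/prodf_neq0 => k _; rewrite subr_eq0; exact: (wx k k).
  rewrite -(pmulr_lgt0 _ (_ : 0 < (\prod_k (X w - x k)) ^+ 2)).
    by rewrite expr2 mulrA mulfVK // lt0r bP // mulf_neq0 ?signr_eq0.
  by rewrite exprn_even_gt0.
move=> q sq f; pose h (k : 'I_r.+1) : {poly R} := q * (P k * (1 + 'X^2) ^+ halfdiff i k).
have sh (k : 'I_r.+1) : (i < k)%N -> (size (h k) < N)%N.
  move=> ik; rewrite /N NE /h.
  have [->|Pk] := eqVneq (P k) 0.
    by rewrite mul0r mulr0 size_poly0; lia.
  have s2 : (size ((1 + 'X^2 : {poly R}) ^+ halfdiff i k)%R <= (halfdiff i k).*2.+1)%N.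
    rewrite (leq_trans (size_poly_exp_leq _ _)) // ltnS.
    have : (size (1 + 'X^2 : {poly R})%R <= 3)%N.
      by rewrite (leq_trans (size_polyD _ _)) // size_poly1 size_polyXn.
    by rewrite -muln2 mulnC leq_mul2l; lia.
  have := size_polyMleq q (P k * (1 + 'X^2) ^+ halfdiff i k).
  have := size_polyMleq (P k) ((1 + 'X^2) ^+ halfdiff i k).
  have := sP k (ltnW ik); have := n_halfdiff (ltnW ik).
  by lia.
pose g (k : 'I_r.+1) w := (h k).[X w] * (1 + X w ^+ 2)
    / \prod_l (X w - x l) * circle_weight i.+1 k w.
have gP (k : 'I_r.+1) : (i < k)%N ->
    (var_measure (sigma (inord i.+1))).-integrable circle (EFin \o g k) /\
    sint (sigma (inord i.+1)) circle (g k) =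
      \sum_l (h k).[x l] / node_diff x l * line_weight i k (x l).
  move=> ik; have [Pk|Pk] := eqVneq (P k) 0; last first.
    by apply: transfer => //; [exact: sh|exact: njP (ltnW ik) Pk].
  have h0 : h k = 0 by rewrite /h Pk mul0r mulr0.
  have -> : g k = fun=> 0 by apply/funext => w; rewrite /g h0 horner0 !mul0r.
  rewrite sint0; split; first exact: integrable0.
  by rewrite big1 // => l _; rewrite h0 horner0 !mul0r.
have fE : f = fun w => \sum_(k : 'I_r.+1 | (i < k)%N) g k w.
  apply/funext => w; rewrite /f /wform mulr_sumr mulr_suml; apply: eq_bigr => k ik.
  rewrite /g /h /rho !hornerM horner_exp !hornerE (halfdiffD ik) exprD -/e.
  rewrite /=; move: (_ ^+ e) (_ ^+ halfdiff i.+1 k) (_^-1) (circle_weight _ _ _) => A B V c.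
  by ring.
have gi (k : 'I_r.+1) (ik : (i < k)%N) := (gP k ik).1.
rewrite fE; split; first by apply: integrable_sumr => // k /gi.
rewrite sint_sum // (eq_bigr _ (fun k ik => (gP k ik).2)) exchange_big /=.
(* At a node the form vanishes, so the terms with j > i add up to minus the value of P_i; what
   remains is a divided difference of q P_i. *)
transitivity (- \sum_l (q * P (inord i)).[x l] / node_diff x l).
  rewrite -sumrN; apply: eq_bigr => l _.
  have [_] := sz _ (xs l); rewrite wform_first ?(ltnW ir) // => /eqP.
  rewrite addr_eq0 => /eqP PE; rewrite hornerM PE mulrN mulNr opprK.
  rewrite mulr_sumr mulr_suml; apply: eq_bigr => k ik.
  by rewrite /h hornerM; ring.
rewrite divided_difference_low ?oppr0 //.
apply: (leq_ltn_trans (size_polyMleq _ _)); rewrite /N NE.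
have sPi : (size (P (inord i)) <= n (inord i))%N.
  by apply: sP; rewrite inordK // ltnS ltnW.
have d0 : (0 < deg i.+1)%N by rewrite deg_first // addn_gt0 ni1.
move: (size q) (size (P (inord i))) (n (inord i)) (deg i.+1) sq sPi ni0 d0 => a c m d.
by lia.
Qed.

Lemma zero_bound_nonorthogonal i : (i <= r)%N -> zero_bound i /\ nonorthogonal i.
Proof.
move=> ir; have [k kE] : exists k, (k + i = r)%N by exists (r - i)%N; rewrite subnK.
elim: k i ir kE => [|k IH] i ir kE.
  have zb : zero_bound i.
    move=> P adm; apply: zero_bound_poly => // j ij.
    by have := ltn_ord j; lia.
  by split => //; exact: nonorthogonalW.
have zb : zero_bound i.
  have ir' : (i < r)%N by lia.
  by apply: zero_boundS => //; apply: (IH i.+1 ir' _).2; lia.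
by split => //; exact: nonorthogonalW.
Qed.

End nikishin_theory.

(** * Half-integer powers in the Cayley coordinate *)

Section half_powers.
Variables (R : realType) (t0 : R).
Implicit Types (x : R) (z : C R).

Local Notation X := (cayX t0).
Local Notation Z := (cayZ t0).
Local Notation e0 := (expi (t0 / 2) : C R).

Definition rho x : R := Num.sqrt (1 + x ^+ 2).

Lemma rho_gt0 x : 0 < rho x.
Proof. by rewrite sqrtr_gt0 ltr_pwDl // sqr_ge0. Qed.

Lemma rho_sqr x : rho x ^+ 2 = 1 + x ^+ 2.
Proof. by rewrite sqr_sqrtr // addr_ge0 // sqr_ge0. Qed.

Lemma rhoC_neq0 x : (rho x)%:C%C != 0 :> C R.
Proof. by rewrite eq_complex /= eqxx andbT gt_eqF // rho_gt0. Qed.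

(** The numerator of z^((2 l - m)/2) in the Cayley coordinate, up to a constant of modulus 1: the
    factors i - x and -i - x come from z^(1/2) and z^(-1/2), each over [rho x]. *)
Definition hbasis (m l : nat) : {poly C R} :=
  ('i%:P - 'X) ^+ l * (- 'i%:P - 'X) ^+ (m - l).

Lemma sqrt_cay_neq0 x : sqrt_from t0 (Z x) != 0.
Proof.
rewrite sqrt_from_cayZ mulf_neq0 ?expi_neq0 // mulf_neq0 ?invr_eq0 ?rhoC_neq0 //.
by rewrite -opprB oppr_eq0 xBi_neq0.
Qed.

Lemma sqrt_cay_inv x : (sqrt_from t0 (Z x))^-1 =
  e0^-1 * ((- 'i - x%:C%C) / (rho x)%:C%C).
Proof.
apply: (mulfI (sqrt_cay_neq0 x)); rewrite mulfV ?sqrt_cay_neq0 // sqrt_from_cayZ -/(rho x).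
rewrite mulrACA divff ?expi_neq0 // mul1r mulf_div -expr2 -rmorphXn /= rho_sqr.
have -> : ('i - x%:C%C) * (- 'i - x%:C%C) = (x%:C%C + 'i) * (x%:C%C - 'i) :> C R by ring.
by rewrite xDixBi divff // -xDixBi mulf_neq0 ?xDi_neq0 ?xBi_neq0.
Qed.

Lemma hpow_cay x (m l : nat) : (l <= m)%N ->
  hpow t0 (Z x) (l%:Z - (m - l)%N%:Z) =
  (e0 ^+ l / e0 ^+ (m - l)) * ((hbasis m l).[x%:C%C] / (rho x)%:C%C ^+ m).
Proof.
move=> lm; rewrite /hpow expfzDr ?sqrt_cay_neq0 // -exprnN -exprnP -exprVn.
rewrite sqrt_cay_inv sqrt_from_cayZ -/(rho x) !exprMn mulrACA; congr (_ * _).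
  by rewrite exprVn.
rewrite /hbasis hornerM !horner_exp !hornerE /=.
have -> : (rho x)%:C%C ^+ m = (rho x)%:C%C ^+ l * (rho x)%:C%C ^+ (m - l) :> C R.
  by rewrite -exprD subnKC.
by rewrite invfM !exprVn; ring.
Qed.

Lemma norm_sqrt_from z : circle z -> `|sqrt_from t0 z| = 1.
Proof. by move=> zc; rewrite /sqrt_from zc sqrtC1 mul1r norm_expi. Qed.

Lemma hpowD z (a b : int) : circle z ->
  hpow t0 z (a + b) = hpow t0 z a * hpow t0 z b.
Proof.
by move=> zc; rewrite /hpow expfzDr // -normr_eq0 norm_sqrt_from // oner_eq0.
Qed.

Lemma size_hbasis m l : (l <= m)%N -> (size (hbasis m l) <= m.+1)%N.
Proof.
move=> lm; have s1 (c : C R) : size (c%:P - 'X) = 2%N.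
  by rewrite -opprB size_polyN size_XsubC.
rewrite (leq_trans (size_polyMleq _ _)) //.
have h1 : (size (('i%:P - 'X : {poly C R}) ^+ l) <= l.+1)%N.
  by rewrite (leq_trans (size_poly_exp_leq _ _)) // s1 mul1n.
have h2 : (size ((- 'i%:P - 'X : {poly C R}) ^+ (m - l)) <= (m - l).+1)%N.
  by rewrite (leq_trans (size_poly_exp_leq _ _)) // -polyCN s1 mul1n.
move: h1 h2; move: (size _) (size _) => a b; lia.
Qed.

Lemma cay_ratio_inj : injective (fun x : R => ('i - x%:C%C) / (- 'i - x%:C%C) : C R).
Proof.
move=> x y xy; apply: (@cayZ_inj R 0); rewrite /cayZ; congr (_ * _).
by move: xy; rewrite -![- 'i - _]opprD -![ 'i - _]opprB !invrN !mulrNN ![ 'i + _]addrC.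
Qed.

(** Division by (-i - x)^m turns the combination into a polynomial of size at most m + 1 in u = (i -
    x) / (-i - x). As u is injective in x, the points x = 0, ..., m give m + 1 distinct roots. *)
Lemma hbasis_free m (c : 'I_m.+1 -> C R) :
  \sum_l c l *: hbasis m l = 0 -> forall l, c l = 0.
Proof.
move=> c0; pose P := \poly_(l < m.+1) c (inord l).
suff P0 : P = 0.
  move=> l; have := congr1 (fun p : {poly _} => p`_l) P0.
  by rewrite coef_poly ltn_ord coef0 inord_val.
apply/eqP; apply: contraT => Pn0.
pose u (x : R) : C R := ('i - x%:C%C) / (- 'i - x%:C%C).
pose s := [seq u k%:R | k <- iota 0 m.+1].
have := @max_poly_roots _ P s Pn0; rewrite size_map size_iota.
move=> /(_ _ _)/wrap[]; last by rewrite ltnNge size_poly.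
  apply/allP => _ /mapP[k _ ->]; apply/rootP; rewrite horner_poly.
  set x := k%:R.
  have d0 : - 'i - x%:C%C != 0 :> C R.
    by rewrite -opprD oppr_eq0 addrC xDi_neq0.
  apply: (mulIf (expf_neq0 m d0)); rewrite mul0r mulr_suml.
  have := congr1 (fun p : {poly _} => p.[x%:C%C]) c0.
  rewrite horner0 horner_sum => E; rewrite -[RHS]E; apply: eq_bigr => l _.
  rewrite inord_val hornerZ /hbasis hornerM !horner_exp !hornerE /= -!mulrA; congr (_ * _).
  have lm : (l <= m)%N by rewrite -ltnS.
  rewrite /u expr_div_n -mulrA; congr (_ * _).
  apply: (mulIf (expf_neq0 l d0)); rewrite mulrAC mulVf ?expf_neq0 // mul1r.
  by rewrite -exprD subnK.
rewrite map_inj_uniq ?iota_uniq // => a b /cay_ratio_inj /eqP.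
by rewrite eqr_nat => /eqP.
Qed.

(** These are m + 1 independent elements in a space of dimension m + 1, so the matrix of their
    coefficients is invertible. *)
Lemma hbasis_span m (q : {poly C R}) : (size q <= m.+1)%N ->
  exists c : 'I_m.+1 -> C R, q = \sum_l c l *: hbasis m l.
Proof.
move=> sq; pose B := \matrix_(l < m.+1, k < m.+1) (hbasis m l)`_k.
have sumE (v : 'rV_m.+1) : v *m B = poly_rV (\sum_l v 0 l *: hbasis m l).
  apply/rowP => k; rewrite !mxE coef_sum; apply: eq_bigr => l _.
  by rewrite mxE coefZ.
have ssum (v : 'rV_m.+1) : (size (\sum_l v ord0 l *: hbasis m l)%R <= m.+1)%N.
  apply: (leq_trans (size_sum _ _ _)); apply/bigmax_leqP => l _.
  by rewrite (leq_trans (size_scale_leq _ _)) // size_hbasis // -ltnS.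
have Bu : B \in unitmx.
  rewrite -row_free_unit; apply: inj_row_free => v; rewrite sumE => v0.
  have := congr1 rVpoly v0; rewrite poly_rV_K // linear0 => /hbasis_free H.
  by apply/rowP => l; rewrite mxE -(H l).
exists (fun l => (poly_rV q *m invmx B) ord0 l).
have := sumE (poly_rV q *m invmx B); rewrite mulmxKV // => /(congr1 rVpoly).
by rewrite !poly_rV_K.
Qed.

Lemma natz_half (l m : nat) : (l <= m)%N ->
  (2 * l)%N%:Z - m.+1%:Z + 1 = l%:Z - (m - l)%N%:Z.
Proof. by move=> lm; lia. Qed.

(** The passage from coefficients of symmetric half-integer powers to polynomials; the last clause
    is its injectivity, by [hbasis_free]. *)
Lemma hpow_poly k (v : 'I_k -> C R) : exists p : {poly C R},
  [/\ (size p <= k)%N,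
      forall x, \sum_l v l * hpow t0 (Z x) ((2 * l)%N%:Z - k%:Z + 1) =
        p.[x%:C%C] / (rho x)%:C%C ^+ k.-1
    & p = 0 -> forall l, v l = 0].
Proof.
case: k v => [|m] v.
  exists 0; split=> [|x|_ []//]; first by rewrite size_poly0.
  by rewrite big_ord0 horner0 mul0r.
pose c (l : 'I_m.+1) := v l * (e0 ^+ l / e0 ^+ (m - l)).
exists (\sum_l c l *: hbasis m l); split.
- apply: (leq_trans (size_sum _ _ _)); apply/bigmax_leqP => l _.
  by rewrite (leq_trans (size_scale_leq _ _)) // size_hbasis // -ltnS.
- move=> x; rewrite horner_sum mulr_suml; apply: eq_bigr => l _.
  have lm : (l <= m)%N by rewrite -ltnS.
  by rewrite natz_half // hpow_cay // hornerZ /c -!mulrA.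
move=> /hbasis_free H l; have /eqP := H l.
by rewrite mulf_eq0 mulf_eq0 invr_eq0 !expf_eq0 (negPf (expi_neq0 _)) !andbF !orbF => /eqP.
Qed.

(** Surjectivity of the same passage: it lets an arbitrary polynomial be used as a test function
    built from powers of z. *)
Lemma hpow_span k (q : {poly C R}) : (size q <= k)%N ->
  exists v : 'I_k -> C R, forall x,
    \sum_l v l * hpow t0 (Z x) ((2 * l)%N%:Z - k%:Z + 1) =
    q.[x%:C%C] / (rho x)%:C%C ^+ k.-1.
Proof.
case: k => [|m] sq.
  exists (fun=> 0) => x; rewrite big_ord0.
  by move: sq; rewrite leqn0 size_poly_eq0 => /eqP ->; rewrite horner0 mul0r.
have [c ->] := hbasis_span sq.
exists (fun l => c l / (e0 ^+ l / e0 ^+ (m - l))) => x.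
rewrite horner_sum mulr_suml; apply: eq_bigr => l _.
have lm : (l <= m)%N by rewrite -ltnS.
rewrite natz_half // hpow_cay // hornerZ mulrA divfK ?mulrA //.
by rewrite mulf_neq0 ?invr_eq0 ?expf_neq0 ?expi_neq0.
Qed.

Lemma norm_hpow z m : circle z -> `|hpow t0 z m| = 1.
Proof.
move=> zc; have s1 := norm_sqrt_from zc.
rewrite /hpow; case: m => k; first by rewrite -exprnP normrX s1 expr1n.
by rewrite NegzE -exprnN normfV normrX s1 expr1n invr1.
Qed.

End half_powers.

(** * Real and imaginary parts of polynomials at real points *)

Section complex_polynomials.
Variable R : realType.
Implicit Types (p : {poly C R}) (x : R).

Definition Repoly p : {poly R} := \poly_(i < size p) complex.Re p`_i.
Definition Impoly p : {poly R} := \poly_(i < size p) complex.Im p`_i.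

Lemma coef_Repoly p i : (Repoly p)`_i = complex.Re p`_i.
Proof. by rewrite coef_poly; case: ltnP => // h; rewrite nth_default. Qed.

Lemma coef_Impoly p i : (Impoly p)`_i = complex.Im p`_i.
Proof. by rewrite coef_poly; case: ltnP => // h; rewrite nth_default. Qed.

Lemma horner_ReIm p x : p.[x%:C%C] =
  ((Repoly p).[x])%:C%C + 'i * ((Impoly p).[x])%:C%C.
Proof.
rewrite !horner_poly horner_coef !rmorph_sum mulr_sumr -big_split /=.
apply: eq_bigr => i _; rewrite [p`_i in LHS]complexE !rmorphM !rmorphXn /=.
by rewrite complexiE mulrDl mulrA.
Qed.

Lemma ReIm_poly0 p : Repoly p = 0 -> Impoly p = 0 -> p = 0.
Proof.
move=> r0 i0; apply/polyP => i; rewrite coef0 [LHS]complexE.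
by rewrite -coef_Repoly -coef_Impoly r0 i0 !coef0 mulr0 addr0.
Qed.

End complex_polynomials.

(** * Complex integrals over the circle *)

Section complex_integrals.
Variable R : realType.
Implicit Types (nu s t : borel_charge R) (f g : C R -> C R).

Local Notation Re := (@complex.Re R).
Local Notation Im := (@complex.Im R).

Lemma ReM (a b : C R) : Re (a * b) = Re a * Re b - Im a * Im b.
Proof. by case: a b => ? ? []. Qed.

Lemma ImM (a b : C R) : Im (a * b) = Re a * Im b + Im a * Re b.
Proof. by case: a b => ? ? []. Qed.

Lemma Re_sum (I : Type) (r : seq I) (P : pred I) (F : I -> C R) :
  Re (\sum_(i <- r | P i) F i) = \sum_(i <- r | P i) Re (F i).
Proof. by apply: (big_morph Re) => // -[? ?] []. Qed.

Lemma Im_sum (I : Type) (r : seq I) (P : pred I) (F : I -> C R) :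
  Im (\sum_(i <- r | P i) F i) = \sum_(i <- r | P i) Im (F i).
Proof. by apply: (big_morph Im) => // -[? ?] []. Qed.

Lemma complex_eq (a b : C R) : Re a = Re b -> Im a = Im b -> a = b.
Proof. by case: a b => ? ? [? ?] /= -> ->. Qed.

Lemma cintegrable_eq nu f g : (forall z, circle z -> f z = g z) ->
  cintegrable nu circle f -> cintegrable nu circle g.
Proof.
move=> fg [f1 f2]; have mc := @measurable_circle R.
by split; [move: f1|move: f2]; apply: eq_integrable => // z; rewrite inE => zc;
  rewrite fg.
Qed.

Lemma cint_eq nu f g : (forall z, circle z -> f z = g z) ->
  cint nu circle f = cint nu circle g.
Proof.
by move=> fg; rewrite /cint /sint; congr Complex; congr (_ - _);
  apply: eq_Rintegral => z; rewrite inE => zc; rewrite fg.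
Qed.

Lemma cintegrableZ nu f (c : C R) : cintegrable nu circle f ->
  cintegrable nu circle (fun z => c * f z).
Proof.
move=> [f1 f2]; have mc := @measurable_circle R.
have z1 k := integrableZr' k mc f1; have z2 k := integrableZr' k mc f2.
split.
  apply: eq_integrable (integrableD mc (z1 (Re c)) (z2 (- Im c))) => // z _ /=.
  by rewrite -EFinD ReM mulNr.
apply: eq_integrable (integrableD mc (z2 (Re c)) (z1 (Im c))) => // z _ /=.
by rewrite -EFinD ImM.
Qed.

Lemma cintZ nu f (c : C R) : cintegrable nu circle f ->
  cint nu circle (fun z => c * f z) = c * cint nu circle f.
Proof.
move=> [f1 f2]; have mc := @measurable_circle R.
have z1 k := integrableZr' k mc f1; have z2 k := integrableZr' k mc f2.
apply: complex_eq => /=.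
  rewrite ReM /= -mulNr -!sintZ // -sintD //.
  by congr (sint nu); apply/funext => z; rewrite ReM mulNr.
rewrite ImM /= -!sintZ // -sintD //.
by congr (sint nu); apply/funext => z; rewrite ImM.
Qed.

Lemma cintD nu f g : cintegrable nu circle f -> cintegrable nu circle g ->
  cint nu circle (fun z => f z + g z) = cint nu circle f + cint nu circle g.
Proof.
move=> [f1 f2] [g1 g2]; have mc := @measurable_circle R.
apply: complex_eq; rewrite /= -sintD //; congr (sint nu); apply/funext => z;
  by case: (f z) (g z) => ? ? [].
Qed.

Lemma cintegrable_sum nu (I : Type) (r : seq I) (P : pred I) (F : I -> C R -> C R) :
  (forall i, P i -> cintegrable nu circle (F i)) ->
  cintegrable nu circle (fun z => \sum_(i <- r | P i) F i z).
Proof.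
move=> Fi; have mc := @measurable_circle R; split.
  under eq_fun do rewrite Re_sum.
  by apply: integrable_sumr => // i Pi; have [] := Fi i Pi.
under eq_fun do rewrite Im_sum.
by apply: integrable_sumr => // i Pi; have [] := Fi i Pi.
Qed.

Lemma cint_sum nu (I : Type) (r : seq I) (P : pred I) (F : I -> C R -> C R) :
  (forall i, P i -> cintegrable nu circle (F i)) ->
  cint nu circle (fun z => \sum_(i <- r | P i) F i z) =
  \sum_(i <- r | P i) cint nu circle (F i).
Proof.
move=> Fi; have mc := @measurable_circle R; apply: complex_eq.
  rewrite Re_sum /= -sint_sum // => [|i Pi]; last by have [] := Fi i Pi.
  by congr (sint nu); apply/funext => z; rewrite Re_sum.
rewrite Im_sum /= -sint_sum // => [|i Pi]; last by have [] := Fi i Pi.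
by congr (sint nu); apply/funext => z; rewrite Im_sum.
Qed.

Lemma has_density_cint s D w t f : constant_sign s -> has_density s D w t ->
  cintegrable t circle f ->
  cintegrable s circle (fun z => f z * (Re (w z))%:C%C) /\
  cint t circle f = cint s circle (fun z => f z * (Re (w z))%:C%C).
Proof.
move=> cs st [f1 f2].
have [r1 r2] := has_density_change cs st f1.
have [i1 i2] := has_density_change cs st f2.
have eR : (fun z => Re (f z * (Re (w z))%:C%C)) = (fun z => Re (f z) * Re (w z)).
  by apply/funext => z; rewrite ReM /= mulr0 subr0.
have eI : (fun z => Im (f z * (Re (w z))%:C%C)) = (fun z => Im (f z) * Re (w z)).
  by apply/funext => z; rewrite ImM /= mulr0 add0r.
rewrite /cint eR eI r2 i2; split => //; split.
  by rewrite -[X in integrable _ _ X]/(EFin \o (fun z => Re (f z * (Re (w z))%:C%C))) eR.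
by rewrite -[X in integrable _ _ X]/(EFin \o (fun z => Im (f z * (Re (w z))%:C%C))) eI.
Qed.

Lemma cmeasurable_exp (D : set (C R)) f k : cmeasurable D f ->
  cmeasurable D (fun z => f z ^+ k).
Proof.
move=> mf; elim: k => [|k IH].
  under eq_fun do rewrite expr0; exact: cmeasurable_cst.
by under eq_fun do rewrite exprS; exact: cmeasurableM.
Qed.

Lemma cmeasurable_real (D : set (C R)) (h : C R -> R) :
  measurable_fun (D : set (borelC R)) h -> cmeasurable D (fun z => (h z)%:C%C).
Proof. by move=> mh; split => //; exact: measurable_cst. Qed.

Lemma measurable_rho : measurable_fun setT (@rho R).
Proof.
apply: (measurableT_comp (f := @Num.sqrt R)).
  by apply: continuous_measurable_fun; exact: sqrt_continuous.
by apply: measurable_funD => //; exact: measurable_funX.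
Qed.

(** The branch is defined through a choice of argument, which says nothing about measurability. Off
    the pole it has an explicit expression in [cayX], and the pole is a single point. *)
Lemma cmeasurable_hpow (t0 : R) m : cmeasurable circle (fun z : C R => hpow t0 z m).
Proof.
suff H : cmeasurable circle (sqrt_from t0 : C R -> C R).
  rewrite /hpow; case: m => k; first exact: cmeasurable_exp.
  rewrite NegzE.
  have -> : (fun z => sqrt_from t0 z ^ (- k.+1%:Z)) =
      (fun z : C R => (sqrt_from t0 z ^+ k.+1)^-1).
    by apply/funext => z; rewrite -exprnN.
  by apply: cmeasurableV; exact: cmeasurable_exp.
have mc := @measurable_circle R.
pose D : set (C R) := circle `\ expi t0.
have mD : measurable (D : set (borelC R)).
  by apply: measurableD => //; exact: measurable_set1C.
have cE : circle = [set expi t0] `|` D :> set (C R).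
  apply/seteqP; split=> z; last first.
    by case=> [->|[]//]; exact: norm_expi.
  by move=> zc; have [->|zt] := pselect (z = expi t0); [left|right].
have HD : cmeasurable D (sqrt_from t0 : C R -> C R).
  have [m1 m2] : cmeasurable D (fun z => expi (t0 / 2) *
      (('i + (- 1) * (cayX t0 z)%:C%C) * ((rho (cayX t0 z))%:C%C)^-1)).
    have mX : measurable_fun (D : set (borelC R)) (cayX t0).
      by apply: measurable_funTS; exact: measurable_cayX.
    apply: cmeasurableM; first exact: cmeasurable_cst.
    apply: cmeasurableM.
      apply: cmeasurableD; first exact: cmeasurable_cst.
      by apply: cmeasurableM; [exact: cmeasurable_cst|exact: cmeasurable_real].
    apply: cmeasurableV; apply: cmeasurable_real.
    exact: (measurableT_comp measurable_rho).
  split; [move: m1|move: m2]; apply: eq_measurable_fun => z; rewrite inE => -[zc zt];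
    by rewrite mulN1r -sqrt_from_cayZ cayXK //; apply/eqP.
have [m1 m2] := HD.
by split; rewrite cE; apply/measurable_funU => //;
  try exact: measurable_set1C; split => //; exact: measurable_fun_set1.
Qed.

Lemma hpow_cintegrable nu (t0 : R) m : cintegrable nu circle (fun z => hpow t0 z m).
Proof.
have mc := @measurable_circle R.
have [mu muE] := fin_measure_exists nu.
have i1 : (var_measure nu).-integrable circle (EFin \o (fun=> 1 : R)).
  by apply: eq_measure_integrable (finite_measure_integrable_cst mu 1 mc) => A mA; exact: muE.
have [m1 m2] := cmeasurable_hpow t0 m.
split.
  apply: (@ae_le_integrable _ _ _ _ _ mc (fun=> 1)) i1 => //; apply: aeW => z zc.
  by rewrite normr1 -lecR (le_trans (Re_le_norm _)) // norm_hpow.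
apply: (@ae_le_integrable _ _ _ _ _ mc (fun=> 1)) i1 => //; apply: aeW => z zc.
by rewrite normr1 -lecR (le_trans (Im_le_norm _)) // norm_hpow.
Qed.

End complex_integrals.

(** * AT systems and normality *)

Lemma sum_tagged (V : nmodType) (r : nat) (n : 'I_r -> nat)
    (F : {j : 'I_r & 'I_(n j)} -> V) :
  \sum_p F p = \sum_j \sum_(l < n j) F (Tagged (fun j => 'I_(n j)) l).
Proof. by rewrite sig_big_dep /=; apply: eq_bigr => -[j l]. Qed.

Lemma card_sum_tagged (r : nat) (n : 'I_r -> nat) :
  #|{: {j : 'I_r & 'I_(n j)}}| = (\sum_j n j)%N.
Proof.
rewrite card_tagged sumnE big_map big_enum /=.
by apply: eq_bigr => j _; rewrite card_ord.
Qed.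

Lemma cplx_eq0 (R : realType) (a b : R) :
  a%:C%C + 'i * b%:C%C = 0 :> C R -> a = 0 /\ b = 0.
Proof.
rewrite -complexiE => E.
split; [move/(congr1 (@complex.Re R)): E|move/(congr1 (@complex.Im R)): E] => /= <-; ring.
Qed.

Section at_systems.
Variables (R : realType) (r : nat) (Gamma : 'I_r.+1 -> set (C R)).
Variables (sigma mu : 'I_r.+1 -> borel_charge R) (t0 : R).
Hypothesis nik : nikishin Gamma sigma mu.
Hypothesis nG : forall j, ~ Gamma j (expi t0).

Local Notation X := (cayX t0).
Local Notation Z := (cayZ t0).
Local Notation ib := (ibracket sigma).
Local Notation cwt := (circle_weight sigma).
Local Notation wt := (line_weight sigma t0).

Lemma inord0 : inord 0 = ord0 :> 'I_r.+1.
Proof. by apply: val_inj; rewrite /= inordK. Qed.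

Lemma weight_dom_ib (j : 'I_r.+1) : (0 < j)%N ->
  weight_dom sigma j = cara_dom (ib 1 j).
Proof. by rewrite /weight_dom /ibracket; case: (j : nat) => // k _; rewrite subn1. Qed.

Lemma weight_ib (j : 'I_r.+1) : (0 < j)%N -> weight sigma j = icara (ib 1 j).
Proof. by rewrite /weight /ibracket; case: (j : nat) => // k _; rewrite subn1. Qed.

Lemma Re_weight (j : 'I_r.+1) z : complex.Re (weight sigma j z) = cwt 0 j z.
Proof.
rewrite /circle_weight; have [j0|j0] := posnP j; last by rewrite ltn_eqF // weight_ib.
by rewrite /weight j0 eqxx.
Qed.

Lemma weightE (j : 'I_r.+1) z : Gamma ord0 z -> weight_dom sigma j z ->
  weight sigma j z = (wt 0 j (X z))%:C%C.
Proof.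
move=> Gz; rewrite /line_weight; have [j0|j0] := posnP j; first by rewrite /weight j0 eqxx.
have [zc zt] := Gamma_offpole nik nG Gz.
rewrite ltn_eqF // weight_ib // weight_dom_ib // -{1 2}(cayXK zc zt) => d.
by apply: icara_cayZ => //; apply: ib_offpole nik nG _ _ _; rewrite j0 -ltnS ltn_ord.
Qed.

Lemma mu_has_density (j : 'I_r.+1) :
  has_density (sigma ord0) (weight_dom sigma j) (weight sigma j) (mu j).
Proof.
have mc := @measurable_circle R.
have muE := nikishinE nik j.
have [j0|j0] := posnP j; last first.
  have j0r : (0 < j <= r)%N by rewrite j0 -ltnS ltn_ord.
  have [d i E] := ib_bracket nik j0r; rewrite inord0 in d i E.
  rewrite weight_ib // weight_dom_ib //; split => // A mA.
  by rewrite muE // -E // /ibracket subn0.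
have w1 : weight sigma j = fun=> 1 by rewrite /weight j0.
have [_ mom _ _] := nikishin_generator nik ord0.
rewrite w1; split; first by rewrite /weight_dom j0; exact: aeW.
  by have := mom 0; under eq_fun do rewrite expr0z.
move=> A mA; rewrite muE // j0 /= inord0.
have [b [sE nuE]] := constant_sign_sint (sigma_sign nik ord0).
have mAc : measurable (A `&` (circle : set (C R)) : set (borelC R)).
  exact: measurableI.
have [B [mB B0 sB]] := ae_sigma_Gamma nik ord0.
(* [has_density] integrates over A intersected with the circle, so the complement of the circle must
   be seen to be null. *)
have AE : var_measure (sigma ord0) A = var_measure (sigma ord0) (A `&` (circle : set (C R))).
  rewrite -[in LHS](setIT A) -(setUv (circle : set (C R))) setIUr measureU //.
  - rewrite [X in (_ + X)%E](_ : _ = 0%E) ?adde0 //.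
    apply: (subset_measure0 _ _ _ B0) => //.
      by apply: measurableI => //; exact: measurableC.
    by move=> z [_ zc]; apply: sB => /(Gamma_offpole nik nG)[].
  - by apply: measurableI => //; exact: measurableC.
  - by apply/seteqP; split=> // z [[_ zc] [_]].
apply: complex_eq => /=.
  rewrite sE // nuE // AE /= Rintegral_cst // mul1r; congr (_ * fine _).
by rewrite sE // Rintegral_cst // mul0r mulr0.
Qed.

(** An interior point has an interval of Cayley coordinates around it inside the first arc. By
    separation the bracket on the next arc has no mass over that interval, and [cara_dom_interior]
    applies. *)
Lemma interior_weight_dom (j : 'I_r.+1) :
  circle_interior (Gamma ord0) `<=` weight_dom sigma j.
Proof.
move=> z [zc zin]; have [j0|j0] := posnP j; first by rewrite /weight_dom j0.
have Gz : Gamma ord0 z by apply: (nbhs_singleton zin).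
have [_ zt] := Gamma_offpole nik nG Gz; rewrite weight_dom_ib //.
have zE := cayXK zc zt; rewrite -zE.
have := cayZ_continuous (t0 := t0) (x := X z); rewrite /continuous_at zE => cZ.
have /nbhs_ballP[e /= e0 eG] := cZ _ zin.
have in0 x : `|X z - x| < e -> Gamma (inord 0) (Z x).
  by move=> xe; rewrite inord0; apply: (eG x xe); exact: norm_cayZ.
have j0r : (0 < j <= r)%N by rewrite j0 -ltnS ltn_ord.
have off : offpole t0 (ib 1 j) := ib_offpole nik nG j0r.
have he : X z - e / 2 < X z < X z + e / 2 by apply/andP; split; lra.
rewrite -zE; apply: (cara_dom_interior off _ he).
apply: aeS (ae_sep nik nG j0r) => w; apply; apply: in0.
  by rewrite opprB addrC subrK gtr0_norm //; lra.
by rewrite opprD addrA subrr add0r normrN gtr0_norm //; lra.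
Qed.

Variable n : 'I_r.+1 -> nat.
Hypothesis npar : forall j k, odd (n j) = odd (n k).
Hypothesis nmon : nonincreasing_index n.

Lemma lvl0P z : Gamma ord0 z -> lvl Gamma sigma t0 n 0 (X z) <->
  forall j, (0 < n j)%N -> weight_dom sigma j z.
Proof.
move=> Gz; have [zc zt] := Gamma_offpole nik nG Gz; have zE := cayXK zc zt.
split=> [[_ d] j nj|d].
  have [j0|j0] := posnP j; first by rewrite /weight_dom j0.
  by rewrite weight_dom_ib // -zE; exact: d.
split; first by rewrite inord0 zE.
by move=> j j0 nj; rewrite zE -weight_dom_ib //; exact: d.
Qed.

(** The common denominator is rho^(n_0 - 1), because n_0 - 1 = (n_j - 1) + 2 [halfdiff] and 1 + x^2
    = rho^2. Since the weights are real, a complex form splits into two real forms of level 0. *)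
Lemma cform (p : 'I_r.+1 -> {poly C R}) (w : 'I_r.+1 -> R) x :
  (forall j, (size (p j) <= n j)%N) ->
  \sum_j (p j).[x%:C%C] / (rho x)%:C%C ^+ (n j).-1 * (w j)%:C%C =
  ((rho x)^-1 ^+ (n ord0).-1)%:C%C *
    ((wform n 0 (fun j => Repoly (p j)) w x)%:C%C +
     'i * (wform n 0 (fun j => Impoly (p j)) w x)%:C%C).
Proof.
move=> sp; rewrite /wform !rmorph_sum mulr_sumr -big_split /= mulr_sumr.
apply: eq_big => // j _.
rewrite horner_ReIm !rmorphM !rmorphXn /= fmorphV.
(* For n_j = 0 the truncated predecessor breaks the identity of exponents, but then p_j = 0. *)
have [nj|nj] := posnP (n j).
  have /eqP : size (p j) = 0%N by apply/eqP; rewrite -leqn0 -nj.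
  rewrite size_poly_eq0 => /eqP pj.
  have R0 : Repoly (p j) = 0 by apply/polyP => i; rewrite coef_Repoly pj !coef0.
  have I0 : Impoly (p j) = 0 by apply/polyP => i; rewrite coef_Impoly pj !coef0.
  by rewrite R0 I0 !horner0 !mul0r !mulr0 addr0 !mul0r mulr0.
have h : n ord0 = (n j + (halfdiff n 0 j).*2)%N.
  by rewrite -inord0; apply: n_halfdiff npar nmon _ _ (leq0n j).
have -> : (n ord0).-1 = ((n j).-1 + (halfdiff n 0 j).*2)%N by rewrite h; lia.
have -> : (1 + x ^+ 2)%:C%C = (rho x)%:C%C ^+ 2 :> C R by rewrite -rmorphXn /= rho_sqr.
rewrite -exprM mul2n exprVn exprD.
have key (s A B W : C R) a b : s != 0 -> (A + 'i * B) / s ^+ a * W =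
    (s ^+ a * s ^+ b)^-1 * (A * s ^+ b * W + 'i * (B * s ^+ b * W)).
  by move=> s0; field; rewrite !expf_neq0.
exact: key (rhoC_neq0 x).
Qed.

(** In the Cayley coordinate the function is an explicit continuous factor times a weight continuous
    on [lvl]; composition with [cayX], continuous off the pole, carries this back to the arc. *)
Lemma AT_fun_continuous (p : {j : 'I_r.+1 & 'I_(n j)}) :
  {within [set z | Gamma ord0 z /\ forall j, (0 < n j)%N -> weight_dom sigma j z],
    continuous (AT_fun t0 (weight sigma) (n := n) p)}.
Proof.
case: p => j l; set E := [set z | _].
have nj : (0 < n j)%N by apply: leq_trans (ltn_ord l).
pose m := (n j).-1; have lm : (l <= m)%N by rewrite /m -ltnS prednK.
pose c := expi (t0 / 2) ^+ l / expi (t0 / 2) ^+ (m - l) : C R.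
pose F x : C R := (c * ((hbasis R m l).[x%:C%C] * ((rho x)%:C%C ^+ m)^-1)) * (wt 0 j x)%:C%C.
have FE z : E z -> F (X z) = AT_fun t0 (weight sigma) (n := n) (existT _ j l) z.
  move=> [Gz d]; have [zc zt] := Gamma_offpole nik nG Gz.
  rewrite /AT_fun /= (weightE Gz (d j nj)) /F; congr (_ * _).
  have -> : (2 * l)%N%:Z - (n j)%:Z + 1 = l%:Z - (m - l)%N%:Z.
    by rewrite -natz_half // /m prednK.
  by rewrite -[X in hpow _ X _](cayXK zc zt) hpow_cay.
apply: (@subspace_eq_continuous _ _ _ (fun z => F (X z))).
  by move=> z; rewrite inE; exact: FE.
have cw := wt_continuous nik nG (leq0n j) nj.
have cF : {within lvl Gamma sigma t0 n 0, continuous F}.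
  move=> x; apply: (@for_continuousM (subspace (lvl Gamma sigma t0 n 0)) (C R)
    (fun y => c * ((hbasis R m l).[y%:C%C] * ((rho y)%:C%C ^+ m)^-1)) (fun y =>
        (wt 0 j y)%:C%C)); last first.
    apply: (@continuous_comp (subspace (lvl Gamma sigma t0 n 0)) _ _ (wt 0 j) (fun y : R =>
        y%:C%C : C R) x (cw x)).
    exact: real_complex_continuous.
  have cg : continuous (fun x : R => c * ((hbasis R m l).[x%:C%C] * ((rho x)%:C%C ^+ m)^-1)).
    move=> y; apply: (@for_continuousM _ _ (fun=> c)); first exact: for_continuous_cst.
    apply: (@for_continuousM _ _ (fun x : R => (hbasis R m l).[x%:C%C]) (fun x : R =>
        ((rho x)%:C%C ^+ m)^-1)).
      apply: (@continuous_comp _ _ _ (fun x : R => x%:C%C : C R) (horner (hbasis R m l))).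
        exact: real_complex_continuous.
      exact: poly_continuous.
    apply: for_continuousV; first by rewrite expf_neq0 // rhoC_neq0.
    have cr : {for y, continuous (fun x : R => (rho x)%:C%C : C R)}.
      apply: (@continuous_comp _ _ _ (@rho R) (fun y : R =>
          y%:C%C : C R)); last exact: real_complex_continuous.
      apply: (@continuous_comp _ _ _ (fun y : R =>
          1 + y ^+ 2) (@Num.sqrt R)); last exact: sqrt_continuous.
      apply: (@for_continuousD _ _ (fun=> 1)); first exact: for_continuous_cst.
      exact: exprn_continuous.
    have -> : (fun x : R => (rho x)%:C%C ^+ m) =
        (fun x : R => ('X^m : {poly C R}).[(rho x)%:C%C]).
      by apply/funext => x'; rewrite hornerXn.
    by apply: (@continuous_comp _ _ _ _ (horner ('X^m : {poly C R})) _ cr); exact: poly_continuous.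
  exact: (continuous_subspaceT cg).
apply/subspace_continuousP => z Ez; have [Gz d] := Ez.
have [zc zt] := Gamma_offpole nik nG Gz.
have cX : {for z, continuous X} by exact: cayX_continuous.
move/subspace_continuousP: cF => /(_ (X z) ((lvl0P Gz).2 d)) cF.
apply: cvg_trans cF => W HW; have := cX _ HW.
apply: (@filterS _ _ (nbhs_filter _)) => w H [Gw dw]; apply: H.
exact: (lvl0P Gw).2 dw.
Qed.

(** A vanishing determinant yields coefficients, not all zero, whose combination vanishes at all the
    points. Its real and imaginary parts are forms of level 0 with [deg 0] zeros, so their
    polynomials are zero by [zero_bound], and [hpow_poly] returns zero coefficients. *)
Lemma AT_chebyshev : chebyshev_system
  [set z | Gamma ord0 z /\ forall j, (0 < n j)%N -> weight_dom sigma j z]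
  (AT_fun t0 (weight sigma) (n := n)).
Proof.
split=> [p|z zi zE]; first exact: AT_fun_continuous.
apply/negP => /det0P[v v0 vM].
have Gz k : Gamma ord0 (z k) := (zE k).1.
have zX k : Z (X (z k)) = z k.
  by have [zc zt] := Gamma_offpole nik nG (Gz k); exact: cayXK.
pose u (p : {j : 'I_r.+1 & 'I_(n j)}) : C R := v ord0 (enum_rank p).
pose tg (j : 'I_r.+1) (l : 'I_(n j)) := Tagged (fun j => 'I_(n j)) l.
have uE k : \sum_p u p * AT_fun t0 (weight sigma) (n := n) p (z k) = 0.
  have := congr1 (fun M : 'rV_ _ => M ord0 k) vM; rewrite !mxE => E.
  rewrite (reindex (@enum_rank {j : 'I_r.+1 & 'I_(n j)})) /= in E; last first.
    by apply: onW_bij; exact: enum_rank_bij.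
  by rewrite -[RHS]E; apply: eq_bigr => i _; rewrite mxE enum_rankK.
have [p pP] := choice (fun j => hpow_poly t0 (fun l : 'I_(n j) => u (tg j l))).
have uE' k : \sum_j (p j).[(X (z k))%:C%C] / (rho (X (z k)))%:C%C ^+ (n j).-1 *
    (wt 0 j (X (z k)))%:C%C = 0.
  rewrite -[RHS](uE k) sum_tagged; apply: eq_bigr => j _; have [_ <- _] := pP j.
  rewrite mulr_suml; apply: eq_bigr => l _; rewrite /AT_fun /= zX -mulrA; congr (_ * _).
  have nj : (0 < n j)%N by apply: leq_trans (ltn_ord l).
  by rewrite (weightE (Gz k)) //; exact: (zE k).2.
have sp j : (size (p j) <= n j)%N by have [] := pP j.
pose xs := [seq X (z k) | k <- enum 'I_#|{: {j : 'I_r.+1 & 'I_(n j)}}|].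
have uxs : uniq xs.
  rewrite map_inj_uniq ?enum_uniq // => k l kl.
  by apply: zi; rewrite -zX kl zX.
have deg0 : deg n 0 = #|{: {j : 'I_r.+1 & 'I_(n j)}}|.
  by rewrite card_sum_tagged.
have zb := (zero_bound_nonorthogonal nik nG npar nmon (leq0n r)).1.
have zero (P : 'I_r.+1 -> {poly R}) : (forall j, (size (P j) <= n j)%N) ->
    (forall k, wform n 0 P ((wt 0)^~ (X (z k))) (X (z k)) = 0) -> forall j, P j = 0.
  move=> sP P0 j; apply/eqP; apply: contrapT => /negP Pj.
  apply: (zb P); first by split=> [k _ //|]; exists j.
  exists xs; split=> [//||_ /mapP[k _ ->]].
    by rewrite deg0 size_map size_enum_ord.
  split; last exact: P0.
  by apply/(lvl0P (Gz k)) => i; exact: (zE k).2.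
have ReIm0 k : wform n 0 (fun j => Repoly (p j)) ((wt 0)^~ (X (z k))) (X (z k)) = 0 /\
    wform n 0 (fun j => Impoly (p j)) ((wt 0)^~ (X (z k))) (X (z k)) = 0.
  have := uE' k; rewrite (cform _ _ sp) => /eqP; rewrite mulf_eq0 => /orP[|].
    by rewrite rmorphXn /= fmorphV expf_eq0 invr_eq0 (negPf (rhoC_neq0 _)) andbF.
  by move=> /eqP /cplx_eq0.
have p0 j : p j = 0.
  apply: ReIm_poly0.
    apply: (zero (fun j => Repoly (p j))) => [i|k]; last exact: (ReIm0 k).1.
    exact: leq_trans (size_poly _ _) (sp i).
  apply: (zero (fun j => Impoly (p j))) => [i|k]; last exact: (ReIm0 k).2.
  exact: leq_trans (size_poly _ _) (sp i).
move/eqP: v0; apply; apply/rowP => i; rewrite mxE.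
have := pP (tag (enum_val i)) => -[_ _ /(_ (p0 _) (tagged (enum_val i)))].
by rewrite /u; case: (enum_val i) (enum_valK i) => j l /= ->.
Qed.

Lemma AT_nikishin : AT_system t0 (Gamma ord0) (sigma ord0)
  (weight_dom sigma) (weight sigma) mu n.
Proof.
split.
- exact: nikishin_generator nik ord0.
- move=> j; split; last exact: mu_has_density.
  by have [] := nikishin_measure nik j.
- exact: interior_weight_dom.
- move=> j z Gz d; rewrite (weightE Gz d).
  by apply/complex_realP; exists (wt 0 j (X z)).
- exact: AT_chebyshev.
Qed.

(** * Normality of the index *)

Local Notation N := (index_length n).

Definition phi_moment (m : int) (j : 'I_r.+1) (l : nat) : C R :=
  cint (mu j) circle (fun z => hpow t0 z m * hpow t0 z ((n j)%:Z - (2 * l)%N%:Z)).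

Lemma hpowM_cintegrable nu a b : cintegrable nu circle (fun z => hpow t0 z a * hpow t0 z b).
Proof.
apply: cintegrable_eq (hpow_cintegrable nu t0 (a + b)) => z zc.
by rewrite hpowD.
Qed.

Lemma measurable_wform (P : 'I_r.+1 -> {poly R}) :
  measurable_fun (circle : set (borelC R)) (fun z => wform n 0 P ((cwt 0)^~ z) (X z)).
Proof.
have mX : measurable_fun (circle : set (borelC R)) X.
  by apply: measurable_funTS; exact: measurable_cayX.
have -> : (fun z => wform n 0 P ((cwt 0)^~ z) (X z)) =
    (fun z => \sum_j (P j).[X z] * (1 + X z ^+ 2) ^+ halfdiff n 0 j * cwt 0 j z).
  by apply/funext => z; apply: eq_bigl => j.
apply: measurable_sum => j; apply: measurable_funM;
    last exact: measurable_cwt nik _ _ (leq0n j).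
apply: measurable_funM; first exact: (measurableT_comp (measurable_horner (P j)) mX).
by apply: measurable_funX; apply: measurable_funD => //; exact: measurable_funX.
Qed.

(** The transposed system: v combines the orthogonality conditions into a form annihilating the N
    lower powers of z. These are the symmetric powers of length N times z^(-1/2), while the powers
    in the conditions are symmetric ones times z^(1/2); the two factors cancel. Through [hpow_span]
    the form is then orthogonal to all polynomials of size at most N = [deg 0], which
    [nonorthogonal] forbids unless it is zero. *)
Lemma moment_kernel (v : {j : 'I_r.+1 & 'I_(n j)} -> C R) :
  (forall m : 'I_N, \sum_p v p *
     phi_moment (N%:Z - (2 * m.+1)%N%:Z) (tag p) (tagged p) = 0) ->
  forall p, v p = 0.
Proof.
move=> v0; have mc := @measurable_circle R.
pose tg (j : 'I_r.+1) (l : 'I_(n j)) := Tagged (fun j => 'I_(n j)) l.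
(* The conditions list powers of z in decreasing order, [hpow_poly] in increasing order; hence
   [rev_ord]. *)
pose u (j : 'I_r.+1) (l : 'I_(n j)) := v (tg j (rev_ord l)).
have [p pP] := choice (fun j => hpow_poly t0 (u j)).
have sp j : (size (p j) <= n j)%N by have [] := pP j.
(* The exponent of [rh] collects the denominator rho^(N - 1) of the test function and the
   denominator rho^(n_0 - 1) of the form from [cform]. *)
have key (q : {poly R}) : (size q <= N)%N -> let rh y := (rho y)^-1 ^+ (N.-1 + (n ord0).-1) in
    forall P, P = (fun j => Repoly (p j)) \/ P = (fun j => Impoly (p j)) ->
    let f w := q.[X w] * wform n 0 P ((cwt 0)^~ w) (X w) * rh (X w) in
    (var_measure (sigma ord0)).-integrable circle (EFin \o f) /\
    sint (sigma ord0) circle f = 0.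
  move=> sq rh.
  have sqC : (size (map_poly (real_complex R) q : {poly C R}) <= N)%N by rewrite size_map_poly.
  have [g gP] := hpow_span t0 sqC.
  pose A (m : 'I_N) (s : {j : 'I_r.+1 & 'I_(n j)}) z : C R :=
    (g m * v s) * (hpow t0 z (N%:Z - (2 * (rev_ord m).+1)%N%:Z) *
    hpow t0 z ((n (tag s))%:Z - (2 * tagged s)%N%:Z) * (cwt 0 (tag s) z)%:C%C).
  have dens m (s : {j : 'I_r.+1 & 'I_(n j)}) :=
    has_density_cint (sigma_sign nik ord0) (mu_has_density (tag s))
      (hpowM_cintegrable (mu (tag s)) (N%:Z - (2 * (@rev_ord N m).+1)%N%:Z)
        ((n (tag s))%:Z - (2 * tagged s)%N%:Z)).
  have Ai m s : cintegrable (sigma ord0) circle (A m s).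
    apply: cintegrableZ; have [+ _] := dens m s.
    by apply: cintegrable_eq => z _; rewrite Re_weight.
  pose H z := \sum_m \sum_s A m s z.
  have Hi : cintegrable (sigma ord0) circle H.
    by apply: cintegrable_sum => m _; apply: cintegrable_sum => s _; exact: Ai.
  have H0 : cint (sigma ord0) circle H = 0.
    rewrite cint_sum => [|m _]; last by apply: cintegrable_sum => s _; exact: Ai.
    rewrite big1 // => m _; rewrite cint_sum => [|s _]; last exact: Ai.
    transitivity (g m * \sum_s v s * phi_moment (N%:Z - (2 * (rev_ord m).+1)%N%:Z)
      (tag s) (tagged s)); last by rewrite v0 mulr0.
    rewrite mulr_sumr; apply: eq_bigr => s _.
    rewrite mulrA cintZ.
      congr (_ * _); rewrite /phi_moment (dens m s).2.
      by apply: cint_eq => z _; rewrite Re_weight.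
    by have [+ _] := dens m s; apply: cintegrable_eq => z _; rewrite Re_weight.
  have HE z : circle z -> z != expi t0 -> H z = (q.[X z] * rh (X z))%:C%C *
     ((wform n 0 (fun j => Repoly (p j)) ((cwt 0)^~ z) (X z))%:C%C +
     'i * (wform n 0 (fun j => Impoly (p j)) ((cwt 0)^~ z) (X z))%:C%C).
    move=> zc zt; have zE := cayXK zc zt.
    transitivity ((\sum_m g m * hpow t0 z ((2 * m)%N%:Z - N%:Z + 1)) *
      \sum_j (\sum_l u j l * hpow t0 z ((2 * l)%N%:Z - (n j)%:Z + 1)) * (cwt 0 j z)%:C%C).
      rewrite mulr_suml; apply: eq_bigr => m _; rewrite sum_tagged mulr_sumr.
      apply: eq_bigr => j _; rewrite (reindex_inj rev_ord_inj) /= mulr_suml mulr_sumr.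
      apply: eq_bigr => l _; rewrite /A /= -/(tg j _) -/(u j l).
      have -> : hpow t0 z (N%:Z - (2 * (N - m.+1).+1)%N%:Z) * hpow t0 z ((n j)%:Z - (2 * (n j - l.+1))%N%:Z) =
          hpow t0 z ((2 * m)%N%:Z - N%:Z + 1) * hpow t0 z ((2 * l)%N%:Z - (n j)%:Z + 1).
        rewrite -!hpowD //; congr hpow.
        by have := ltn_ord m; have := ltn_ord l; lia.
      by rewrite /=; ring.
    rewrite -zE gP zE.
    under [X in _ * X]eq_bigr => j _.
      have [_ E _] := pP j; rewrite -zE E zE; over.
    rewrite cform // horner_map /=.
    rewrite rmorphM /= /rh exprD rmorphM /= !rmorphXn /= fmorphV.
    by rewrite !exprVn /=; ring.
  have mrh : measurable_fun (circle : set (borelC R)) (fun z => rh (X z)).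
    apply: (measurableT_comp (f := rh)); last
        by apply: measurable_funTS; exact: measurable_cayX.
    apply: measurable_funX; apply: (measurableT_comp (@measurable_invr R)).
    exact: measurable_rho.
  have mf P : measurable_fun (circle : set (borelC R))
      (fun w => q.[X w] * wform n 0 P ((cwt 0)^~ w) (X w) * rh (X w)).
    apply: measurable_funM => //; apply: measurable_funM; last exact: measurable_wform.
    have mX : measurable_fun (circle : set (borelC R)) X.
      by apply: measurable_funTS; exact: measurable_cayX.
    exact: (measurableT_comp (measurable_horner q) mX).
  have off : offpole t0 (sigma ord0).
    by apply: aeS (ae_sigma_Gamma nik ord0) => w /(Gamma_offpole nik nG).
  have [H1 H2] := Hi.
  have mH1 := (measurable_EFinP _ _).1 (measurable_int _ H1).
  have mH2 := (measurable_EFinP _ _).1 (measurable_int _ H2).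
  (* As q, the weights and [rh] are real, the real and imaginary parts of H separate the two real
     forms. *)
  move=> P [->|->] f.
    have Hf : {ae var_measure (sigma ord0), forall z, circle z -> complex.Re (H z) = f z}.
      apply: aeS off => z [zc zt] _; rewrite HE // -complexiE /f /=; ring.
    split; first exact: (ae_eq_integrable mc (mf _) Hf H1).
    rewrite -(ae_eq_sint mc mH1 (mf _) Hf).
    by have /(congr1 (@complex.Re R)) := H0.
  have Hf : {ae var_measure (sigma ord0), forall z, circle z -> complex.Im (H z) = f z}.
    apply: aeS off => z [zc zt] _; rewrite HE // -complexiE /f /=; ring.
  split; first exact: (ae_eq_integrable mc (mf _) Hf H2).
  rewrite -(ae_eq_sint mc mH2 (mf _) Hf).
  by have /(congr1 (@complex.Im R)) := H0.
have no := (zero_bound_nonorthogonal nik nG npar nmon (leq0n r)).2.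
have zero P : P = (fun j => Repoly (p j)) \/ P = (fun j => Impoly (p j)) ->
    forall j, P j = 0.
  move=> PE j; apply/eqP; apply: contrapT => /negP Pj.
  apply: (no P (fun y => (rho y)^-1 ^+ (N.-1 + (n ord0).-1)) false).
  - split; last by exists j.
    by move=> k _; case: PE => ->; exact: leq_trans (size_poly _ _) (sp k).
  - by apply: aeW => w; rewrite expr0 mul1r exprn_gt0 // invr_gt0 rho_gt0.
  - by move=> q sq; rewrite inord0; exact: key.
have p0 j : p j = 0.
  by apply: ReIm_poly0; [apply: (zero (fun j => Repoly (p j))); left|apply: (zero (fun j =>
      Impoly (p j))); right].
move=> [j l]; have [_ _ /(_ (p0 j) (rev_ord l))] := pP j.
by rewrite /u rev_ordK.
Qed.

(** Orthogonality is a linear system for the coefficients of phi, square because the number of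
    conditions is N. [moment_kernel] says that the rows of its matrix are independent; the transpose
    is then both full and free, which gives existence and uniqueness. *)
Lemma phi_normal_nikishin : phi_normal t0 mu n.
Proof.
pose I := {j : 'I_r.+1 & 'I_(n j)}.
pose a (i : 'I_#|{: I}|) (m : 'I_N) : C R :=
  phi_moment (N%:Z - (2 * m.+1)%N%:Z) (tag (enum_val i)) (tagged (enum_val i)).
pose A := \matrix_(i, m) a i m.
pose b := \row_i phi_moment N%:Z (tag (@enum_val I predT i)) (tagged (@enum_val I predT i)).
have cN : #|{: I}| = N by rewrite card_sum_tagged.
have Afree : row_free A.
  apply: inj_row_free => v vA.
  have vE : forall p : I, v ord0 (enum_rank p) = 0.
    apply: moment_kernel => m.
    have := congr1 (fun M : 'rV_ _ => M ord0 m) vA; rewrite !mxE => E.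
    rewrite (reindex (@enum_rank I)) /= in E; last first.
      by apply: onW_bij; exact: enum_rank_bij.
    by rewrite -[RHS]E; apply: eq_bigr => p _; rewrite mxE /a enum_rankK.
  by apply/rowP => i; rewrite mxE -(enum_valK i) vE.
have rA : \rank A = #|{: I}| by apply/eqP.
have Tfull : row_full A^T by rewrite /row_full mxrank_tr rA.
have Tfree : row_free A^T by rewrite /row_free mxrank_tr rA cN.
have orthE (k : 'rV[C R]_N) (phi : C R -> C R) :
    (forall z, phi z = hpow t0 z N%:Z +
      \sum_(l < N) k ord0 l * hpow t0 z (N%:Z - (2 * l.+1)%N%:Z)) ->
    phi_orthogonal t0 mu n phi <-> k *m A^T = - b.
  move=> phiE.
  have E (p : I) : cint (mu (tag p)) circle
      (fun z => phi z * hpow t0 z ((n (tag p))%:Z - (2 * tagged p)%N%:Z)) =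
      phi_moment N%:Z (tag p) (tagged p) +
      \sum_m k ord0 m * phi_moment (N%:Z - (2 * m.+1)%N%:Z) (tag p) (tagged p).
    pose h z := hpow t0 z ((n (tag p))%:Z - (2 * tagged p)%N%:Z).
    have hi a' : cintegrable (mu (tag p)) circle (fun z => hpow t0 z a' * h z).
      exact: hpowM_cintegrable.
    have si : cintegrable (mu (tag p)) circle (fun z =>
        \sum_m k ord0 m * (hpow t0 z (N%:Z - (2 * m.+1)%N%:Z) * h z)).
      by apply: cintegrable_sum => m _; apply: cintegrableZ; exact: hi.
    transitivity (cint (mu (tag p)) circle (fun z => hpow t0 z N%:Z * h z +
        \sum_m k ord0 m * (hpow t0 z (N%:Z - (2 * m.+1)%N%:Z) * h z))).
      apply: cint_eq => z _; rewrite phiE mulrDl mulr_suml; congr (_ + _).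
      by apply: eq_bigr => m _; rewrite mulrA.
    rewrite cintD // cint_sum => [|m _]; last by apply: cintegrableZ; exact: hi.
    by congr (_ + _); apply: eq_bigr => m _; rewrite cintZ //; exact: hi.
  have E2 i : (k *m A^T) ord0 i = \sum_m k ord0 m * a i m.
    by rewrite mxE; apply: eq_bigr => m _; rewrite !mxE.
  split=> [orth|kE j l].
    apply/rowP => i; rewrite E2 [RHS]mxE [X in - X]mxE; apply/eqP.
    by rewrite -addr_eq0 addrC -E; apply/eqP; exact: orth.
  have := congr1 (fun M : 'rV_ _ => M ord0 (enum_rank (Tagged (fun j => 'I_(n j)) l : I))) kE.
  rewrite E2 [RHS]mxE [X in - X]mxE => /eqP; rewrite -addr_eq0 addrC => /eqP.
  by rewrite /a enum_rankK => <-; rewrite -E.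
have [k kE] : exists k : 'rV[C R]_N, - b = k *m A^T by apply/submxP; exact: submx_full.
exists (fun z => hpow t0 z N%:Z +
   \sum_(l < N) k ord0 l * hpow t0 z (N%:Z - (2 * l.+1)%N%:Z)).
split.
  split; first by exists (k ord0).
  by apply/(orthE k) => //; rewrite -kE.
move=> phi [[k' phiE] orth]; pose kk : 'rV[C R]_N := \row_l k' l.
have phiE' z : phi z = hpow t0 z N%:Z +
    \sum_(l < N) kk ord0 l * hpow t0 z (N%:Z - (2 * l.+1)%N%:Z).
  by rewrite phiE; congr (_ + _); apply: eq_bigr => l _; rewrite mxE.
have /(row_free_inj Tfree) -> : k *m A^T = kk *m A^T.
  by rewrite -kE; apply/esym/(orthE kk phi phiE').
by apply/funext => z; rewrite phiE'.
Qed.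

End at_systems.

Theorem theorem13 (R : realType) (r : nat)
  (Gamma : 'I_r.+1 -> set (C R)) (sigma mu : 'I_r.+1 -> borel_charge R)
  (t0 : R) :
  nikishin Gamma sigma mu ->
  (forall j, ~ Gamma j (expi t0)) ->
  [/\ forall n : 'I_r.+1 -> nat,
        (forall j, odd (n j)) -> nonincreasing_index n ->
        AT_system t0 (Gamma ord0) (sigma ord0)
          (weight_dom sigma) (weight sigma) mu n,
      forall n : 'I_r.+1 -> nat,
        (forall j, ~~ odd (n j)) -> nonincreasing_index n ->
        AT_system t0 (Gamma ord0) (sigma ord0)
          (weight_dom sigma) (weight sigma) mu n
    & forall n : 'I_r.+1 -> nat,
        (forall j, odd (n j)) \/ (forall j, ~~ odd (n j)) ->
        nonincreasing_index n ->
        phi_normal t0 mu n].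
Proof.
move=> nik nG; split=> n npar nmon.
- by apply: (AT_nikishin nik nG) nmon => j k; rewrite !npar.
- by apply: (AT_nikishin nik nG) nmon => j k; rewrite !(negPf (npar _)).
- apply: (phi_normal_nikishin nik nG) nmon => j k.
  by case: npar => npar; rewrite ?npar // !(negPf (npar _)).
Qed.
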